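(* Let $X\subset\mathbb{P}^5_{\mathbb{C}}$ be a general cubic fourfold. The rational map $\psi:\tilde{F}\dashrightarrow X$, sending a pair $(\ell,\Pi)$ with $X\cap\Pi=2\ell+\ell'$ and $\ell\neq\ell'$ to the point $\ell\cap\ell'$, is resolved by blowing up $\tilde{V}$, and the resolution morphism is given by the composition $$\mathrm{Bl}_{\tilde{V}}\tilde{F}\to\tilde{I}\to I\to X,$$ where the first morphism sends, outside the exceptional divisor, a point $(\ell,\Pi)$ with $X\cap\Pi=2\ell+\ell'$ to the point $(\ell\cap\ell',(\ell,\Pi))$ of $\tilde I$, and identifies the fibre of the exceptional divisor over $(\ell,\Pi)\in\tilde{V}$ with the line $\ell$ (the fibre of $\tilde I\to\tilde F$ over $(\ell,\Pi)$).
   Context: ''General'' means: for $X$ in some dense Zariski-open subset of $|\mathcal{O}_{\mathbb{P}^5}(3)|$; in particular $X$ is smooth and contains no plane. $F\subset\mathrm{G}(2,6)$ is the Fano scheme of lines in $X$, $S\subset F$ the smooth surface of second type lines (those with $N_{\ell/X}\cong\mathcal{O}(1)^2\oplus\mathcal{O}(-1)$), and $V\subset F$ the locus of triple lines (those $\ell$ for which there is a 2-plane $\Pi$ with $\Pi\cap X=3\ell$). $\tilde{F}=\{(\ell,\Pi):\Pi\text{ is a 2-plane tangent to }X\text{ along }\ell\}\subset\mathrm{G}(2,6)\times\mathrm{G}(3,6)$, which is isomorphic to the blowup $\mathrm{Bl}_S F$; for $(\ell,\Pi)\in\tilde F$ one has $X\cap\Pi=2\ell+\ell'$, with $\ell'$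 the residual line. $\tilde{V}=\{(\ell,\Pi)\in\tilde{F}:\Pi\cap X=3\ell\}$ is the strict transform of $V$. $I=\{(x,\ell):x\in\ell\}\subset X\times F$ is the universal line, $\tilde{I}=\{(x,(\ell,\Pi)):x\in\ell\}\subset X\times\tilde{F}$ its pullback to $\tilde F$; $\tilde{I}\to I$ is $(x,(\ell,\Pi))\mapsto(x,\ell)$ and $I\to X$ is the projection. *)

(* Defs.v *)
From HB Require Import structures.
From mathcomp Require Import all_boot all_order all_algebra.
From mathcomp Require Import complex mpoly.
From mathcomp Require Import boolp classical_sets functions filter reals.
From mathcomp Require Import topology_structure initial_topology.
From mathcomp Require Import subtype_topology.

Set Implicit Arguments.
Unset Strict Implicit.
Unset Printing Implicit Defensive.

Import GRing.Theory.
Local Open Scope classical_set_scope.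
Local Open Scope ring_scope.

(** * Spaces with functions

    Varieties are treated classically, as spaces with functions: a topological
    space together with, at each point x, the K-valued functions that are
    regular at x, i.e. that restrict to a section of the structure sheaf on some
    open neighbourhood of x.  Functions are total, and [regular_germ] says that
    regularity at x depends only on the germ at x. *)

Record fspace (K : fieldType) := FSpace {
  fcarrier :> topologicalType;
  regular_at : (fcarrier -> K) -> fcarrier -> Prop;
  regular_germ : forall (x : fcarrier) (h h' : fcarrier -> K),
    (\forall y \near x, h' y = h y) -> regular_at h x -> regular_at h' x }.

Section Spaces.
Variable K : fieldType.
Implicit Types T S X Y B : fspace K.

Definition regular_on T (U : set T) (h : T -> K) : Prop :=
  forall x, U x -> regular_at h x.

Definition morphism T S (g : T -> S) : Prop :=
  continuous g /\
  forall (t : T) (h : S -> K), regular_at h (g t) -> regular_at (h \o g) t.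

Definition isomorphism T S (g : T -> S) : Prop :=
  morphism g /\ exists g', [/\ morphism g', cancel g g' & cancel g' g].

(** A subset with the induced topology and the induced (reduced) structure. *)
Definition fsub_regular T (A : set T) (h : A -> K) (x : A) : Prop :=
  exists g : T -> K, regular_at g (set_val x) /\
    \forall y \near x, h y = g (set_val y).

Lemma fsub_germ T (A : set T) (x : A) (h h' : A -> K) :
  (\forall y \near x, h' y = h y) -> fsub_regular h x -> fsub_regular h' x.
Proof.
by move=> e [g [rg hg]]; exists g; split=> //; apply: filterS2 e hg => y ->.
Qed.

Definition fsub T (A : set T) : fspace K := FSpace (@fsub_germ T A).

Definition fsub_mk T (A : set T) (x : T) (Ax : A x) : fsub A :=
  exist (fun y => y \in A) x (mem_set Ax).

(** Product of varieties: its topology is not the product topology, but the one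
    generated by the loci where a sum of a_i (x) * b_i (y) does not vanish. *)
Definition tensor T S n (a : 'I_n -> T -> K) (b : 'I_n -> S -> K)
  (p : T * S) : K := \sum_(i < n) a i p.1 * b i p.2.

Definition zprod T S : Type := (T * S)%type.
HB.instance Definition _ T S := Choice.on (zprod T S).

Definition zprod_subbase T S : set (set (zprod T S)) :=
  [set W | exists (U : set T) (V : set S) (n : nat)
             (a : 'I_n -> T -> K) (b : 'I_n -> S -> K),
    [/\ open U, open V, forall i, regular_on U (a i),
        forall i, regular_on V (b i) &
        W = [set p | [/\ U p.1, V p.2 & tensor a b p != 0]]]].

HB.instance Definition _ T S :=
  @isSubBaseTopological.Build (zprod T S) (set (zprod T S))
    (@zprod_subbase T S) id.

Definition vprod_regular T S (h : zprod T S -> K) (p : zprod T S) : Prop :=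
  exists n (a : 'I_n -> T -> K) (b : 'I_n -> S -> K)
         m (c : 'I_m -> T -> K) (d : 'I_m -> S -> K),
    [/\ forall i, regular_at (a i) p.1 /\ regular_at (b i) p.2,
        forall i, regular_at (c i) p.1 /\ regular_at (d i) p.2,
        tensor c d p != 0 &
        \forall q \near p, h q = tensor a b q / tensor c d q].

Lemma vprod_germ T S (p : zprod T S) (h h' : zprod T S -> K) :
  (\forall q \near p, h' q = h q) -> vprod_regular h p -> vprod_regular h' p.
Proof.
move=> e [n [a [b [m [c [d [rab rcd nz hq]]]]]]].
exists n, a, b, m, c, d; split=> //.
by apply: filterS2 e hq => q ->.
Qed.

Definition vprod T S : fspace K := FSpace (@vprod_germ T S).

(** Affine space. *)
Definition zaff n : Type := 'rV[K]_n.
HB.instance Definition _ n := Choice.on (zaff n).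

Definition zaff_subbase n : set (set (zaff n)) :=
  [set W | exists Q : {mpoly K[n]}, W = [set x : zaff n | Q.@[x ord0] != 0]].

HB.instance Definition _ n :=
  @isSubBaseTopological.Build (zaff n) (set (zaff n)) (@zaff_subbase n) id.

Definition aff_regular n (h : zaff n -> K) (x : zaff n) : Prop :=
  exists P Q : {mpoly K[n]}, Q.@[x ord0] != 0 /\
    \forall y \near x, h y = P.@[y ord0] / Q.@[y ord0].

Lemma aff_germ n (x : zaff n) (h h' : zaff n -> K) :
  (\forall y \near x, h' y = h y) -> aff_regular h x -> aff_regular h' x.
Proof.
move=> e [P [Q [nz hy]]]; exists P, Q; split=> //.
by apply: filterS2 e hy => y ->.
Qed.

Definition aff n : fspace K := FSpace (@aff_germ n).

Definition affine_variety Y : Prop :=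
  exists n (A : set (aff n)) (g : Y -> fsub A), closed A /\ isomorphism g.

Definition separated Y : Prop :=
  closed ([set p | p.1 = p.2] : set (vprod Y Y)).

Definition variety Y : Prop :=
  separated Y /\
  exists n (U : 'I_n -> set Y),
    (forall i, open (U i) /\ affine_variety (fsub (U i))) /\
    \bigcup_i U i = setT.

(** * Blowups *)

(** Germs at y of functions in the ideal sheaf of Z (with reduced structure). *)
Definition ideal_at Y (Z : set Y) (y : Y) (h : Y -> K) : Prop :=
  regular_at h y /\ \forall y' \near y, Z y' -> h y' = 0.

(** Germs at t of the inverse image ideal sheaf of Z under g. *)
Definition inverse_ideal_at T Y (g : T -> Y) (Z : set Y) (t : T) (h : T -> K)
    : Prop :=
  exists n (a : 'I_n -> T -> K) (b : 'I_n -> Y -> K),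
    (forall i, regular_at (a i) t /\ ideal_at Z (g t) (b i)) /\
    \forall s \near t, h s = \sum_(i < n) a i s * b i (g s).

Definition nonzerodivisor_at T (e : T -> K) (t : T) : Prop :=
  regular_at e t /\
  forall a : T -> K, regular_at a t ->
    (\forall s \near t, a s * e s = 0) -> \forall s \near t, a s = 0.

(** The inverse image of Z under g is an effective Cartier divisor. *)
Definition cartier_preimage T Y (g : T -> Y) (Z : set Y) : Prop :=
  forall t : T, exists e : T -> K, nonzerodivisor_at e t /\
    forall h : T -> K, inverse_ideal_at g Z t h <->
      exists a : T -> K, regular_at a t /\ \forall s \near t, h s = a s * e s.

(** [beta : B -> Y] is the blowup of Y along Z, by the universal property. *)
Definition is_blowup B Y (beta : B -> Y) (Z : set Y) : Prop :=
  [/\ variety B, morphism beta, cartier_preimage beta Z &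
      forall T (g : T -> Y),
        variety T -> morphism g -> cartier_preimage g Z ->
        exists! g' : T -> B, morphism g' /\ beta \o g' = g].

(** * Rational maps *)

Record ratmap Y X := RatMap {
  rdom : set Y;
  rfun :> fsub rdom -> X;
  rdom_open : open rdom;
  rdom_dense : dense rdom;
  rfun_morphism : morphism rfun }.

Definition resolves B Y X (beta : B -> Y) (psi : ratmap Y X) (chi : B -> X)
    : Prop :=
  [/\ morphism chi, dense (beta @^-1` rdom psi) &
      forall (b : B) (y : fsub (rdom psi)), set_val y = beta b ->
        chi b = psi y].

(** * Grassmannians *)

Section Grassmannian.
Variables (V : vectType K) (k : nat).

Definition grass : Type := {W : {vspace V} | \dim W == k}.
HB.instance Definition _ := Choice.on grass.

Definition vsp (W : grass) : {vspace V} := val W.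

Definition plucker_index : finType := {ffun 'I_k -> 'I_(\dim {:V})}.

(** All k x k minors of a basis, indexed by arbitrary sequences of k columns:
    the usual Pluecker coordinates, with repetitions up to sign and zeros.  They
    depend on the chosen basis of W only through a common factor. *)
Definition plucker (W : grass) (s : 'I_#|plucker_index|) : K :=
  \det (\matrix_(i < k, j < k)
    coord (vbasis {:V}) ((enum_val s : plucker_index) j)
      (vbasis (vsp W))`_i).

Definition grass_subbase : set (set grass) :=
  [set D | exists d (Q : {mpoly K[#|plucker_index|]}),
     Q \is d.-homog /\ D = [set W | Q.@[plucker W] != 0]].

HB.instance Definition _ :=
  @isSubBaseTopological.Build grass (set grass) grass_subbase id.

Definition grass_regular (h : grass -> K) (W : grass) : Prop :=
  exists d (P Q : {mpoly K[#|plucker_index|]}),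
    [/\ P \is d.-homog, Q \is d.-homog, Q.@[plucker W] != 0 &
        \forall W' \near W, h W' = P.@[plucker W'] / Q.@[plucker W']].

Lemma grass_germ (W : grass) (h h' : grass -> K) :
  (\forall W' \near W, h' W' = h W') -> grass_regular h W ->
  grass_regular h' W.
Proof.
move=> e [d [P [Q [hP hQ nz hW]]]]; exists d, P, Q; split=> //.
by apply: filterS2 e hW => W' ->.
Qed.

Definition Gr : fspace K := FSpace grass_germ.

End Grassmannian.
End Spaces.

(** * Cubic fourfolds *)

Section Cubic.
Variable K : fieldType.
Local Notation V := 'rV[K]_6.
Local Notation cubic_form := (dhomog 6 K 3).

(** The linear system |O(3)| on P^5. *)
Definition cubics : fspace K := Gr cubic_form 1.

Variable f : cubic_form.

Definition evalf (v : V) : K := (val f).@[v ord0].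

(** The derivative of f at v in the direction w. *)
Definition dirder (v w : V) : K :=
  \sum_(i < 6) ((val f)^`M(i)).@[v ord0] * w ord0 i.

(** The (k-1)-planes of P^5 contained in the hypersurface f = 0. *)
Definition linear_subspaces k : set (Gr V k) :=
  [set W | forall v, v \in vsp W -> evalf v = 0].

Definition Xf : fspace K := fsub (@linear_subspaces 1).
Definition Ff : fspace K := fsub (@linear_subspaces 2).

Definition incidentI : set (vprod Xf Ff) :=
  [set p | (vsp (set_val p.1) <= vsp (set_val p.2))%VS].
Definition If : fspace K := fsub incidentI.

Definition tangent_pairs : set (vprod (Gr V 2) (Gr V 3)) :=
  [set p | [/\ linear_subspaces p.1, (vsp p.1 <= vsp p.2)%VS &
     forall v w, v \in vsp p.1 -> w \in vsp p.2 -> dirder v w = 0]].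
Definition Ftilde : fspace K := fsub tangent_pairs.

Definition line_of (p : Ftilde) : Gr V 2 := (set_val p).1.
Definition plane_of (p : Ftilde) : Gr V 3 := (set_val p).2.

Definition incidentIt : set (vprod Xf Ftilde) :=
  [set p | (vsp (set_val p.1) <= vsp (line_of p.2))%VS].
Definition Itilde : fspace K := fsub incidentIt.

Lemma line_of_subproof (p : Ftilde) : @linear_subspaces 2 (line_of p).
Proof. by case: (set_valP p). Qed.

Definition Ftilde_to_F (p : Ftilde) : Ff := fsub_mk (@line_of_subproof p).

Lemma Itilde_to_I_subproof (q : Itilde) :
  incidentI ((set_val q).1, Ftilde_to_F (set_val q).2).
Proof. exact: (set_valP q). Qed.

Definition Itilde_to_I (q : Itilde) : If := fsub_mk (@Itilde_to_I_subproof q).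

Definition I_to_X (q : If) : Xf := (set_val q).1.

Definition Itilde_to_Ftilde (q : Itilde) : Ftilde := (set_val q).2.

(** The cubic cut out on the plane P is l1 + l2 + l3 as a divisor on P: the
    restriction of f to P is a product of linear forms defining the l_i. *)
Definition plane_section (P : Gr V 3) (l1 l2 l3 : Gr V 2) : Prop :=
  exists a1 a2 a3 : 'Hom(V, K^o),
    [/\ forall v, v \in vsp P -> evalf v = a1 v * a2 v * a3 v,
        vsp l1 = (vsp P :&: lker a1)%VS,
        vsp l2 = (vsp P :&: lker a2)%VS &
        vsp l3 = (vsp P :&: lker a3)%VS].

Definition Vtilde : set Ftilde :=
  [set p | plane_section (plane_of p) (line_of p) (line_of p) (line_of p)].

(** The residual line l' is distinct from l, and meets it in the point x. *)
Definition residual_point (p : Ftilde) (x : Xf) : Prop :=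
  exists l' : Gr V 2,
    [/\ plane_section (plane_of p) (line_of p) (line_of p) l',
        line_of p <> l' &
        vsp (set_val x) = (vsp (line_of p) :&: vsp l')%VS].

End Cubic.

Arguments Vtilde {K} f _.
Arguments Itilde_to_I {K} f _.
Arguments I_to_X {K} f _.
Arguments Itilde_to_Ftilde {K} f _.

(* Main.v *)
(** Let T be the symmetric trilinear form of f.  Points of Ftilde are flags
    l < P with T(l, l, P) = 0; if X contains no plane, such a flag lies in Vtilde
    iff moreover T(l, P, P) = 0.  The blowup is the contact locus C of points
    (x, (l, P)) of Itilde with T(x, P, P) = 0: off Vtilde the point x is unique
    and is the residual point, over Vtilde every x of l is allowed.

    In a frame v0, v1, v2 adapted to the flag, Vtilde has the two equations
    s_i = T(v_i, v2, v2), i = 0, 1, and C is the locus s_0 = 0 for frames with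
    x = <v0>.  For general X the differentials of the nine equations
    T(v_i, v_j, v_k) = 0 with (i, j, k) other than (2, 2, 2) are independent
    along Vtilde.  Hence, by the Nullstellensatz, the s_i generate the ideal of
    Vtilde, and s_1 is a nonzerodivisor on C, whose local rings are domains.  So
    the inverse image of Vtilde in C is a Cartier divisor; conversely, if
    s_i = a_i e with e a local equation of the inverse image of Vtilde in some T,
    then a_0 and a_1 generate the unit ideal and x = <a_1 v0 - a_0 v1> lifts
    T -> Ftilde to C, uniquely since C is separated.

    Independence of the differentials fails only on a proper closed set of
    cubics: it follows from the smoothness of X and the absence of certain
    degenerate frames, and each excluded configuration is put into a normal form
    by elementary operations on the coordinates and then has more conditions than
    parameters.  A set of cubics covered by polynomial images of a smaller affine
    space lies in a hypersurface. *)

From HB Require Import structures.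
From mathcomp Require Import finmap.
From mathcomp Require Import all_boot all_order all_fingroup all_algebra.
From mathcomp Require Import complex mpoly ring lra.
From mathcomp Require Import boolp classical_sets functions filter reals.
From mathcomp Require Import topology_structure initial_topology subtype_topology.
Require Import Defs.

Set Implicit Arguments.
Unset Strict Implicit.
Unset Printing Implicit Defensive.

Import Order.TTheory GRing.Theory Num.Theory.
Local Open Scope classical_set_scope.
Local Open Scope ring_scope.

(** * Commutative algebra *)

(** Local rings are not computed on [Ftilde] or on the contact locus. A frame (v0, v1, v2) is a
    point of the affine space of 3 by 6 matrices, where the equations are polynomials; near a given
    flag a moving frame is a section of the space of frames, and ideal membership is proved among
    polynomials and pulled back along this section. The algebra behind this is that r polynomials
    with independent differentials at a common zero generate a prime ideal locally. It is proved by
    truncation: modulo each power of the maximal ideal the equations can be straightened to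
    coordinates, where orders of vanishing add up, and Krull's theorem returns to the localisation.
    With the Nullstellensatz, local primality also says that functions vanishing on the zeros lie in
    the ideal. Each dimension count is won by one: 6 conditions against 5 parameters for a singular
    point, 10 against 9 for a plane, 18 against 15 + 2 for a degenerate triple. The last
    configuration is the one obstruction to independence that smoothness does not exclude. The
    theorem speaks of every blowup, so the contact locus is compared with it by the universal
    property. *)

Section Dickson.
Local Open Scope nat_scope.

(** Each chosen index minimises [a] on the tail beyond the previous choice, and all later choices
    lie in that same tail. *)
Lemma nondecreasing_subseq (a : nat -> nat) :
  exists phi : nat -> nat, {homo phi : i j / i < j} /\
    {homo a \o phi : i j / i <= j}.
Proof.
have argmin N : exists m, N <= m /\ forall k, N <= k -> a m <= a k.
  have ex : exists v, `[< exists2 m, N <= m & a m = v >].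
    by exists (a N); apply/asboolP; exists N.
  case: (ex_minnP ex) => v /asboolP[m Nm <-] min; exists m; split=> // k Nk.
  by apply: min; apply/asboolP; exists k.
have [g gP] := choice argmin.
pose phi := fix phi n := if n is k.+1 then g (phi k).+1 else g 0.
have phiS n : phi n < phi n.+1 by have [] := gP (phi n).+1.
have phi_mono : {homo phi : i j / i < j} by apply: homo_ltn => //; apply: ltn_trans.
exists phi; split=> //.
apply: homo_leq => [//|x y z|i]; first exact: leq_trans.
case: i => [|i] /=; first by have [_] := gP 0; apply.
have [l1 h1] := gP (phi i).+1; apply: h1.
have [l2 _] := gP (g (phi i).+1).+1; apply: leq_trans l2.
by apply: leqW; apply: l1.
Qed.

(** The previous lemma is applied to one coordinate after another, each time on the subsequence
    already found; the first two terms of the last subsequence serve. *)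
Lemma dickson n (u : nat -> 'X_{1..n}) : exists i j, i < j /\ (u i <= u j)%MM.
Proof.
suff H k : exists phi : nat -> nat, {homo phi : i j / i < j} /\
    forall l : 'I_n, l < k -> {homo (fun i => u (phi i) l) : i j / i <= j}.
  have [phi [mphi hphi]] := H n; exists (phi 0), (phi 1); split; first exact: mphi.
  by apply/mnm_lepP => l; apply: (hphi l (ltn_ord l)).
elim: k => [|k [phi [mphi hphi]]]; first by exists id; split.
have [kn|nk] := ltnP k n; last first.
  by exists phi; split=> // l _; apply: hphi; apply: leq_trans (ltn_ord l) nk.
have [psi [mpsi hpsi]] := nondecreasing_subseq (fun i => u (phi i) (Ordinal kn)).
have psile : {homo psi : i j / i <= j}.
  by move=> i j; rewrite leq_eqVlt => /orP[/eqP->//|/mpsi/ltnW].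
exists (phi \o psi); split=> [i j ij|l]; first exact/mphi/mpsi.
rewrite ltnS leq_eqVlt => /orP[/eqP lk|lk] i j ij.
  by have -> : l = Ordinal kn by [exact: val_inj]; exact: hpsi.
by apply: (hphi l lk); apply: psile.
Qed.

End Dickson.

Section Ideals.
Variable A : comNzRingType.
Implicit Types (I J : set A) (F : set (set A)).

Definition is_ideal I : Prop :=
  [/\ I 0, forall x y, I x -> I y -> I (x + y) & forall a x, I x -> I (a * x)].

(** The maximal condition is the form used below, for families of ideals that avoid something and
    for chains of colon ideals. *)
Definition noetherian : Prop :=
  forall F, F !=set0 -> (forall I, F I -> is_ideal I) ->
  exists2 I, F I & forall J, F J -> I `<=` J -> J = I.

Definition gen_ideal r (g : 'I_r -> A) : set A :=
  [set x | exists c : 'I_r -> A, x = \sum_i c i * g i].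

Lemma gen_ideal_is_ideal r (g : 'I_r -> A) : is_ideal (gen_ideal g).
Proof.
split=> [|x y [c ->] [d ->]|a x [c ->]].
- by exists (fun=> 0); rewrite big1 // => i _; rewrite mul0r.
- by exists (fun i => c i + d i); rewrite -big_split; apply: eq_bigr => i _; rewrite mulrDl.
- by exists (fun i => a * c i); rewrite mulr_sumr; apply: eq_bigr => i _; rewrite mulrA.
Qed.

Lemma gen_idealW r (g : 'I_r -> A) i : gen_ideal g (g i).
Proof.
exists (fun j => (j == i)%:R); rewrite (bigD1 i) //= eqxx mul1r big1 ?addr0 //.
by move=> j /negPf->; rewrite mul0r.
Qed.

Lemma ideal_opp I x : is_ideal I -> I x -> I (- x).
Proof. by move=> [_ _ IM] Ix; rewrite -mulN1r; apply: IM. Qed.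

Lemma ideal_sub I x y : is_ideal I -> I x -> I y -> I (x - y).
Proof. by move=> iI Ix Iy; case: (iI) => _ ID _; apply: ID => //; apply: ideal_opp. Qed.

Definition ideal_add I J : set A := [set z | exists x y, [/\ I x, J y & z = x + y]].

Lemma ideal_add_is_ideal I J : is_ideal I -> is_ideal J -> is_ideal (ideal_add I J).
Proof.
move=> [I0 ID IM] [J0 JD JM]; split.
- by exists 0, 0; split=> //; rewrite addr0.
- move=> _ _ [x [y [Ix Jy ->]]] [x' [y' [Ix' Jy' ->]]].
  by exists (x + x'), (y + y'); split; [exact: ID|exact: JD|rewrite addrACA].
- move=> a _ [x [y [Ix Jy ->]]]; exists (a * x), (a * y).
  by split; [exact: IM|exact: JM|rewrite mulrDr].
Qed.

Definition principal (x : A) : set A := [set y | exists a, y = a * x].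

Lemma principal_is_ideal x : is_ideal (principal x).
Proof.
split=> [|_ _ [a ->] [b ->]|b _ [a ->]]; first by exists 0; rewrite mul0r.
  by exists (a + b); rewrite mulrDl.
by exists (b * a); rewrite mulrA.
Qed.

Lemma ideal_addl I J : is_ideal J -> I `<=` ideal_add I J.
Proof. by move=> [J0 _ _] x Ix; exists x, 0; rewrite addr0; split. Qed.

End Ideals.

(** * Hilbert's basis theorem, Krull's intersection theorem and orders of vanishing at the origin *)

Section MPoly.
Variables (K : fieldType) (n : nat).
Local Notation A := {mpoly K[n]}.

(** In a strictly increasing chain let [h k] have the least leading monomial among the elements of
    step k + 1 outside step k. By Dickson's lemma [mlead (h i)] divides [mlead (h j)] for some i <
    j, and subtracting a multiple of [h i] from [h j] contradicts minimality. *)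
Lemma mpoly_noetherian : noetherian A.
Proof.
move=> F [I0 FI0] Fid; apply: contrapT => nomax.
have step (I : {I : set A | F I}) : exists J : {I : set A | F I},
    proj1_sig I `<` proj1_sig J.
  apply: contrapT => noJ; apply: nomax; exists (proj1_sig I); first exact: (proj2_sig I).
  move=> J FJ IJ; apply: contrapT => neq; apply: noJ; exists (exist _ J FJ) => /=.
  by rewrite properEneq; split=> //; apply/eqP => e; apply: neq.
have [nxt nxtP] := choice step.
pose I := fix I k := if k is l.+1 then nxt (I l) else exist _ I0 FI0.
have Iid k : is_ideal (proj1_sig (I k)) by apply: Fid; exact: (proj2_sig (I k)).
have Imono : {homo (fun k => proj1_sig (I k)) : i j / (i <= j)%N >-> i `<=` j}.
  apply: homo_leq => [x//|x y z xy yz|k]; first exact: subset_trans yz.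
  by have [] := nxtP (I k).
pose N k : set A := [set h | proj1_sig (I k.+1) h /\ ~ proj1_sig (I k) h].
have minlead k : exists h, N k h /\ forall h', N k h' -> ~ (mlead h' < mlead h)%O.
  have [h0 Nh0] : exists h, N k h.
    have [_ /existsNP[h /not_implyP[h1 h2]]] := nxtP (I k).
    by exists h; split.
  move: {2}(mlead h0) (erefl (mlead h0)) => m; elim/(well_founded_ind (@ltom_wf n)): m h0 Nh0 => m IH h0
      Nh0 e.
  have [[h' [Nh' lt]]|no] := pselect (exists h', N k h' /\ (mlead h' < mlead h0)%O).
    by apply: (IH (mlead h') _ h') => //; rewrite -e.
  by exists h0; split=> // h' Nh' lt; apply: no; exists h'.
have [h hP] := choice minlead.
have [i [j [ij le]]] := dickson (fun k => mlead (h k)).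
have [[Ij1 nIj] min] := hP j; have [[Ii1 _] _] := hP i.
have Ihi : proj1_sig (I j) (h i) by apply: (Imono i.+1).
have hi0 : h i != 0.
  have [[_ ni] _] := hP i; apply/eqP => e; apply: ni; rewrite e; by case: (Iid i).
have hj0 : h j != 0 by apply/eqP => e; apply: nIj; rewrite e; case: (Iid j).
pose m := (mlead (h j) - mlead (h i))%MM.
pose c := mleadc (h j) / mleadc (h i).
have ci : mleadc (h i) != 0 by rewrite mleadc_eq0.
have c0 : c != 0 by rewrite mulf_neq0 ?invr_neq0 // mleadc_eq0.
pose q := (c *: 'X_[m]) * h i.
have Iq : proj1_sig (I j) q by case: (Iid j) => _ _; apply.
have lq : mlead q = mlead (h j).
  rewrite /q mleadM ?mleadZ ?mleadXm ?submK // ?scaler_eq0 ?negb_or ?c0 //=.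
  by rewrite -mleadc_eq0 mleadXm mcoeffX eqxx oner_eq0.
have cq : q@_(mlead (h j)) = mleadc (h j).
  have e : mlead (h j) = (m + mlead (h i))%MM by rewrite /m submK.
  rewrite [X in q@_X]e.
  by rewrite /q -scalerAl mcoeffZ mulrC [_ * h i]mulrC mcoeffMX mulrC /c divfK.
have NB : N j (h j - q).
  split; first by apply: ideal_sub => //; apply: (Imono j).
  move=> Ij; apply: nIj; rewrite -(subrK q (h j)).
  by case: (Iid j) => _ ID _; apply: ID.
apply: (min _ NB); rewrite lt_neqAle; apply/andP; split.
  apply/eqP => e.
  have d0 : h j - q != 0 by apply/eqP => e0; case: NB => _; rewrite e0; case: (Iid j).
  by have := mleadc_eq0 (h j - q); rewrite e mcoeffB cq subrr eqxx (negPf d0).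
by have := mleadB_le (h j) q; rewrite lq joinxx.
Qed.

(* [ordge N p]: [p] lies in the [N]-th power of the ideal of the origin. *)
Definition ordge N (p : A) : Prop := all [pred m | (N <= mdeg m)%N] (msupp p).

Lemma ordgeP N p : ordge N p <-> forall m, (mdeg m < N)%N -> p@_m = 0.
Proof.
split=> [/allP h m lt|h].
  by apply/eqP; rewrite mcoeff_eq0; apply/negP => /h /=; rewrite leqNgt lt.
by apply/allP => m /=; rewrite mcoeff_msupp leqNgt => /eqP nz; apply/negP => /h.
Qed.

Lemma ordge0 N : ordge N 0.
Proof. by apply/ordgeP => m _; rewrite mcoeff0. Qed.

Lemma ordge_ideal N : is_ideal (ordge N).
Proof.
split=> [|x y /ordgeP hx /ordgeP hy|a x /ordgeP hx]; first exact: ordge0.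
  by apply/ordgeP => m lt; rewrite mcoeffD hx ?hy ?addr0.
apply/ordgeP => m lt.
rewrite mcoeffM big1 // => -[m1 m2] /= /eqP.
move: (bmnm m1) (bmnm m2) => {}m1 {}m2 /(congr1 (@mdeg n)); rewrite mdegD => em.
by rewrite (hx m2) ?mulr0 //; apply: leq_ltn_trans lt; rewrite em leq_addl.
Qed.

Lemma ordgeM a b p q : ordge a p -> ordge b q -> ordge (a + b) (p * q).
Proof.
move=> /ordgeP hp /ordgeP hq; apply/ordgeP => m lt; rewrite mcoeffM big1 // => -[m1 m2] /= /eqP.
move: (bmnm m1) (bmnm m2) => {}m1 {}m2 /(congr1 (@mdeg n)); rewrite mdegD => em.
have [l1|l1] := ltnP (mdeg m1) a; first by rewrite hp ?mul0r.
rewrite (hq m2) ?mulr0 //; move: lt; rewrite em => lt.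
by have := leq_ltn_trans (leq_add l1 (leqnn _)) lt; rewrite ltn_add2l.
Qed.

Lemma ordgeW a b p : (a <= b)%N -> ordge b p -> ordge a p.
Proof. by move=> ab /ordgeP hp; apply/ordgeP => m lt; apply: hp; apply: leq_trans ab. Qed.

Lemma ordge1 p : p@_0%MM = 0 -> ordge 1 p.
Proof. by move=> p0; apply/ordgeP => m; rewrite ltnS leqn0 mdeg_eq0 => /eqP->. Qed.

Lemma ideal_sum (J : set A) (T : Type) (s : seq T) (P : pred T) (E : T -> A) :
  is_ideal J -> (forall i, P i -> J (E i)) -> J (\sum_(i <- s | P i) E i).
Proof. by move=> [J0 JD _] JE; elim/big_ind: _. Qed.

(* Krull's intersection theorem: an ideal [Q] maximal among those meeting
   [J + (h)] in [J + h m] contains a power of [m]. *)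
Lemma krull (J : set A) (h : A) : is_ideal J ->
  (forall N, ideal_add J (ordge N) h) -> exists q, q@_0%MM = 1 /\ J (q * h).
Proof.
move=> iJ hJ; have [J0 JD JM] := iJ.
(* With m the ideal of the origin, [I] is J + m h and [L] is J + (h). The aim is that h lies in [I]:
   then (1 - u) h lies in J for some u in m. *)
pose I : set A := [set z | exists j u, [/\ J j, u@_0%MM = 0 & z = j + u * h]].
pose L := ideal_add J (principal h).
have iL : is_ideal L by apply: ideal_add_is_ideal => //; apply: principal_is_ideal.
have iI : is_ideal I.
  split=> [|_ _ [j [u [Jj u0 ->]]] [j' [u' [Jj' u0' ->]]]|a _ [j [u [Jj u0 ->]]]].
  - by exists 0, 0; rewrite mcoeff0 mul0r addr0.
  - exists (j + j'), (u + u'); rewrite mcoeffD u0 u0' addr0 mulrDl addrACA; split=> //.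
    exact: JD.
  - exists (a * j), (a * u); rewrite mulrDr mulrA; split=> //; first exact: JM.
    by have [_ _ M] := ordge_ideal 1; move/ordgeP: (M a u (ordge1 u0)); apply; rewrite mdeg0.
have IL : I `<=` L by move=> _ [j [u [Jj _ ->]]]; exists j, (u * h); split=> //; exists u.
have [|Q [iQ IQ QL] Qmax] := @mpoly_noetherian
    [set Q | [/\ is_ideal Q, I `<=` Q & Q `&` L `<=` I]] _ (fun Q H => let: And3 a _ _ := H in a).
  by exists I; split=> // z [].
have [Q0 QD QM] := iQ.
(* The colon ideals (Q : X_i^k) increase with k and so stabilise. From then on adding X_i^k to Q
   keeps the intersection with [L] inside [I], because X_i [L] lies in [I]; maximality then puts
   X_i^k into Q. *)
have var i : exists k, Q ('X_i ^+ k).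
  have [||_ [k _ <-] kmax] := @mpoly_noetherian
      [set (fun k : nat => [set a : A | Q ('X_i ^+ k * a)]) k | k in setT].
  - by exists [set a : A | Q ('X_i ^+ 0 * a)]; exists 0%N.
  - move=> _ [k _ <-]; split=> /= [|x y hx hy|a x hx]; first by rewrite mulr0.
      by rewrite mulrDr; apply: QD.
    by rewrite mulrCA; apply: QM.
  exists k; pose Q' := ideal_add Q (principal ('X_i ^+ k)).
  have iQ' : is_ideal Q' by apply: ideal_add_is_ideal => //; apply: principal_is_ideal.
  have QQ' : Q `<=` Q' by apply: ideal_addl; apply: principal_is_ideal.
  suff e : Q' = Q by rewrite -e; exists 0, ('X_i ^+ k); rewrite add0r; split=> //; exists 1; rewrite mul1r.
  apply: Qmax => //; split=> //; first exact: subset_trans QQ'.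
  move=> z [[x [_ [Qx [a ->] ez]]] Lz].
  have Xz : Q ('X_i * z).
    apply: IQ; case: Lz => j [_ [Jj [b ->] ->]]; exists ('X_i * j), ('X_i * b).
    rewrite mulrDr mulrA; split=> //; first exact: JM.
    have X1 : ordge 1 ('X_i : A) by apply: ordge1; rewrite mcoeffX mnm1_eq0.
    by rewrite mulrC; have [_ _ M] := ordge_ideal 1; move/ordgeP: (M b _ X1); apply; rewrite mdeg0.
  have Qa : Q ('X_i ^+ k.+1 * a).
    have -> : 'X_i ^+ k.+1 * a = 'X_i * z - 'X_i * x.
      by rewrite ez exprS; ring.
    by apply: ideal_sub => //; apply: QM.
  have : [set a : A | Q ('X_i ^+ k.+1 * a)] a by [].
  rewrite (kmax [set a : A | Q ('X_i ^+ k.+1 * a)]) => /= [Qka||].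
  - apply: QL; split=> //; rewrite ez; apply: QD => //.
    by rewrite mulrC.
  - by exists k.+1.
  - by move=> b /= Qb; rewrite exprS -mulrA; apply: QM.
have [k kP] := choice var.
(* A monomial of degree above the sum of the [k i] is divisible by some X_i^(k i). *)
have powQ p : ordge (\sum_i k i).+1 p -> Q p.
  move=> /ordgeP op; rewrite [p]mpolyE; apply: ideal_sum => // m _.
  have [lt|le] := ltnP (mdeg m) (\sum_i k i).+1; first by rewrite op ?scale0r.
  have [i ki] : exists i, (k i <= m i)%N.
    apply: contrapT => no; have lt i : (m i < k i)%N.
      by rewrite ltnNge; apply/negP => ki; apply: no; exists i.
    have le2 : (\sum_i m i <= \sum_i k i)%N by apply: leq_sum => i _; apply: ltnW.
    move: le; rewrite mdegE => le.
    by have := leq_trans le le2; rewrite ltnn.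
  rewrite -mul_mpolyC.
  have -> : 'X_[m] = 'X_[m - U_(i) *+ k i] * 'X_i ^+ k i :> A.
    rewrite mpolyXn -mpolyXD submK //; apply/mnm_lepP => l; rewrite mulmnE mnm1E.
    by case: eqP => [<-|]; rewrite ?mul1n ?mul0n.
  by rewrite mulrA; apply: QM.
have Ih : I h.
  apply: QL; split; last by exists 0, h; rewrite add0r; split=> //; exists 1; rewrite mul1r.
  have [j [r [Jj or ->]]] := hJ (\sum_i k i).+1.
  by apply: QD; [apply: IQ; exists j, 0; rewrite mcoeff0 mul0r addr0|exact: powQ].
have [j [u [Jj u0 e]]] := Ih.
exists (1 - u); rewrite mcoeffB u0 mcoeff1 eqxx subr0; split=> //.
by rewrite mulrBl mul1r {1}e addrK.
Qed.

(** Least monomials multiply, since every other pair of monomials has a strictly larger product. The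
    order is graded, so this makes orders of vanishing at the origin additive. *)
Lemma mcoeffM_mlast (p q : A) :
  (p * q)@_(mlast p + mlast q) = p@_(mlast p) * q@_(mlast q).
Proof.
have [->|p0] := eqVneq p 0; first by rewrite !mcoeff0 !mul0r mcoeff0.
have [->|q0] := eqVneq q 0; first by rewrite !mcoeff0 !mulr0 mcoeff0.
rewrite mpolyME (bigD1_seq (mlast p, mlast q)) /=; first last.
- by rewrite allpairs_uniq // => -[? ?] [].
- by rewrite allpairs_f // !mlast_supp.
rewrite mcoeffD mcoeffZ mcoeffX eqxx mulr1 big_seq_cond raddf_sum /= big1 ?addr0 //.
case=> m1 m2 /andP[/allpairsP[[m1' m2'] /= [h1 h2 [-> ->]]] ne].
rewrite mcoeffZ mcoeffX; case: eqP => [e|]; last by rewrite mulr0.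
have l1 := mlast_lemc h1; have := mlast_lemc h2; rewrite le_eqVlt => /orP[/eqP e2|l2].
  by move: e ne => /eqP; rewrite -e2 eqm_add2r => /eqP ->; rewrite eqxx.
by have := lemc_lt_add l1 l2; rewrite e ltxx.
Qed.

Lemma ordge_mlast N p : p != 0 -> ordge N p <-> (N <= mdeg (mlast p))%N.
Proof.
move=> p0; split=> [/ordgeP op|le]; last apply/ordgeP => m lt.
  by rewrite leqNgt; apply/negP => /op; apply/eqP; rewrite -mcoeff_msupp mlast_supp.
apply: mcoeff_lt_mlast; rewrite ltNge; apply/negP => /lemc_mdeg.
by rewrite leqNgt (leq_trans lt).
Qed.

Lemma ordge_mul_lt a b p q :
  ~ ordge a.+1 p -> ~ ordge b.+1 q -> ~ ordge (a + b).+1 (p * q).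
Proof.
move=> np nq; have p0 : p != 0 by apply/eqP => e; apply: np; rewrite e; apply: ordge0.
have q0 : q != 0 by apply/eqP => e; apply: nq; rewrite e; apply: ordge0.
have {}np : ~~ (a.+1 <= mdeg (mlast p))%N by apply/negP => le; apply/np/ordge_mlast.
have {}nq : ~~ (b.+1 <= mdeg (mlast q))%N by apply/negP => le; apply/nq/ordge_mlast.
move=> /ordgeP o.
have /eqP : (p * q)@_(mlast p + mlast q) = 0.
  by apply: o; rewrite mdegD ltnS leq_add // -ltnS ltnNge.
rewrite mcoeffM_mlast mulf_eq0 => /orP[]; apply/negP; rewrite -mcoeff_msupp;
  exact: mlast_supp.
Qed.

End MPoly.

(** * Local primality for equations tangent to coordinate hyperplanes at the origin *)

Section Triangular.
Variables (K : fieldType) (n : nat) (S : 'I_n -> {mpoly K[n]}) (E : pred 'I_n).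
Hypothesis S2 : forall i, ordge 2 (S i - 'X_i).
Hypothesis SX : forall i, ~~ E i -> S i = 'X_i.
Local Notation A := {mpoly K[n]}.

Let J : set A := [set x | exists c : 'I_n -> A, x = \sum_(i | E i) c i * S i].
(** This substitution straightens the equations. It is the identity up to higher order, hence an
    automorphism modulo every power of the maximal ideal, and it carries the X_i with [E i] to the
    generators of [J]; so [prj], which sets these X_i to 0, provides normal forms modulo [J]. *)
Let sig : A -> A := comp_mpoly [tuple S i | i < n].
Let prj : A -> A := comp_mpoly [tuple if E i then 0 else 'X_i | i < n].

Let iJ : is_ideal J.
Proof.
split=> [|x y [c ->] [d ->]|a x [c ->]].
- by exists (fun=> 0); rewrite big1 // => i _; rewrite mul0r.
- by exists (fun i => c i + d i); rewrite -big_split; apply: eq_bigr => i _; rewrite mulrDl.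
- by exists (fun i => a * c i); rewrite mulr_sumr; apply: eq_bigr => i _; rewrite mulrA.
Qed.

Let ordgeD N (p q : A) : ordge N p -> ordge N q -> ordge N (p + q).
Proof. by case: (@ordge_ideal K n N) => _ D _; apply: D. Qed.

Let ordgeMl N (p q : A) : ordge N q -> ordge N (p * q).
Proof. by case: (@ordge_ideal K n N) => _ _; apply. Qed.

Let ordgeB N (p q : A) : ordge N p -> ordge N q -> ordge N (p - q).
Proof. by move=> hp hq; apply: (ideal_sub (@ordge_ideal K n N)). Qed.

Let ordgeX m : ordge (mdeg m) ('X_[m] : A).
Proof. by apply/ordgeP => m' lt; rewrite mcoeffX; case: eqP lt => [->|//]; rewrite ltnn. Qed.

Let sigX i : sig 'X_i = S i.
Proof. by rewrite /sig comp_mpolyXU -tnth_nth tnth_mktuple. Qed.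

Let prjX i : prj 'X_i = if E i then 0 else 'X_i.
Proof. by rewrite /prj comp_mpolyXU -tnth_nth tnth_mktuple. Qed.

Let mnm_decomp (m : 'X_{1..n}) : m = 0%MM \/ exists i m', m = (U_(i) + m')%MM.
Proof.
have [->|m0] := eqVneq m 0%MM; first by left.
right; have [i mi] : exists i, m i != 0%N.
  by apply: contrapT => no; case/eqP: m0; apply/mnmP => i; rewrite mnmE;
     apply/eqP; apply: contrapT => mi; apply: no; exists i; apply/negP.
exists i, (m - U_(i))%MM; rewrite addmC submK //; apply/mnm_lepP => j; rewrite mnm1E.
by case: eqP => [<-|//]; rewrite lt0n.
Qed.

Let sig_monom m : ordge (mdeg m).+1 (sig 'X_[m] - 'X_[m]).
Proof.
move: {2}(mdeg m) (erefl (mdeg m)) => d; elim: d m => [|d IH] m e.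
  move/eqP: e; rewrite mdeg_eq0 => /eqP->; rewrite mpolyX0 /sig comp_mpoly1 subrr.
  exact: ordge0.
case: (mnm_decomp m) e => [->|[i [m' ->]]]; first by rewrite mdeg0.
rewrite mdegD mdeg1 add1n => -[e]; rewrite e mpolyXD.
rewrite /sig rmorphM /= -/sig sigX.
have -> : S i * sig 'X_[m'] - 'X_i * 'X_[m'] =
  (S i - 'X_i) * sig 'X_[m'] + 'X_i * (sig 'X_[m'] - 'X_[m']) by ring.
have X1 : ordge 1 ('X_i : A) by rewrite -(mdeg1 i); apply: ordgeX.
have om := IH _ e; rewrite e in om.
apply: ordgeD; last exact: (ordgeM X1 om).
apply: (@ordgeM _ _ 2 d) => //; rewrite -(subrK 'X_[m'] (sig _)); apply: ordgeD.
  exact: (ordgeW _ om).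
by rewrite -e; apply: ordgeX.
Qed.

Let sig_lead N p : ordge N p -> ordge N.+1 (sig p - p).
Proof.
move=> op; rewrite {1 2}[p]mpolyE /sig linear_sum /= -sumrB.
apply: ideal_sum; first exact: ordge_ideal.
move=> m _; rewrite linearZ /= -scalerBr -mul_mpolyC -/sig.
have [lt|le] := ltnP (mdeg m) N; first by rewrite (proj1 (ordgeP N p) op) // mul0r; apply: ordge0.
by apply: ordgeMl; exact: (ordgeW _ (sig_monom m)).
Qed.

(** Successive approximation: adding the error itself as a correction leaves, by [sig_lead], an
    error of the next order. *)
Let sig_surj N h : exists h', ordge N (h - sig h').
Proof.
elim: N => [|N [h' oh]]; first by exists 0; apply/ordgeP.
exists (h' + (h - sig h')).
have -> : h - sig (h' + (h - sig h')) = 0 - (sig (h - sig h') - (h - sig h')).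
  by rewrite [sig (h' + _)]rmorphD /=; ring.
by apply: ordgeB; [exact: ordge0|exact: sig_lead].
Qed.

Let sig_ord N p : ordge N (sig p) -> ordge N p.
Proof.
move=> os; suff H k : (k <= N)%N -> ordge k p by apply: H.
elim: k => [|k IH] kN; first by apply/ordgeP.
have -> : p = sig p - (sig p - p) by ring.
by apply: ordgeB; [exact: (ordgeW _ os)|apply: sig_lead; apply: IH; apply: ltnW].
Qed.

Let prj_monom m : prj 'X_[m] = 'X_[m] \/ prj 'X_[m] = 0.
Proof.
move: {2}(mdeg m) (erefl (mdeg m)) => d; elim: d m => [|d IH] m e.
  by move/eqP: e; rewrite mdeg_eq0 => /eqP->; left; rewrite mpolyX0 /prj comp_mpoly1.
case: (mnm_decomp m) e => [->|[i [m' ->]]]; first by rewrite mdeg0.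
rewrite mdegD mdeg1 add1n => -[e]; rewrite mpolyXD /prj rmorphM /= -/prj prjX.
case: ifP => _; first by right; rewrite mul0r.
by case: (IH _ e) => ->; [left|right; rewrite mulr0].
Qed.

Let prj_ord N p : ordge N p -> ordge N (prj p).
Proof.
move=> op; rewrite [p]mpolyE /prj linear_sum /=.
apply: ideal_sum; first exact: ordge_ideal.
move=> m _; rewrite linearZ /= -mul_mpolyC -/prj.
have [lt|le] := ltnP (mdeg m) N; first by rewrite (proj1 (ordgeP N p) op) // mul0r; apply: ordge0.
apply: ordgeMl; case: (prj_monom m) => ->; last exact: ordge0.
by apply: (ordgeW le); apply: ordgeX.
Qed.

Let comp_prj (tau : {rmorphism A -> A}) : (forall c : K, tau c%:MP = c%:MP) ->
  (forall i, ~~ E i -> tau 'X_i = 'X_i) -> forall p, tau (prj p) = prj p.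
Proof.
move=> tC tX p; elim/mpolyind: p => [|c m p _ _ IH]; first by rewrite /prj !rmorph0.
rewrite /prj linearD linearZ /= rmorphD -!mul_mpolyC rmorphM /= tC -!/prj IH; congr (_ * _ + _).
elim: {m}(mdeg m) {-2}m (erefl (mdeg m)) => [|d IHd] m e.
  by move/eqP: e; rewrite mdeg_eq0 => /eqP->; rewrite mpolyX0 /prj !rmorph1.
case: (mnm_decomp m) e => [->|[i [m' ->]]]; first by rewrite mdeg0.
rewrite mdegD mdeg1 add1n => -[e]; rewrite mpolyXD /prj rmorphM /= -/prj prjX rmorphM IHd //.
by case: ifPn => [_|/tX->//]; rewrite rmorph0.
Qed.

Let sig_prj p : sig (prj p) = prj p.
Proof.
apply: (@comp_prj (comp_mpoly [tuple S i | i < n])) => [c|i Ei].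
  exact: comp_mpolyC.
by rewrite -[LHS]/(sig 'X_i) sigX SX.
Qed.

Let prj_prj p : prj (prj p) = prj p.
Proof.
apply: (@comp_prj (comp_mpoly [tuple if E i then 0 else 'X_i | i < n])) => [c|i Ei].
  exact: comp_mpolyC.
by rewrite -[LHS]/(prj 'X_i) prjX (negPf Ei).
Qed.

Let sub_prj p : J (sig p - prj p).
Proof.
have [J0 JD JM] := iJ.
elim/mpolyind: p => [|c m p _ _ IH]; first by rewrite /sig /prj !rmorph0 subrr.
rewrite [sig (_ + _)]linearP [prj (_ + _)]linearP /= -/sig -/prj opprD addrACA; apply: JD => //.
rewrite -scalerBr -mul_mpolyC; apply: (JM).
elim: {m}(mdeg m) {-2}m (erefl (mdeg m)) => [|d IHd] m e.
  by move/eqP: e; rewrite mdeg_eq0 => /eqP->; rewrite mpolyX0 /prj /sig !rmorph1 subrr.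
case: (mnm_decomp m) e => [->|[i [m' ->]]]; first by rewrite mdeg0.
rewrite mdegD mdeg1 add1n => -[e]; rewrite mpolyXD /prj /sig !rmorphM /= -/prj -/sig prjX sigX.
case: ifPn => [Ei|Ei].
  rewrite mul0r subr0 mulrC; apply: (JM); exists (fun j => (j == i)%:R).
  by rewrite (bigD1 i) //= eqxx mul1r big1 ?addr0 // => j /andP[_ /negPf->]; rewrite mul0r.
by rewrite SX // -mulrBr; apply: JM; apply: IHd.
Qed.

(** Normal forms stay independent modulo J + m^M: an approximate inverse of [sig] turns an element
    of [J] into a combination of the X_i with [E i], which [prj] kills. *)
Let prj_injJ M p : ideal_add J (ordge M) (prj p) -> ordge M (prj p).
Proof.
move=> [_ [mu [[c ->] omu e]]].
have [c' hc'] := choice (fun i => sig_surj M (c i)).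
have o1 : ordge M (sig (prj p - \sum_(i | E i) c' i * 'X_i)).
  rewrite [sig (_ - _)]rmorphB /= -/sig sig_prj e [sig (\sum_(i | _) _)]rmorph_sum /= -/sig.
  rewrite addrAC -sumrB; apply: ordgeD => //.
  apply: ideal_sum => [|i Ei]; first exact: ordge_ideal.
  by rewrite [sig (_ * _)]rmorphM /= -/sig sigX -mulrBl mulrC; apply: ordgeMl.
have := prj_ord (sig_ord o1); rewrite [prj (_ - _)]rmorphB /= -/prj [prj (\sum_(i | _) _)]rmorph_sum /=
    prj_prj.
rewrite big1 ?subr0 // => i Ei; by rewrite -/prj [prj (_ * _)]rmorphM /= -/prj prjX Ei mulr0.
Qed.

(** The completed quotient by [J] is a power series ring, hence a domain; only its truncations are
    used. If both alternatives fail, [krull] gives powers of m that detect h and k modulo [J], and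
    the normal forms of q, h and k have a product of order too small to lie in J + m^M. *)
Lemma triangular_local_prime h k q : q@_0%MM != 0 -> J (q * (h * k)) ->
  (exists q', q'@_0%MM = 1 /\ J (q' * h)) \/ (exists q', q'@_0%MM = 1 /\ J (q' * k)).
Proof.
move=> q0 Jqhk; have [J0 JD JM] := iJ.
apply: contrapT => /not_orP[nh nk].
have far x : ~ (exists q', q'@_0%MM = 1 /\ J (q' * x)) ->
    exists N, ~ ideal_add J (ordge N) x.
  by move=> nx; apply: contrapT => no; apply: nx; apply: krull => // N; apply: contrapT => c; apply: no;
      exists N.
have [N1 hN1] := far _ nh; have [N2 hN2] := far _ nk.
(* Any M above N1 + N2 is large enough, since q is a unit at the origin and contributes order 0. *)
pose M := (N1 + N2).+2.
have red x : exists x0, x0 = prj x0 /\ ideal_add J (ordge M) (x - x0).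
  have [x' ox'] := sig_surj M x; exists (prj x'); rewrite prj_prj; split=> //.
  exists (sig x' - prj x'), (x - sig x'); split; [exact: sub_prj|exact: ox'|].
  by rewrite [RHS]addrC addrA subrK.
have [h0 [eh Hh]] := red h; have [k0 [ek Hk]] := red k; have [r0 [er Hr]] := red q.
have iJM := ideal_add_is_ideal iJ (@ordge_ideal K n M); have [A0 AD AM] := iJM.
have AW N x : (N <= M)%N -> ideal_add J (ordge M) x -> ideal_add J (ordge N) x.
  by move=> le [y [z [Jy oz ->]]]; exists y, z; split=> //; exact: (ordgeW _ oz).
have far0 N x x0 : (N <= M)%N -> ideal_add J (ordge M) (x - x0) ->
    ~ ideal_add J (ordge N) x -> ~ ordge N x0.
  move=> le Hx nx o; apply: nx; rewrite -(subrK x0 x).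
  have [_ D _] := ideal_add_is_ideal iJ (@ordge_ideal K n N).
  by apply: D; [apply: AW Hx|exists 0, x0; rewrite add0r].
have fh : ~ ordge N1.+1 h0.
  by move=> o; apply: (far0 N1 h h0) hN1 _ => //; [rewrite /M -addn2 -addnA; apply: leq_addr|exact:
      (ordgeW _ o)].
have fk : ~ ordge N2.+1 k0.
  by move=> o; apply: (far0 N2 k k0) hN2 _ => //; [rewrite /M -!addSn; apply: leq_addl|exact: (ordgeW _ o)].
have J1 x : J x -> x@_0%MM = 0.
  move=> [c ->]; have : ordge 1 (\sum_(i | E i) c i * S i).
    apply: ideal_sum => [|i _]; first exact: ordge_ideal.
    apply: ordgeMl; rewrite -(subrK 'X_i (S i)); apply: ordgeD; first exact: (ordgeW _ (S2 i)).
    by rewrite -(mdeg1 i); apply: ordgeX.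
  by move/ordgeP; apply; rewrite mdeg0.
have fr : ~ ordge 1 r0.
  move=> /ordgeP/(_ 0%MM); rewrite mdeg0 => /(_ isT) z; case: Hr => x [y [Jx oy e]].
  move: q0; rewrite -(subrK r0 q) e !mcoeffD z (J1 _ Jx) (proj1 (ordgeP _ _) oy) ?mdeg0 //.
  by rewrite !addr0 eqxx.
have o : ordge M (r0 * (h0 * k0)).
  rewrite er eh ek /prj -!rmorphM /= -/prj; apply: prj_injJ.
  rewrite /prj !rmorphM /= -/prj -er -eh -ek.
  have -> : r0 * (h0 * k0) = q * (h * k) - ((q - r0) * (h * k) +
     (r0 * k) * (h - h0) + (r0 * h0) * (k - k0)) by ring.
  apply: (ideal_sub iJM); first by exists (q * (h * k)), 0; rewrite addr0; split=> //; apply: ordge0.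
  by apply: (AD); [apply: (AD); [rewrite mulrC|]|]; apply: (AM).
apply: (ordge_mul_lt fr (ordge_mul_lt fh fk)); rewrite add0n.
by apply: (ordgeW _ o); rewrite /M leqnSn.
Qed.

End Triangular.

Section MPolyMisc.
Variables (K : fieldType) (n : nat).
Local Notation A := {mpoly K[n]}.

Lemma mpoly_ring_ind (P : A -> Prop) :
  (forall c, P c%:MP) -> (forall i, P 'X_i) ->
  (forall p q, P p -> P q -> P (p + q)) -> (forall p q, P p -> P q -> P (p * q)) ->
  forall p, P p.
Proof.
move=> PC PX PD PM; elim/mpolyind => [|c m p _ _ Pp]; first by rewrite -mpolyC0.
apply: (PD) => //; rewrite -mul_mpolyC; apply: (PM) => //.
rewrite mpolyXE_id; elim/big_ind: _ => // [|i _]; first by rewrite -mpolyC1.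
by elim: (m i) => [|k IH]; [rewrite expr0 -mpolyC1|rewrite exprS; apply: PM].
Qed.

Lemma comp_mpoly_comp m k (lq : n.-tuple {mpoly K[m]}) (lr : m.-tuple {mpoly K[k]}) (p : A) :
  (p \mPo lq) \mPo lr = p \mPo [tuple tnth lq i \mPo lr | i < n].
Proof.
elim/mpoly_ring_ind: p => [c|i|p q IHp IHq|p q IHp IHq].
- by rewrite !comp_mpolyC.
- by rewrite !comp_mpolyXU -!tnth_nth tnth_mktuple.
- by rewrite !comp_mpolyD IHp IHq.
- by rewrite !rmorphM /= IHp IHq.
Qed.

Lemma mcoeff_at0 (p : A) : p@_0%MM = p.@[fun=> 0].
Proof.
elim/mpoly_ring_ind: p => [c|i|p q IHp IHq|p q IHp IHq].
- by rewrite mcoeffC eqxx mulr1 mevalC.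
- by rewrite mcoeffX mnm1_eq0 mevalXU.
- by rewrite mcoeffD mevalD IHp IHq.
- by rewrite mevalM -IHp -IHq; exact: (rmorphM (mcoeff 0%MM)).
Qed.

Lemma mcoeff_atU (p : A) j : p@_U_(j) = (p^`M(j)).@[fun=> 0].
Proof. by rewrite -mcoeff_at0 mcoeff_deriv add0m mnm0E mulr1n. Qed.

Lemma meval_sum (I : Type) (s : seq I) (P : pred I) (F : I -> A) v :
  (\sum_(i <- s | P i) F i).@[v] = \sum_(i <- s | P i) (F i).@[v].
Proof. exact: raddf_sum. Qed.

Lemma mderiv_sum (I : Type) (s : seq I) (P : pred I) (F : I -> A) j :
  (\sum_(i <- s | P i) F i)^`M(j) = \sum_(i <- s | P i) (F i)^`M(j).
Proof. exact: raddf_sum. Qed.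

Lemma mderivXU (i j : 'I_n) : ('X_i : A)^`M(j) = (i == j)%:R%:MP.
Proof.
rewrite mderivX mnm1E; case: eqP => [->|_]; last by rewrite scale0r mpolyC0.
have -> : (U_(j) - U_(j))%MM = 0%MM :> 'X_{1..n} by apply/mnmP => k; rewrite mnmBE subnn mnm0E.
by rewrite mpolyX0 scale1r.
Qed.

Lemma chain_rule m (lq : n.-tuple {mpoly K[m]}) (p : A) (y : 'I_m -> K) j :
  ((p \mPo lq)^`M(j)).@[y] =
  \sum_l (p^`M(l)).@[fun i => (tnth lq i).@[y]] * ((tnth lq l)^`M(j)).@[y].
Proof.
elim/mpoly_ring_ind: p => [c|i|p q IHp IHq|p q IHp IHq].
- rewrite comp_mpolyC mderivC meval0 big1 // => l _.
  by rewrite mderivC meval0 mul0r.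
- rewrite comp_mpolyXU -tnth_nth (bigD1 i) //= mderivXU eqxx meval1 mul1r.
  by rewrite big1 ?addr0 // => l /negPf; rewrite mderivXU eq_sym => ->; rewrite meval0 mul0r.
- rewrite comp_mpolyD mderivD mevalD IHp IHq -big_split; apply: eq_bigr => l _.
  by rewrite mderivD mevalD mulrDl.
- rewrite rmorphM /= mderivM mevalD !mevalM IHp IHq !comp_mpoly_meval.
  rewrite mulr_suml mulr_sumr -big_split; apply: eq_bigr => l _.
  by rewrite mderivM mevalD !mevalM /=; ring.
Qed.

Lemma ordge2P (p : A) : p@_0%MM = 0 -> (forall j, p@_U_(j) = 0) -> ordge 2 p.
Proof.
move=> p0 pU; apply/ordgeP => m; case E: (mdeg m) => [|[|//]] _.
  by move/eqP: E; rewrite mdeg_eq0 => /eqP->.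
by move/eqP/mdeg1P: E => [i /eqP->].
Qed.

End MPolyMisc.

(** * Local primality at a smooth point of a complete intersection *)

Section Smooth.
Variables (K : fieldType) (n r : nat) (g : 'I_r -> {mpoly K[n]}) (x : 'I_n -> K).
Local Notation A := {mpoly K[n]}.
Hypothesis gx : forall i, (g i).@[x] = 0.
Hypothesis jac : row_free (\matrix_(i < r, l < n) ((g i)^`M(l)).@[x]).

(* The contraction of the localisation of [I] at [y]. *)
Definition germ_ideal (y : 'I_n -> K) (I : set A) : set A :=
  [set h | exists q, q.@[y] != 0 /\ I (q * h)].

(** The Gaussian decomposition of the Jacobian matrix supplies an invertible recombination of the
    equations and an affine change of coordinates moving x to the origin; together they bring the
    equations to the triangular form of the previous section. *)
Lemma smooth_local_prime (h k : A) : germ_ideal x (gen_ideal g) (h * k) ->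
  germ_ideal x (gen_ideal g) h \/ germ_ideal x (gen_ideal g) k.
Proof.
pose D := \matrix_(i < r, l < n) ((g i)^`M(l)).@[x].
have rD : \rank D = r by apply/eqP.
have rn : (r <= n)%N by rewrite -rD rank_leq_col.
pose C := col_ebase D; pose L := invmx (row_ebase D).
have uR : row_ebase D \in unitmx by apply: row_ebase_unit.
have uC : C \in unitmx by apply: col_ebase_unit.
pose g' (i : 'I_r) : A := \sum_j invmx C i j *: g j.
have DL : invmx C *m D *m L = pid_mx r.
  by rewrite -{1}(mulmx_ebase D) rD -/C !mulmxA mulVmx // mul1mx mulmxK.
(* Composition with the affine map that sends 0 to x and has linear part [L]: the derivatives of
   [tau (g' i)] at 0 form the matrix C^-1 D L, a partial identity by [DL]. The inverse substitution
   is [tau']. *)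
pose tau : A -> A := comp_mpoly [tuple (x l)%:MP + \sum_j L l j *: 'X_j | l < n].
pose tau' : A -> A := comp_mpoly [tuple \sum_j row_ebase D l j *: ('X_j - (x j)%:MP) | l < n].
have tauX l : tau 'X_l = (x l)%:MP + \sum_j L l j *: 'X_j.
  by rewrite /tau comp_mpolyXU -tnth_nth tnth_mktuple.
have tauX' l : tau' 'X_l = \sum_j row_ebase D l j *: ('X_j - (x j)%:MP).
  by rewrite /tau' comp_mpolyXU -tnth_nth tnth_mktuple.
have tauK p : tau (tau' p) = p.
  rewrite /tau /tau' comp_mpoly_comp -[RHS]comp_mpoly_id; congr (p \mPo _).
  apply: eq_from_tnth => l; rewrite !tnth_mktuple linear_sum /=.
  under eq_bigr => j _ do rewrite linearZ /= comp_mpolyB comp_mpolyC -/tau tauX addrAC subrr add0r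
      scaler_sumr.
  rewrite exchange_big /= (bigD1 l) //= [X in _ + X]big1 ?addr0 => [|j /negPf jl];
    under eq_bigr => i _ do rewrite scalerA; (rewrite -scaler_suml); last first.
    have := congr1 (fun M : 'M_n => M l j) (mulmxV uR); rewrite !mxE eq_sym jl => ->.
    by rewrite scale0r.
  by have := congr1 (fun M : 'M_n => M l l) (mulmxV uR); rewrite !mxE eqxx => ->; rewrite scale1r.
have tau'K p : tau' (tau p) = p.
  rewrite /tau /tau' comp_mpoly_comp -[RHS]comp_mpoly_id; congr (p \mPo _).
  apply: eq_from_tnth => l; rewrite !tnth_mktuple linearD linear_sum /= comp_mpolyC.
  under eq_bigr => j _ do rewrite linearZ /= -/tau' tauX' scaler_sumr.
  rewrite exchange_big /= (bigD1 l) //= [X in _ + (_ + X)]big1 ?addr0 => [|j /negPf jl];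
    under eq_bigr => i _ do rewrite scalerA; (rewrite -scaler_suml); last first.
    have := congr1 (fun M : 'M_n => M l j) (mulVmx uR); rewrite !mxE eq_sym jl => ->.
    by rewrite scale0r.
  have := congr1 (fun M : 'M_n => M l l) (mulVmx uR); rewrite !mxE eqxx => ->.
  by rewrite scale1r addrC subrK.
have tau0 p : (tau p)@_0%MM = p.@[x].
  rewrite mcoeff_at0 /tau comp_mpoly_meval; apply: meval_eq => l.
  rewrite tnth_mktuple mevalD mevalC meval_sum big1 ?addr0 // => j _.
  by rewrite mevalZ mevalXU mulr0.
have tauU p j : (tau p)@_U_(j) = \sum_l (p^`M(l)).@[x] * L l j.
  rewrite mcoeff_atU chain_rule; apply: eq_bigr => l _; congr (_ * _).
    apply: meval_eq => i; rewrite tnth_mktuple mevalD mevalC meval_sum big1 ?addr0 // => k' _.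
    by rewrite mevalZ mevalXU mulr0.
  rewrite tnth_mktuple mderivD mderivC add0r mderiv_sum meval_sum (bigD1 j) //=.
  rewrite mderivZ mevalZ mderivXU eqxx meval1 mulr1 big1 ?addr0 // => k' /negPf.
  by rewrite mderivZ mevalZ mderivXU => ->; rewrite meval0 mulr0.
pose S (l : 'I_n) : A := if insub (l : nat) is Some i then tau (g' i) else 'X_l.
pose E : pred 'I_n := fun l => (l < r)%N.
have SX l : ~~ E l -> S l = 'X_l by rewrite /S /E; case: insubP => // i -> .
have g'x i : (g' i).@[x] = 0.
  by rewrite meval_sum big1 // => j _; rewrite /= mevalZ gx mulr0.
have S2 l : ordge 2 (S l - 'X_l).
  rewrite /S; case: insubP => [i lr il|_]; last by rewrite subrr; apply: ordge0.
  apply: ordge2P => [|j].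
    by rewrite mcoeffB tau0 g'x mcoeffX mnm1_eq0 subr0.
  rewrite mcoeffB tauU mcoeffXU.
  have := congr1 (fun M : 'M_(r, n) => M i j) DL; rewrite [X in _ = X -> _]mxE.
  rewrite -[X in _ == X :> nat]/(val j) il -val_eqE /=.
  rewrite lr andbT => <-; apply/eqP; rewrite subr_eq0; apply/eqP.
  rewrite mxE; apply: eq_bigr => m _; congr (_ * _).
  rewrite mxE mderiv_sum meval_sum; apply: eq_bigr => j' _.
  by rewrite mderivZ mevalZ mxE.
pose J : set A := [set y | exists c : 'I_n -> A, y = \sum_(l | E l) c l * S l].
have Jg p : gen_ideal g p -> J (tau p).
  move=> [c ->]; have eg i : g i = \sum_j C i j *: g' j.
    under eq_bigr => j _ do rewrite scaler_sumr.
    rewrite exchange_big /= (bigD1 i) //= [X in _ + X]big1 ?addr0 => [|j /negPf ji];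
      under eq_bigr => m _ do rewrite scalerA; (rewrite -scaler_suml); last first.
      have := congr1 (fun M : 'M_r => M i j) (mulmxV uC); rewrite !mxE eq_sym ji => ->.
      by rewrite scale0r.
    by have := congr1 (fun M : 'M_r => M i i) (mulmxV uC); rewrite !mxE eqxx => ->; rewrite scale1r.
  pose d (j : 'I_r) : A := \sum_i c i * (C i j)%:MP.
  have -> : \sum_i c i * g i = \sum_j d j * g' j.
    under eq_bigr => i _ do rewrite eg mulr_sumr.
    rewrite exchange_big; apply: eq_bigr => j _; rewrite mulr_suml; apply: eq_bigr => i _.
    by rewrite -mul_mpolyC mulrA.
  exists (fun l => if insub (l : nat) is Some i then tau (d i) else 0).
  rewrite /tau rmorph_sum /= (big_ord_narrow rn); apply: eq_bigr => i _.
  rewrite /S /= insubT //= => lt; have -> : Sub (val i) lt = i by exact: val_inj.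
  by rewrite rmorphM.
have gJ p : J p -> gen_ideal g (tau' p).
  have [G0 GD GM] := gen_ideal_is_ideal g.
  move=> [c ->]; rewrite /tau' rmorph_sum /=; apply: ideal_sum; first exact: gen_ideal_is_ideal.
  move=> l El; rewrite rmorphM /= -/tau'; apply: (GM).
  rewrite /S; case: insubP => [i _ _|]; last by rewrite -/(E l) El.
  rewrite tau'K; apply: ideal_sum => [|j _]; first exact: gen_ideal_is_ideal.
  by rewrite -mul_mpolyC; apply: (GM); apply: gen_idealW.
move=> [q [qx /Jg]]; rewrite /tau !rmorphM /= -/tau => Jq.
have [] := triangular_local_prime S2 SX _ Jq; first by rewrite tau0.
  move=> [q' [q'0 /gJ]]; rewrite /tau' rmorphM /= -/tau' tau'K => Gh; left.
  by exists (tau' q'); rewrite -tau0 tauK q'0 oner_eq0.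
move=> [q' [q'0 /gJ]]; rewrite /tau' rmorphM /= -/tau' tau'K => Gh; right.
by exists (tau' q'); rewrite -tau0 tauK q'0 oner_eq0.
Qed.

End Smooth.

Section Dependence.
Variables (K : fieldType) (n : nat).
Local Notation A := {mpoly K[n]}.

(** The coefficient matrix has more rows than columns, so it has a left kernel. *)
Lemma bounded_mpoly_dependent d N (c : 'I_N -> A) :
  (#|{: 'X_{1..n < d}}| < N)%N -> (forall i, (msize (c i) <= d)%N) ->
  exists2 l : 'rV[K]_N, l != 0 & \sum_i l ord0 i *: c i = 0.
Proof.
pose T : finType := 'X_{1..n < d}.
move=> TN cd.
pose M := \matrix_(i < N, j < #|T|) (c i)@_(enum_val j : T).
have /rowV0Pn[l /sub_kermxP lM l0] : kermx M != 0.
  rewrite -mxrank_eq0 mxrank_ker -lt0n subn_gt0.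
  exact: leq_ltn_trans (rank_leq_col _) TN.
exists l => //; apply/mpolyP => m; rewrite raddf_sum mcoeff0 /=.
have [lt|le] := ltnP (mdeg m) d; last first.
  rewrite big1 // => i _; rewrite mcoeffZ; have -> : (c i)@_m = 0; last by rewrite mulr0.
  apply: memN_msupp_eq0; apply/negP => /msize_mdeg_lt.
  by rewrite ltnNge (leq_trans (cd i) le).
have := congr1 (fun v : 'rV_#|T| => v ord0 (enum_rank (BMultinom lt : T))) lM.
rewrite !mxE => e; rewrite -[RHS]e; apply: eq_bigr => i _.
by rewrite mcoeffZ mxE enum_rankK.
Qed.

End Dependence.

(** * The Nullstellensatz over an uncountable algebraically closed field *)

Section Nullstellensatz.
Variables (K : closedFieldType) (n : nat).
Local Notation A := {mpoly K[n]}.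

(* Uncountability of [K]: some colour class of a countable colouring is infinite. *)
Definition uncountable_field : Prop :=
  forall e : K -> nat, exists N, forall k, exists s : seq K,
    [/\ uniq s, size s = k & forall a, a \in s -> e a = N].

Hypothesis Kunc : uncountable_field.

(* The usual argument for uncountable fields: if no [X_i - a] lay in the maximal
   ideal, the inverses of uncountably many of them would be dependent. *)
Lemma nullstellensatz (J : set A) (h : A) : is_ideal J -> (forall N, ~ J (h ^+ N)) ->
  exists z : 'I_n -> K, (forall p, J p -> p.@[z] = 0) /\ h.@[z] != 0.
Proof.
move=> iJ hJ.
(* An ideal maximal among those that contain J and avoid the powers of h is prime; the point sought
   is the one at which the coordinates take their residues modulo this ideal. *)
have [||M [iM JM hM] Mmax] := @mpoly_noetherian K n
    [set M | [/\ is_ideal M, J `<=` M & forall N, ~ M (h ^+ N)]].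
- by exists J; split.
- by move=> I [].
have [M0 MD MM] := iM.
have far u : ~ M u -> exists N a m, [/\ M m & h ^+ N = m + a * u].
  move=> nu; apply: contrapT => no.
  pose M' := ideal_add M (principal u).
  have iM' : is_ideal M' by apply: ideal_add_is_ideal => //; apply: principal_is_ideal.
  have MM' : M `<=` M' by apply: ideal_addl; apply: principal_is_ideal.
  have Mu : M' u by exists 0, u; rewrite add0r; split=> //; exists 1; rewrite mul1r.
  apply: nu; rewrite -(Mmax M') //; split=> //; first exact: subset_trans MM'.
  by move=> N [m [_ [Mm [a ->] e]]]; apply: no; exists N, a, m.
have Mprime u v : M (u * v) -> M u \/ M v.
  move=> Muv; apply: contrapT => /not_orP[/far[N [a [m [Mm eu]]]] /far[N' [b [m' [Mm' ev]]]]].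
  apply: (hM (N + N')%N); rewrite exprD eu ev.
  have -> : (m + a * u) * (m' + b * v) = (m' + b * v) * m + (a * u) * m' + (a * b) * (u * v) by ring.
  by apply: (MD); [apply: (MD)|]; apply: (MM).
have M1 : ~ M 1 by move=> m1; apply: (hM 0%N); rewrite expr0.
have linear_mem i : exists a, M ('X_i - a%:MP).
  apply: contrapT => /forallNP no.
  have /choice[kd kdP] : forall a : K, exists kd : nat * nat, exists c m,
      [/\ M m, (msize c <= kd.2)%N & h ^+ kd.1 = m + c * ('X_i - a%:MP)].
    by move=> a; have [N [c [m [Mm e]]]] := far _ (no a); exists (N, msize c), c, m.
  (* The exponent of h and the size of the cofactor form a countable colouring of the scalars a, so
     some pair (k, d) is shared by more scalars than there are monomials of degree below d. The
     corresponding cofactors are then linearly dependent. *)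
  have [N0 HN0] := Kunc (pickle \o kd).
  have [k [d kdE]] : exists k d, forall a, pickle (kd a) = N0 -> kd a = (k, d).
    have [s [_ s1 sP]] := HN0 1%N; case: s s1 sP => [//|a s] _ sP.
    case E: (kd a) => [k d]; exists k, d => b eb; rewrite -E; apply: (pcan_inj pickleK).
    by rewrite eb; apply/esym/sP; rewrite mem_head.
  pose N := #|{: 'X_{1..n < d}}|.+1.
  have [s [us sN sP]] := HN0 N.
  pose a (j : 'I_N) := nth 0 s j.
  have kda j : kd (a j) = (k, d) by apply: kdE; apply: sP; rewrite mem_nth ?sN.
  have /choice[c cP] : forall j, exists c, (msize c <= d)%N /\
      exists2 m, M m & h ^+ k = m + c * ('X_i - (a j)%:MP).
    by move=> j; have [c [m]] := kdP (a j); rewrite kda => -[Mm cd e]; exists c; split=> //; exists m.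
  have [l l0 lc] := @bounded_mpoly_dependent K n d N c (ltnSn _) (fun j => (cP j).1).
  pose phi : {poly K} -> A := horner_alg 'X_i.
  have phiX b : phi ('X - b%:P) = 'X_i - b%:MP.
    by rewrite /phi rmorphB /= horner_algX horner_algC -mul_mpolyC mulr1.
  pose P j : {poly K} := \prod_(j' < N | j' != j) ('X - (a j')%:P).
  pose PP : {poly K} := \prod_(j < N) ('X - (a j)%:P).
  (* As in Lagrange interpolation, evaluating at the [a j] shows that [Q] is nonzero. The dependence
     of the [c j] makes h^k Q(X_i) a combination of the elements h^k - c_j (X_i - a_j) of M;
     primality then puts some linear factor of Q(X_i) into M. *)
  pose Q := \sum_j l ord0 j *: P j.
  have Q0 : Q != 0.
    have [j lj] : exists j, l ord0 j != 0.
      apply: contrapT => nol; case/eqP: l0; apply/rowP => j; rewrite mxE.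
      by apply/eqP; apply: contrapT => lj; apply: nol; exists j; apply/negP.
    apply/eqP => /(congr1 (fun q => q.[a j])); rewrite horner0 horner_sum (bigD1 j) //=.
    rewrite big1 ?addr0 => [|j' jj']; last first.
      rewrite hornerZ /P horner_prod (bigD1 j) 1?eq_sym //=.
      by rewrite hornerXsubC subrr mul0r mulr0.
    apply/eqP; rewrite hornerZ mulf_neq0 // horner_prod prodf_seq_neq0.
    apply/allP => j' _; apply/implyP => jj'; rewrite hornerXsubC subr_eq0.
    by rewrite nth_uniq ?sN // -val_eqE eq_sym in jj' *.
  have MQ : M (phi Q).
    suff : M (h ^+ k * phi Q) by case/Mprime => // /hM.
    have -> : h ^+ k * phi Q = \sum_j (l ord0 j *: phi (P j)) * (h ^+ k - c j * ('X_i - (a j)%:MP)).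
      transitivity (h ^+ k * phi Q - phi PP * \sum_j l ord0 j *: c j); first by rewrite lc mulr0 subr0.
      rewrite /phi linear_sum /= !mulr_sumr -sumrB; apply: eq_bigr => j _.
      rewrite linearZ /= /PP (bigD1 j) //= rmorphM /= -/phi phiX -/(P j).
      by rewrite -!mul_mpolyC; ring.
    apply: ideal_sum => // j _; apply: (MM); have [_ [m Mm ->]] := cP j.
    by rewrite addrK.
  have [rs eQ] := closed_field_poly_normal Q.
  have {MQ} : M (phi (\prod_(z <- rs) ('X - z%:P))).
    have lQ : lead_coef Q != 0 by rewrite lead_coef_eq0.
    have -> : \prod_(z <- rs) ('X - z%:P) = (lead_coef Q)^-1 *: Q.
      by rewrite {2}eQ scalerA mulVf // scale1r.
    by rewrite /phi linearZ /= -mul_mpolyC; apply: (MM).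
  elim: rs {eQ} => [|z rs IH]; first by rewrite big_nil /phi rmorph1.
  rewrite big_cons /phi rmorphM /= -/phi phiX => /Mprime[|//].
  exact: no.
have [z zP] := choice linear_mem.
have eval p : M (p - (p.@[z])%:MP).
  elim/mpoly_ring_ind: p => [c|i|p q IHp IHq|p q IHp IHq].
  - by rewrite mevalC subrr.
  - by rewrite mevalXU.
  - by rewrite mevalD mpolyCD opprD addrACA; apply: (MD).
  - rewrite mevalM mpolyCM.
    have -> : p * q - p.@[z]%:MP * q.@[z]%:MP =
      q * (p - p.@[z]%:MP) + p.@[z]%:MP * (q - q.@[z]%:MP) by ring.
    by apply: (MD); apply: (MM).
exists z; split=> [p Jp|].
  apply/eqP; apply: contrapT => /negP pz; apply: M1.
  have Mc : M (p.@[z])%:MP.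
    rewrite -(subKr p (p.@[z])%:MP); apply: ideal_sub => //; exact: JM.
  have -> : 1 = (p.@[z]^-1)%:MP * (p.@[z])%:MP :> A by rewrite -mpolyCM mulVf.
  exact: MM.
apply/eqP => hz; apply: (hM 1%N); rewrite expr1 -(subrK (h.@[z])%:MP h).
by apply: (MD) => //; rewrite hz mpolyC0.
Qed.

End Nullstellensatz.

Section SmoothZeros.
Variables (K : closedFieldType) (n r : nat) (g : 'I_r -> {mpoly K[n]}) (x : 'I_n -> K).
Hypothesis Kunc : uncountable_field K.
Hypothesis gx : forall i, (g i).@[x] = 0.
Hypothesis jac : row_free (\matrix_(i < r, l < n) ((g i)^`M(l)).@[x]).

(** The Nullstellensatz puts a power of q h into the ideal of the equations, and local primality at
    x removes the exponent and the unit q. *)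
Lemma smooth_vanishing (h q : {mpoly K[n]}) : q.@[x] != 0 ->
  (forall z, (forall i, (g i).@[z] = 0) -> q.@[z] != 0 -> h.@[z] = 0) ->
  germ_ideal x (gen_ideal g) h.
Proof.
move=> qx van; have iG := gen_ideal_is_ideal g.
have prime a b := @smooth_local_prime K n r g x gx jac a b.
have [N GN] : exists N, gen_ideal g ((q * h) ^+ N).
  apply: contrapT => /forallNP no.
  have [z [zg]] := nullstellensatz Kunc iG no.
  rewrite mevalM mulf_eq0 negb_or => /andP[qz /eqP]; apply; apply: van => // i.
  by apply: zg; apply: gen_idealW.
have ng1 p : gen_ideal g p -> p.@[x] = 0.
  by move=> [c ->]; rewrite meval_sum big1 // => i _; rewrite mevalM gx mulr0.
have [G0 GD GM] := iG.
suff [q' [q'x Gq']] : germ_ideal x (gen_ideal g) (q * h).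
  by exists (q' * q); rewrite mevalM mulf_neq0 // -mulrA.
have {GN} : germ_ideal x (gen_ideal g) ((q * h) ^+ N).
  by exists 1; rewrite meval1 oner_eq0 mul1r.
elim: N => [|N IH]; last by rewrite exprS => /prime[//|/IH].
by rewrite expr0 => -[q' [q'x]]; rewrite mulr1 => /ng1 e; rewrite e eqxx in q'x.
Qed.

End SmoothZeros.

(** * Uncountability of the complex numbers *)

Section RealsUncountable.
Variable R : realType.

(** Of the two outer thirds of an interval at least one misses a given point. *)
Lemma avoid_finite (s : seq R) (a b : R) : a < b ->
  exists p : R * R, [/\ a <= p.1, p.1 < p.2, p.2 <= b &
    forall x, x \in s -> p.1 <= x -> x <= p.2 -> False].
Proof.
move=> ab; elim: s => [|x s [[c d] /= [ac cd db avoid]]]; first by exists (a, b).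
have [lx|lx] := lerP x ((2 * c + d) / 3).
  exists ((c + 2 * d) / 3, d) => /=; split; try lra.
  by move=> y; rewrite inE => /orP[/eqP->|ys] h1 h2; [lra|apply: (avoid y ys); lra].
exists (c, (2 * c + d) / 3) => /=; split; try lra.
by move=> y; rewrite inE => /orP[/eqP->|ys] h1 h2; [lra|apply: (avoid y ys); lra].
Qed.

(** Cantor's nested intervals on the real line: if every colour class were finite, interval N + 1
    could be chosen to miss the class of N, and the common point of all intervals would miss its own
    class. *)
Lemma complex_uncountable : uncountable_field R[i].
Proof.
move=> e; apply: contrapT => /forallNP nofin.
have class N : exists s : seq R, forall x : R, e x%:C%C = N -> x \in s.
  apply: contrapT => no; apply: (nofin N) => k.
  suff [s [us sk sP]] : exists s : seq R, [/\ uniq s, size s = k & forall x, x \in s -> e x%:C%C = N].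
    exists (map (fun x => x%:C%C) s); rewrite size_map map_inj_uniq; last exact: complexI.
    by split=> // _ /mapP[x xs ->]; apply: sP.
  elim: k => [|k [s [us sk sP]]]; first by exists [::].
  have [x ex xs] : exists2 x, e x%:C%C = N & x \notin s.
    apply: contrapT => nox; apply: no; exists s => x ex.
    by apply/negPn/negP => xs; apply: nox; exists x.
  exists (x :: s); rewrite /= xs us sk; split=> // y; rewrite inE => /orP[/eqP->//|].
  exact: sP.
have step (Np : nat * {p : R * R | p.1 < p.2}) : exists q : {p : R * R | p.1 < p.2},
   [/\ (sval Np.2).1 <= (sval q).1, (sval q).2 <= (sval Np.2).2 &
    forall x, e x%:C%C = Np.1 -> (sval q).1 <= x -> x <= (sval q).2 -> False].
  case: Np => N [[a b] /= ab]; have [s sP] := class N.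
  have [p [h1 h2 h3 h4]] := avoid_finite s ab; exists (exist _ p h2); split=> //= x ex.
  by apply: h4; apply: sP.
have [nxt nxtP] := choice step.
pose I := fix I k := if k is l.+1 then nxt (l, I l)
  else exist (fun p : R * R => p.1 < p.2) (0, 1) ltr01.
have Il : {homo (fun k => (sval (I k)).1) : i j / (i <= j)%N >-> i <= j}.
  by apply: homo_leq => // [x y z|k]; [exact: le_trans|have [] := nxtP (k, I k)].
have Ir : {homo (fun k => (sval (I k)).2) : i j / (i <= j)%N >-> j <= i}.
  apply: (@homo_leq _ _ (fun x y => y <= x)) => // [x y z xy yz|k]; first exact: le_trans xy.
  by have [] := nxtP (k, I k).
have lr j k : (sval (I j)).1 <= (sval (I k)).2.
  apply: le_trans (Il j (maxn j k) (leq_maxl _ _)) _.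
  by apply: le_trans (ltW (svalP (I (maxn j k)))) (Ir _ _ (leq_maxr _ _)).
pose L : set R := [set (sval (I k)).1 | k in setT].
have L0 : L !=set0 by exists (sval (I 0%N)).1; exists 0%N.
have ubL k : ubound L (sval (I k)).2 by move=> _ [j _ <-].
pose x := sup L.
have [_ _ avoid] := nxtP (e x%:C%C, I (e x%:C%C)).
apply: (avoid x erefl).
  by apply: (ub_le_sup (E := L)); [exists (sval (I 0%N)).2|exists (e x%:C%C).+1].
by apply: (ge_sup L0); apply: (ubL (e x%:C%C).+1).
Qed.

End RealsUncountable.

(** * Spaces with functions *)

Section Subbase.
Variables (T : topologicalType) (D : set (set T)).
Hypothesis openE : @open T =
  [set \bigcup_(i in D') i | D' in subset^~ (finI_from D id)].

Lemma subbase_open W : D W -> open W.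
Proof.
move=> DW; rewrite openE; exists [set W]; last by rewrite bigcup_set1.
move=> _ ->; exists [fset W]%fset; last by rewrite set_fset1 bigcap_set1.
by move=> i /fset1P->; apply: mem_set.
Qed.

(** Taking for F an image filter yields continuity; taking the sets that contain a principal open
    set around x yields a basis of neighbourhoods. *)
Lemma subbase_filter (F : set_system T) (x : T) : Filter F ->
  (forall W, D W -> W x -> F W) -> forall P, nbhs x P -> F P.
Proof.
move=> FF FW P; rewrite nbhsE => -[B [oB Bx] BP].
move: oB; rewrite openE => -[D' D'D eB].
move: (Bx); rewrite -eB => -[I DI Ix]; apply: (filterS (P := I)).
  by move=> y Iy; apply: BP; rewrite -eB; exists I.
have [s sD eI] := D'D _ DI; move: Ix; rewrite -eI => Ix.
apply: filter_bigI => i si; apply: FW; first exact: set_mem (sD i si).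
exact: Ix.
Qed.

Lemma subbase_cont (S : topologicalType) (v : S -> T) (t : S) :
  (forall W, D W -> W (v t) -> nbhs t (v @^-1` W)) ->
  forall P, nbhs (v t) P -> nbhs t (v @^-1` P).
Proof. by move=> H P; apply: (@subbase_filter (v @ t) (v t)). Qed.

End Subbase.

(** * Germs of regular functions and morphisms at a point *)

Section Local.
Variable K : fieldType.
Implicit Types T S X Y : fspace K.

(** By definition an [fspace] has no algebraic structure on its germs. These properties hold for
    affine spaces and Grassmannians, pass to subspaces and products, and hold for every variety by
    [lr_variety]. *)
Record locally_ringed T : Prop := LocallyRinged {
  lr_cst : forall c t, regular_at (fun=> c) (t : T);
  lr_add : forall h k (t : T), regular_at h t -> regular_at k t ->
    regular_at (fun s => h s + k s) t;
  lr_mul : forall h k (t : T), regular_at h t -> regular_at k t ->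
    regular_at (fun s => h s * k s) t;
  lr_inv : forall h (t : T), regular_at h t -> h t != 0 ->
    regular_at (fun s => (h s)^-1) t;
  lr_neq0 : forall h (t : T), regular_at h t -> h t != 0 ->
    \forall s \near t, h s != 0;
  lr_near : forall h (t : T), regular_at h t ->
    \forall s \near t, regular_at h s }.

Lemma near_all (T : topologicalType) (x : T) (P : set T) : (forall y, P y) -> \forall y \near x, P y.
Proof. by move=> HP; apply: filterS (@filterT _ (nbhs x) _) => y _; apply: HP. Qed.

Section Near.
Variables (T : topologicalType) (x : T).
Implicit Types P Q : set T.

Lemma near_imp P Q : (forall y, P y -> Q y) -> (\forall y \near x, P y) -> \forall y \near x, Q y.
Proof. by move=> PQ; apply: filterS. Qed.

Lemma near_imp2 P P' Q : (forall y, P y -> P' y -> Q y) ->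
  (\forall y \near x, P y) -> (\forall y \near x, P' y) -> \forall y \near x, Q y.
Proof. by move=> PQ; apply: filterS2. Qed.

Lemma near_imp3 P P' P'' Q : (forall y, P y -> P' y -> P'' y -> Q y) ->
  (\forall y \near x, P y) -> (\forall y \near x, P' y) -> (\forall y \near x, P'' y) ->
  \forall y \near x, Q y.
Proof. by move=> PQ; apply: filterS3. Qed.

Lemma near_imp4 P P' P'' P''' Q : (forall y, P y -> P' y -> P'' y -> P''' y -> Q y) ->
  (\forall y \near x, P y) -> (\forall y \near x, P' y) -> (\forall y \near x, P'' y) ->
  (\forall y \near x, P''' y) -> \forall y \near x, Q y.
Proof.
move=> PQ p1 p2 p3 p4; apply: near_imp2 (filterI p1 p2) (filterI p3 p4).
by move=> y [? ?] [? ?]; apply: PQ.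
Qed.

Lemma near_near P : (\forall y \near x, P y) -> \forall y \near x, \forall z \near y, P z.
Proof. by move=> /nbhs_interior. Qed.

Lemma near_forall_fin (I : finType) (P : I -> T -> Prop) :
  (forall i, \forall y \near x, P i y) -> \forall y \near x, forall i, P i y.
Proof. exact: filter_forall. Qed.

End Near.

Lemma regular_eq T (t : T) (h h' : T -> K) :
  (\forall s \near t, h s = h' s) -> regular_at h t -> regular_at h' t.
Proof. by move=> e; apply: regular_germ; apply: near_imp e => s ->. Qed.

Section Closure.
Variables (T : fspace K) (lrT : locally_ringed T).
Implicit Types (h : T -> K) (t : T).

Lemma lr_opp h t : regular_at h t -> regular_at (fun s => - h s) t.
Proof.
move=> rh; apply: (regular_eq (h := fun s => -1 * h s)).
  by apply: near_all => s; rewrite mulN1r.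
by apply: lr_mul => //; apply: lr_cst.
Qed.

Lemma lr_sub h k t : regular_at h t -> regular_at k t -> regular_at (fun s => h s - k s) t.
Proof. by move=> rh rk; apply: lr_add => //; apply: lr_opp. Qed.

Lemma lr_div h k t : regular_at h t -> regular_at k t -> k t != 0 ->
  regular_at (fun s => h s / k s) t.
Proof. by move=> rh rk k0; apply: lr_mul => //; apply: lr_inv. Qed.

Lemma lr_sum (I : Type) (s : seq I) (P : pred I) (F : I -> T -> K) t :
  (forall i, P i -> regular_at (F i) t) ->
  regular_at (fun u => \sum_(i <- s | P i) F i u) t.
Proof.
move=> rF; elim: s => [|i s IH].
  by apply: (regular_eq (h := fun=> 0)); [apply: near_all => u; rewrite big_nil|apply: lr_cst].
case E: (P i); last first.
  by apply: regular_eq IH; apply: near_all => u; rewrite big_cons E.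
apply: (regular_eq (h := fun u => F i u + \sum_(j <- s | P j) F j u)).
  by apply: near_all => u; rewrite big_cons E.
by apply: lr_add => //; apply: rF.
Qed.

Lemma lr_prod (I : Type) (s : seq I) (P : pred I) (F : I -> T -> K) t :
  (forall i, P i -> regular_at (F i) t) ->
  regular_at (fun u => \prod_(i <- s | P i) F i u) t.
Proof.
move=> rF; elim: s => [|i s IH].
  by apply: (regular_eq (h := fun=> 1)); [apply: near_all => u; rewrite big_nil|apply: lr_cst].
case E: (P i); last first.
  by apply: regular_eq IH; apply: near_all => u; rewrite big_cons E.
apply: (regular_eq (h := fun u => F i u * \prod_(j <- s | P j) F j u)).
  by apply: near_all => u; rewrite big_cons E.
by apply: lr_mul => //; apply: rF.
Qed.

Lemma lr_exp h t k : regular_at h t -> regular_at (fun s => h s ^+ k) t.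
Proof.
move=> rh; elim: k => [|k IH]; first exact: lr_cst.
apply: (regular_eq (h := fun s => h s * h s ^+ k)); first by apply: near_all => s; rewrite exprS.
exact: lr_mul.
Qed.

Lemma lr_meval n (P : {mpoly K[n]}) (v : T -> 'I_n -> K) t :
  (forall i, regular_at (fun s => v s i) t) -> regular_at (fun s => P.@[v s]) t.
Proof.
move=> rv; apply: (regular_eq (h := fun s => \sum_(m <- msupp P) P@_m * \prod_i v s i ^+ m i)).
  by apply: near_all => s; rewrite mevalE.
apply: lr_sum => m _; apply: lr_mul => //; first exact: lr_cst.
by apply: lr_prod => i _; apply: lr_exp.
Qed.

Lemma lr_det k (M : T -> 'M[K]_k) t :
  (forall i j, regular_at (fun s => M s i j) t) -> regular_at (fun s => \det (M s)) t.
Proof.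
move=> rM; rewrite /determinant; apply: lr_sum => s _; apply: lr_mul => //.
  exact: lr_cst.
by apply: lr_prod => i _; apply: rM.
Qed.

End Closure.

(** Maps are total but often meaningful only near one point, with arbitrary values elsewhere; so the
    notion of morphism is needed point by point. *)
Definition morph_at T S (g : T -> S) (t : T) : Prop :=
  (forall P : set S, nbhs (g t) P -> nbhs t (g @^-1` P)) /\
  forall h : S -> K, regular_at h (g t) -> regular_at (h \o g) t.

Lemma morphismP T S (g : T -> S) : morphism g <-> forall t, morph_at g t.
Proof.
split=> [[cg rg] t|mg]; first by split; [move=> P; apply: cg|apply: rg].
by split=> [t P|t h]; [case: (mg t) => + _; apply|case: (mg t) => _; apply].
Qed.

Lemma morph_at_eq T S (g g' : T -> S) t :
  (\forall s \near t, g s = g' s) -> morph_at g t -> morph_at g' t.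
Proof.
move=> e [cg rg]; have et := nbhs_singleton e; split=> [P|h].
  by rewrite -et => /cg; apply: near_imp2 e => s /= ->.
by rewrite -et => /rg; apply: regular_eq; apply: near_imp e => s /= ->.
Qed.

Lemma morph_at_comp T S X (g : T -> S) (k : S -> X) t :
  morph_at g t -> morph_at k (g t) -> morph_at (k \o g) t.
Proof.
move=> [cg rg] [ck rk]; split=> [P /ck /cg//|h /rk].
exact: rg.
Qed.

Lemma morph_at_id T (t : T) : morph_at id t.
Proof. by []. Qed.

Lemma morph_at_cst T S (lrT : locally_ringed T) (s : S) (t : T) : morph_at (fun=> s) t.
Proof.
split=> [P /nbhs_singleton Ps|h _]; last exact: lr_cst.
exact: near_all.
Qed.

Lemma aff_openE n : @open (zaff K n) =
  [set \bigcup_(i in D') i | D' in subset^~ (finI_from (@zaff_subbase K n) id)].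
Proof. by []. Qed.

Lemma aff_near_neq0 n (Q : {mpoly K[n]}) (x : aff K n) : Q.@[x ord0] != 0 ->
  \forall y \near x, Q.@[(y : 'rV_n) ord0] != 0.
Proof.
move=> Qx; have oW : @open (zaff K n) [set y : zaff K n | Q.@[y ord0] != 0].
  by apply: (@subbase_open (zaff K n) _ (aff_openE n)); exists Q.
exact: (@open_nbhs_nbhs (zaff K n) x _ (conj oW Qx)).
Qed.

Lemma lr_aff n : locally_ringed (aff K n).
Proof.
split.
- move=> c t; exists c%:MP, 1; rewrite meval1 oner_neq0; split=> //.
  by apply: near_all => y; rewrite mevalC meval1 divr1.
- move=> h k t [P [Q [Q0 e]]] [P' [Q' [Q0' e']]]; exists (P * Q' + P' * Q), (Q * Q').
  rewrite mevalM mulf_neq0 //; split=> //.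
  apply: near_imp4 e e' (aff_near_neq0 Q0) (aff_near_neq0 Q0') => y -> -> ? ?.
  by rewrite mevalD !mevalM addf_div.
- move=> h k t [P [Q [Q0 e]]] [P' [Q' [Q0' e']]]; exists (P * P'), (Q * Q').
  rewrite mevalM mulf_neq0 //; split=> //.
  by apply: near_imp2 e e' => y -> ->; rewrite !mevalM mulf_div.
- move=> h t [P [Q [Q0 e]]] h0; exists Q, P.
  have P0 : P.@[t ord0] != 0.
    by apply: contra_neq h0 => P0; rewrite (nbhs_singleton e) P0 mul0r.
  by split=> //; apply: near_imp e => y ->; rewrite invf_div.
- move=> h t [P [Q [Q0 e]]] h0.
  have P0 : P.@[t ord0] != 0.
    by apply: contra_neq h0 => P0; rewrite (nbhs_singleton e) P0 mul0r.
  move: (aff_near_neq0 Q0) (aff_near_neq0 P0).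
  by apply: near_imp3 e => y -> ? ?; rewrite mulf_neq0 ?invr_neq0.
- move=> h t [P [Q [Q0 e]]]; move: (aff_near_neq0 Q0) (nbhs_interior e).
  by apply: near_imp2 => y Qy ey; exists P, Q.
Qed.

Lemma aff_regular_meval n (P : {mpoly K[n]}) (x : aff K n) :
  regular_at (fun y : aff K n => P.@[(y : 'rV_n) ord0]) x.
Proof.
exists P, 1; rewrite meval1 oner_neq0; split=> //.
by apply: near_all => y; rewrite meval1 divr1.
Qed.

Lemma aff_regular_coord n (i : 'I_n) (x : aff K n) :
  regular_at (fun y : aff K n => (y : 'rV_n) ord0 i) x.
Proof.
apply: regular_eq (aff_regular_meval 'X_i x).
by apply: near_all => y; rewrite mevalXU.
Qed.

Lemma morph_at_aff T n (v : T -> aff K n) t : locally_ringed T ->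
  (forall i, regular_at (fun s => (v s : 'rV_n) ord0 i) t) -> morph_at v t.
Proof.
move=> lrT rv; have cv P : nbhs (v t) P -> nbhs t (v @^-1` P).
  move: P; apply: (@subbase_cont (zaff K n) _ (aff_openE n)) => _ [Q ->] /= Qv.
  by apply: (lr_neq0 lrT _ Qv); apply: lr_meval.
split=> // h [P [Q [Q0 /cv e]]].
apply: (regular_eq (h := fun s => P.@[(v s : 'rV_n) ord0] / Q.@[(v s : 'rV_n) ord0])).
  by apply: near_imp e => s /= ->.
by apply: lr_div => //; apply: lr_meval.
Qed.

Lemma fsub_near T (A : set T) (x : fsub A) (P : set T) :
  nbhs (set_val x) P -> nbhs x (set_val @^-1` P).
Proof. exact: (@initial_continuous A T set_val x). Qed.

Lemma fsub_nearE T (A : set T) (x : fsub A) (Q : set (fsub A)) : nbhs x Q ->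
  exists2 P, nbhs (set_val x) P & forall y : fsub A, P (set_val y) -> Q y.
Proof.
rewrite nbhsE => -[B [[P oP <-] /= Px] BQ]; exists P => //.
by apply: open_nbhs_nbhs.
Qed.

Lemma morph_val T (A : set T) (x : fsub A) : morph_at (set_val : fsub A -> T) x.
Proof.
split=> [P|h rh]; first exact: fsub_near.
by exists h; split=> //; apply: near_all.
Qed.

Lemma lr_fsub T (A : set T) : locally_ringed T -> locally_ringed (fsub A).
Proof.
move=> lrT; split.
- by move=> c t; exists (fun=> c); split; [apply: lr_cst|apply: near_all].
- move=> h k t [g [rg e]] [g' [rg' e']]; exists (fun s => g s + g' s).
  by split; [apply: lr_add|apply: near_imp2 e e' => y -> ->].
- move=> h k t [g [rg e]] [g' [rg' e']]; exists (fun s => g s * g' s).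
  by split; [apply: lr_mul|apply: near_imp2 e e' => y -> ->].
- move=> h t [g [rg e]] h0; exists (fun s => (g s)^-1); split; last by apply: near_imp e => y ->.
  by apply: lr_inv => //; rewrite -(nbhs_singleton e).
- move=> h t [g [rg e]] h0; have g0 : g (set_val t) != 0 by rewrite -(nbhs_singleton e).
  by have := fsub_near (lr_neq0 lrT rg g0); apply: near_imp2 e => y ->.
- move=> h t [g [rg e]]; have := fsub_near (lr_near lrT rg).
  by apply: near_imp2 (nbhs_interior e) => y ey rgy; exists g.
Qed.

Lemma morph_fsub T Y (A : set Y) (g : T -> fsub A) t :
  morph_at (fun s => set_val (g s)) t -> morph_at g t.
Proof.
move=> [cg rg]; have cg' P : nbhs (g t) P -> nbhs t (g @^-1` P).
  by move=> /fsub_nearE[Q nQ QP]; apply: near_imp (cg _ nQ) => s; apply: QP.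
split=> // h [k [rk /cg' e]]; apply: regular_eq (rg _ rk).
by apply: near_imp e => s /= ->.
Qed.

End Local.

(** * Products, separatedness and closed sets *)

Section Products.
Variable K : fieldType.
Implicit Types T S X Y : fspace K.

Section VProd.
Variables (T S : fspace K) (lrT : locally_ringed T) (lrS : locally_ringed S).
Implicit Types (p : vprod T S) (h : vprod T S -> K).

(** The numerators and denominators of regular functions on a product. They are stable under sums
    and products, so [lr_vprod] reduces to the arithmetic of fractions. *)
Definition tens_at p h : Prop :=
  exists n (a : 'I_n -> T -> K) (b : 'I_n -> S -> K),
    (forall i, regular_at (a i) p.1 /\ regular_at (b i) p.2) /\
    forall q, h q = tensor a b q.

Lemma zprod_openE : @open (zprod T S) =
  [set \bigcup_(i in D') i | D' in subset^~ (finI_from (@zprod_subbase K T S) id)].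
Proof. by []. Qed.

Lemma zprod_near_subbase p (U : set T) (V : set S) n
    (a : 'I_n -> T -> K) (b : 'I_n -> S -> K) :
  open U -> open V -> (forall i, regular_on U (a i)) ->
  (forall i, regular_on V (b i)) -> U p.1 -> V p.2 -> tensor a b p != 0 ->
  \forall q \near p, [/\ U q.1, V q.2 & tensor a b q != 0].
Proof.
move=> oU oV ra rb Up Vp ab0.
have oW : @open (zprod T S) [set q : zprod T S | [/\ U q.1, V q.2 & tensor a b q != 0]].
  by apply: (@subbase_open (zprod T S) _ zprod_openE); exists U, V, n, a, b.
exact: (@open_nbhs_nbhs (zprod T S) p _ (conj oW (And3 Up Vp ab0))).
Qed.

Lemma tens_cst c p : tens_at p (fun=> c).
Proof.
exists 1%N, (fun _ _ => c), (fun _ _ => 1); split; first by split; apply: lr_cst.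
by move=> q; rewrite /tensor big_ord1 mulr1.
Qed.

Lemma tens_fst (a : T -> K) p : regular_at a p.1 -> tens_at p (fun q => a q.1).
Proof.
move=> ra; exists 1%N, (fun _ => a), (fun _ _ => 1); split; first by split=> //; apply: lr_cst.
by move=> q; rewrite /tensor big_ord1 mulr1.
Qed.

Lemma tens_snd (b : S -> K) p : regular_at b p.2 -> tens_at p (fun q => b q.2).
Proof.
move=> ra; exists 1%N, (fun _ _ => 1), (fun _ => b); split; first by split=> //; apply: lr_cst.
by move=> q; rewrite /tensor big_ord1 mul1r.
Qed.

Lemma tens_add p h k : tens_at p h -> tens_at p k -> tens_at p (fun q => h q + k q).
Proof.
move=> [n [a [b [rab e]]]] [m [c [d [rcd e']]]].
exists (n + m)%N, (fun i => match fintype.split i with inl j => a j | inr j => c j end),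
  (fun i => match fintype.split i with inl j => b j | inr j => d j end); split.
  by move=> i; case: (fintype.split i).
move=> q; rewrite e e' /tensor big_split_ord; congr (_ + _); apply: eq_bigr => i _.
  by rewrite (unsplitK (inl i)).
by rewrite (unsplitK (inr i)).
Qed.

Lemma tens_mul p h k : tens_at p h -> tens_at p k -> tens_at p (fun q => h q * k q).
Proof.
move=> [n [a [b [rab e]]]] [m [c [d [rcd e']]]].
pose I : finType := ('I_n * 'I_m)%type.
exists #|I|, (fun i x => a (enum_val i : I).1 x * c (enum_val i : I).2 x),
  (fun i y => b (enum_val i : I).1 y * d (enum_val i : I).2 y); split.
  move=> i; have [ra rb] := rab (enum_val i : I).1; have [rc rd] := rcd (enum_val i : I).2.
  by split; apply: lr_mul.
move=> q; rewrite e e' /tensor mulr_suml.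
under eq_bigr => i _ do rewrite mulr_sumr.
rewrite pair_bigA /= (reindex (enum_val : 'I_#|I| -> I)) /=; last exact/onW_bij/enum_val_bij.
by apply: eq_bigr => i _; case: (enum_val i) => i1 i2 /=; ring.
Qed.

Lemma near_interior (Y : fspace K) (y : Y) (P : set Y) : nbhs y P ->
  [/\ open (interior P), interior P y & forall z, interior P z -> P z].
Proof.
move=> nP; split; [exact: open_interior|exact: nP|].
by move=> z; apply: interior_subset.
Qed.

Lemma near_regular (Y : fspace K) (lrY : locally_ringed Y) n (a : 'I_n -> Y -> K) (y : Y) :
  (forall i, regular_at (a i) y) ->
  exists2 U : set Y, open U /\ U y & forall i, regular_on U (a i).
Proof.
move=> ra; have [|oU Uy UP] := @near_interior Y y [set z | forall i, regular_at (a i) z].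
  by apply: filter_forall => i; apply: lr_near.
by exists (interior [set z | forall i, regular_at (a i) z]) => // i z /UP.
Qed.

Lemma tens_neq0 p h : tens_at p h -> h p != 0 -> \forall q \near p, h q != 0.
Proof.
move=> [n [a [b [rab e]]]] hp.
have [U [oU Up] Ua] := near_regular lrT (fun i => (rab i).1).
have [V [oV Vp] Vb] := near_regular lrS (fun i => (rab i).2).
apply: near_imp (@zprod_near_subbase p U V n a b oU oV Ua Vb Up Vp _).
  by move=> q []; rewrite e.
by rewrite -e.
Qed.

Lemma zprod_near p (U : set T) (V : set S) : nbhs p.1 U -> nbhs p.2 V ->
  \forall q \near p, U q.1 /\ V q.2.
Proof.
move=> /near_interior[oU Up UU] /near_interior[oV Vp VV].
have := @zprod_near_subbase p _ _ 1%N (fun _ _ => 1) (fun _ _ => 1) oU oV.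
rewrite /tensor big_ord1 mulr1 oner_neq0 => /(_ _ _ Up Vp isT) H.
by apply: near_imp (H _ _) => [q [/UU ? /VV ? _]|i x _|i x _] //; apply: lr_cst.
Qed.

Lemma tens_near p h : tens_at p h -> \forall q \near p, tens_at q h.
Proof.
move=> [n [a [b [rab e]]]].
have [U [oU Up] Ua] := near_regular lrT (fun i => (rab i).1).
have [V [oV Vp] Vb] := near_regular lrS (fun i => (rab i).2).
have nU : nbhs p.1 U by apply: open_nbhs_nbhs.
have nV : nbhs p.2 V by apply: open_nbhs_nbhs.
apply: near_imp (zprod_near nU nV) => q [Uq Vq].
by exists n, a, b; split=> // i; split; [apply: Ua|apply: Vb].
Qed.

Lemma vprod_regularP h p : regular_at h p <-> exists u v,
  [/\ tens_at p u, tens_at p v, v p != 0 & \forall q \near p, h q = u q / v q].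
Proof.
split=> [[n [a [b [m [c [d [rab rcd nz e]]]]]]]|].
  by exists (tensor a b), (tensor c d); split=> //; [exists n, a, b|exists m, c, d].
move=> [u [v [[n [a [b [rab eu]]]] [m [c [d [rcd ev]]]] nz e]]].
exists n, a, b, m, c, d; split=> //; first by rewrite -ev.
by apply: near_imp e => q ->; rewrite -eu -ev.
Qed.

Lemma lr_vprod : locally_ringed (vprod T S).
Proof.
split.
- move=> c t; apply/vprod_regularP; exists (fun=> c), (fun=> 1).
  split; [exact: tens_cst|exact: tens_cst|exact: oner_neq0|].
  by apply: near_all => q; rewrite divr1.
- move=> h k t /vprod_regularP[u [v [tu tv v0 e]]] /vprod_regularP[u' [v' [tu' tv' v0' e']]].
  apply/vprod_regularP; exists (fun q => u q * v' q + u' q * v q), (fun q => v q * v' q); split.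
  + by apply: tens_add; apply: tens_mul.
  + exact: tens_mul.
  + exact: mulf_neq0.
  + apply: near_imp4 e e' (tens_neq0 tv v0) (tens_neq0 tv' v0') => q -> -> ? ?.
    by rewrite addf_div.
- move=> h k t /vprod_regularP[u [v [tu tv v0 e]]] /vprod_regularP[u' [v' [tu' tv' v0' e']]].
  apply/vprod_regularP; exists (fun q => u q * u' q), (fun q => v q * v' q); split.
  + exact: tens_mul.
  + exact: tens_mul.
  + exact: mulf_neq0.
  + by apply: near_imp2 e e' => q -> ->; rewrite mulf_div.
- move=> h t /vprod_regularP[u [v [tu tv v0 e]]] h0.
  apply/vprod_regularP; exists v, u; split=> //.
    by apply: contra_neq h0 => u0; rewrite (nbhs_singleton e) u0 mul0r.
  by apply: near_imp e => q ->; rewrite invf_div.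
- move=> h t /vprod_regularP[u [v [tu tv v0 e]]] h0.
  have u0 : u t != 0 by apply: contra_neq h0 => u0; rewrite (nbhs_singleton e) u0 mul0r.
  apply: near_imp3 e (tens_neq0 tv v0) (tens_neq0 tu u0) => q -> ? ?.
  by rewrite mulf_neq0 ?invr_neq0.
- move=> h t /vprod_regularP[u [v [tu tv v0 e]]].
  apply: near_imp4 (near_near e) (tens_near tu) (tens_near tv) (tens_neq0 tv v0) => q eq tu' tv' v0'.
  by apply/vprod_regularP; exists u, v.
Qed.

Lemma morph_fst p : morph_at (fun q : vprod T S => q.1) p.
Proof.
split=> [P nP|h rh].
  by apply: near_imp (@zprod_near p P setT nP filterT) => q [].
apply/vprod_regularP; exists (fun q => h q.1), (fun=> 1).
split; [exact: tens_fst|exact: tens_cst|exact: oner_neq0|].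
by apply: near_all => q; rewrite divr1.
Qed.

Lemma morph_snd p : morph_at (fun q : vprod T S => q.2) p.
Proof.
split=> [P nP|h rh].
  by apply: near_imp (@zprod_near p setT P filterT nP) => q [].
apply/vprod_regularP; exists (fun q => h q.2), (fun=> 1).
split; [exact: tens_snd|exact: tens_cst|exact: oner_neq0|].
by apply: near_all => q; rewrite divr1.
Qed.

End VProd.

Lemma morph_pair X T S (g : X -> T) (k : X -> S) (x : X) : locally_ringed X ->
  morph_at g x -> morph_at k x -> morph_at (fun z => (g z, k z) : vprod T S) x.
Proof.
move=> lrX [cg rg] [ck rk].
have tens n (a : 'I_n -> T -> K) (b : 'I_n -> S -> K) :
    (forall i, regular_at (a i) (g x) /\ regular_at (b i) (k x)) ->
    regular_at (fun z => tensor a b (g z, k z)) x.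
  move=> rab; apply: lr_sum => // i _; have [ra rb] := rab i.
  by apply: lr_mul => //; [apply: rg ra|apply: rk rb].
have cgk P : nbhs ((g x, k x) : vprod T S) P -> nbhs x ((fun z => (g z, k z) : vprod T S) @^-1` P).
  move: P; apply: (@subbase_cont (zprod T S) _ (@zprod_openE T S)).
  move=> _ [U [V [n [a [b [oU oV ra rb ->]]]]]] /= [Ux Vx ab].
  have nU : nbhs (g x) U by apply: open_nbhs_nbhs.
  have nV : nbhs (k x) V by apply: open_nbhs_nbhs.
  have nab := lr_neq0 lrX (tens n a b (fun i => conj (ra i _ Ux) (rb i _ Vx))) ab.
  by apply: near_imp3 (cg _ nU) (ck _ nV) nab => z.
split=> // h [n [a [b [m [c [d [rab rcd nz /cgk e]]]]]]].
apply: (regular_eq (h := fun z => tensor a b (g z, k z) / tensor c d (g z, k z))).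
  by apply: near_imp e => z /= ->.
by apply: lr_div => //; apply: tens.
Qed.

Lemma fsub_inj T (A : set T) : injective (set_val : fsub A -> T).
Proof. by move=> x y e; apply: val_inj; move: e; rewrite set_valE. Qed.


(** If the values at t differed, the pair would lie in the open complement of the diagonal, and so
    would the pairs at all nearby points. *)
Lemma separated_agree T Y (g k : T -> Y) (t : T) : locally_ringed T -> separated Y ->
  morph_at g t -> morph_at k t ->
  (forall P, nbhs t P -> exists2 s, P s & g s = k s) -> g t = k t.
Proof.
move=> lrT sY mg mk agree; apply: contrapT => ne.
have [c _] := morph_pair lrT mg mk.
have n : nbhs ((g t, k t) : vprod Y Y) (~` [set p | p.1 = p.2]).
  by apply: open_nbhs_nbhs; split=> //; rewrite openC.
by have [s] := agree _ (c _ n).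
Qed.

Lemma closedP T (C : set T) : locally_ringed T ->
  (forall t, ~ C t -> exists h : T -> K, [/\ regular_at h t, h t != 0 &
     \forall s \near t, C s -> h s = 0]) -> closed C.
Proof.
move=> lrT H; rewrite -openC openE => t /= nC.
have [h [rh h0 e]] := H t nC.
by apply: near_imp2 e (lr_neq0 lrT rh h0) => s hs h0s /hs /eqP; apply/negP.
Qed.

Lemma closed_preimage T S (g : T -> S) (C : set S) :
  (forall t, morph_at g t) -> closed C -> closed (g @^-1` C).
Proof.
move=> mg cC; rewrite -openC openE => t /= nC; have [c _] := mg t.
apply: (c (~` C)); apply: open_nbhs_nbhs; split=> //; exact: closed_openC.
Qed.

Lemma separated_inj T S (g : T -> S) : locally_ringed T -> separated S ->
  (forall t, morph_at g t) -> injective g -> separated T.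
Proof.
move=> lrT sS mg ig.
have lrTT := lr_vprod lrT lrT.
have m p : morph_at (fun q : vprod T T => (g q.1, g q.2) : vprod S S) p.
  apply: morph_pair => //.
    by apply: (morph_at_comp (morph_fst lrT lrT p)).
  by apply: (morph_at_comp (morph_snd lrT lrT p)).
have := closed_preimage m sS; rewrite /separated.
set A := (X in closed X -> _); set B := (X in _ -> closed X).
suff -> : A = B by [].
by apply/seteqP; split=> -[x y] /= e; [exact: ig|have {e}-> : x = y := e].
Qed.

Lemma separated_fsub T (A : set T) : locally_ringed T -> separated T -> separated (fsub A).
Proof.
move=> lrT sT; apply: separated_inj sT (@morph_val _ _ _) _.
  exact: lr_fsub.
exact: fsub_inj.
Qed.

Lemma separated_vprod T S : locally_ringed T -> locally_ringed S ->
  separated T -> separated S -> separated (vprod T S).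
Proof.
move=> lrT lrS sT sS.
have lr1 := lr_vprod lrT lrS; have lr2 := lr_vprod lr1 lr1.
have m1 p : morph_at (fun q : vprod (vprod T S) (vprod T S) => (q.1.1, q.2.1) : vprod T T) p.
  apply: morph_pair => //.
    exact: (morph_at_comp (morph_fst lr1 lr1 p) (morph_fst lrT lrS _)).
  exact: (morph_at_comp (morph_snd lr1 lr1 p) (morph_fst lrT lrS _)).
have m2 p : morph_at (fun q : vprod (vprod T S) (vprod T S) => (q.1.2, q.2.2) : vprod S S) p.
  apply: morph_pair => //.
    exact: (morph_at_comp (morph_fst lr1 lr1 p) (morph_snd lrT lrS _)).
  exact: (morph_at_comp (morph_snd lr1 lr1 p) (morph_snd lrT lrS _)).
have := closedI (closed_preimage m1 sT) (closed_preimage m2 sS); rewrite /separated.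
set A := (X in closed X -> _); set B := (X in _ -> closed X).
suff -> : A = B by [].
apply/seteqP; split=> -[[x y] [x' y']]; first by move=> [/= ex ey]; rewrite ex ey.
by move=> e; have [{e}-> ->] : (x, y) = (x', y') := e.
Qed.

End Products.

(** * Varieties through affine charts: closed subvarieties and products *)

Section Varieties.
Variable K : fieldType.
Implicit Types T S X Y : fspace K.

Lemma fsub_mkK T (A : set T) x (Ax : A x) : set_val (fsub_mk Ax) = x.
Proof. by rewrite set_valE. Qed.

Lemma fsub_valP T (A : set T) (x : fsub A) : A (set_val x).
Proof. exact: set_valP. Qed.

Lemma fsub_mk_val T (A : set T) (x : fsub A) (Ax : A (set_val x)) : fsub_mk Ax = x.
Proof. by apply: fsub_inj; rewrite fsub_mkK. Qed.

Section Open.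
Variables (T : fspace K) (U : set T) (oU : open U).

Lemma near_open (t : fsub U) (P : set T) :
  (\forall s \near t, P (set_val s)) -> \forall s \near set_val t, P s.
Proof.
move=> /fsub_nearE[Q nQ QP].
have nU : nbhs (set_val t) U by apply: open_nbhs_nbhs; split=> //; apply: fsub_valP.
by apply: near_imp2 nQ nU => s Qs Us; rewrite -(fsub_mkK Us); apply: QP; rewrite fsub_mkK.
Qed.

Lemma regular_open (t : fsub U) (h : T -> K) :
  regular_at (h \o set_val : fsub U -> K) t <-> regular_at h (set_val t).
Proof.
split=> [[g [rg e]]|]; last by case: (morph_val t) => _; apply.
apply: regular_germ rg; exact: near_open e.
Qed.

Lemma morph_open S (g : T -> S) (t : fsub U) :
  morph_at (g \o set_val : fsub U -> S) t -> morph_at g (set_val t).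
Proof.
move=> [cg rg]; split=> [P nP|h rh]; first exact: near_open (cg _ nP).
by apply/regular_open; apply: (rg h rh).
Qed.

End Open.

Lemma lr_iso X Y (g : X -> Y) : isomorphism g -> locally_ringed Y -> locally_ringed X.
Proof.
move=> [/morphismP mg [g' [/morphismP mg' gK g'K]]] lrY.
have to h x : regular_at h x -> regular_at (h \o g') (g x).
  by move=> rh; case: (mg' (g x)) => _; apply; rewrite gK.
have of_ k h x : regular_at k (g x) -> (forall z, h z = k (g z)) -> regular_at h x.
  move=> rk e; case: (mg x) => _ /(_ k rk); apply: regular_germ.
  by apply: near_all => z; rewrite e.
split.
- by move=> c x; apply: (of_ (fun=> c)) => //; apply: lr_cst.
- move=> h k x /to rh /to rk; apply: of_ (lr_add lrY rh rk) _ => z /=; by rewrite gK.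
- move=> h k x /to rh /to rk; apply: of_ (lr_mul lrY rh rk) _ => z /=; by rewrite gK.
- move=> h x /to rh h0; apply: of_ (lr_inv lrY rh _) _ => [|z] /=; by rewrite gK.
- move=> h x /to rh h0; have [cg _] := mg x.
  have h0' : (h \o g') (g x) != 0 by rewrite /= gK.
  by apply: near_imp (cg _ (lr_neq0 lrY rh h0')) => z /=; rewrite gK.
- move=> h x /to rh; have [cg _] := mg x.
  apply: near_imp (cg _ (lr_near lrY rh)) => z /= rz.
  by apply: of_ rz _ => w /=; rewrite gK.
Qed.

Lemma lr_local T :
  (forall t : T, exists U : set T, [/\ open U, U t & locally_ringed (fsub U)]) ->
  locally_ringed T.
Proof.
move=> H.
have loc t (Q : T -> Prop) : (forall (U : set T) (x : fsub U), open U ->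
    locally_ringed (fsub U) -> Q (set_val x)) -> Q t.
  by move=> HQ; have [U [oU Ut lrU]] := H t; rewrite -(fsub_mkK Ut); apply: HQ.
split.
- move=> c t; apply: (loc t (regular_at (fun=> c))) => U x oU lrU.
  by apply/(regular_open oU); apply: (lr_cst lrU c x).
- move=> h k t; apply: (loc t (fun t => regular_at h t -> regular_at k t -> regular_at (fun s => h s + k
    s) t)) => U x oU lrU rh rk.
  apply/(regular_open oU); exact: (lr_add lrU ((regular_open oU _ _).2 rh) ((regular_open oU _ _).2 rk)).
- move=> h k t; apply: (loc t (fun t => regular_at h t -> regular_at k t -> regular_at (fun s => h s * k
    s) t)) => U x oU lrU rh rk.
  apply/(regular_open oU); exact: (lr_mul lrU ((regular_open oU _ _).2 rh) ((regular_open oU _ _).2 rk)).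
- move=> h t; apply: (loc t (fun t => regular_at h t -> h t != 0 -> regular_at (fun s => (h s)^-1) t))
    => U x oU lrU rh h0.
  apply/(regular_open oU); exact: (lr_inv lrU ((regular_open oU _ _).2 rh)).
- move=> h t; apply: (loc t (fun t => regular_at h t -> h t != 0 -> \forall s \near t, h s != 0)) => U x
    oU lrU rh h0.
  apply: (near_open oU); exact: (lr_neq0 lrU ((regular_open oU _ _).2 rh)).
- move=> h t; apply: (loc t (fun t => regular_at h t -> \forall s \near t, regular_at h s)) => U x oU lrU rh.
  apply: (near_open oU); apply: near_imp (lr_near lrU ((regular_open oU _ _).2 rh)) => z.
  by move/(regular_open oU).
Qed.

Lemma lr_variety T : variety T -> locally_ringed T.
Proof.
move=> [_ [n [U [HU cov]]]]; apply: lr_local => t.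
have [i _ Ut] : (\bigcup_i U i) t by rewrite cov.
have [oU [m [A [g [_ ig]]]]] := HU i; exists (U i); split=> //.
by apply: lr_iso ig _; apply: lr_fsub; apply: lr_aff.
Qed.

(* The coordinate map [c] is extended arbitrarily outside [U]. *)
Definition chart T (U : set T) : Prop :=
  exists n (A : set (aff K n)) (c : T -> aff K n) (d : fsub A -> T),
    [/\ closed A, forall t, U t -> morph_at c t /\ A (c t),
        forall a, morph_at d a /\ U (d a), forall a, c (d a) = set_val a &
        forall t (At : A (c t)), U t -> d (fsub_mk At) = t].

Lemma chart_affine T (U : set T) : chart U -> affine_variety (fsub U).
Proof.
move=> [n [A [c [d [cA cP dP dK cK]]]]].
pose g (y : fsub U) : fsub A := fsub_mk (cP _ (fsub_valP y)).2.
pose g' (a : fsub A) : fsub U := fsub_mk (dP a).2.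
exists n, A, g; split=> //; split; last exists g'.
  apply/morphismP => y; apply: morph_fsub.
  apply: (morph_at_eq (g := c \o set_val : fsub U -> aff K n)); first by apply: near_all => z; rewrite
      /g fsub_mkK.
  by apply: (morph_at_comp (morph_val y)); case: (cP _ (fsub_valP y)).
split.
- apply/morphismP => a; apply: morph_fsub.
  apply: (morph_at_eq (g := d : fsub A -> T)); first by apply: near_all => z; rewrite /g' fsub_mkK.
  by case: (dP a).
- move=> y; apply: fsub_inj; rewrite /g' fsub_mkK /g cK //; exact: fsub_valP.
- move=> a; apply: fsub_inj; rewrite /g fsub_mkK /g' fsub_mkK; exact: dK.
Qed.

Lemma affine_chart T (U : set T) : open U -> affine_variety (fsub U) -> chart U.
Proof.
move=> oU [n [A [g [cA [/morphismP mg [g' [/morphismP mg' gK g'K]]]]]]].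
pose c (t : T) : aff K n :=
  if pselect (U t) is left Ut then set_val (g (fsub_mk Ut)) else 0 : 'rV[K]_n.
have cE (y : fsub U) : c (set_val y) = set_val (g y).
  by rewrite /c; case: pselect => [Uy|[]]; [rewrite fsub_mk_val|exact: fsub_valP].
exists n, A, c, (fun a => set_val (g' a)); split=> //.
- move=> t Ut; rewrite -(fsub_mkK Ut); split; last by rewrite cE; apply: fsub_valP.
  apply: (morph_open oU); apply: (morph_at_eq (g := set_val \o g : fsub U -> aff K n)).
    by apply: near_all => z; rewrite /= cE.
  exact: (morph_at_comp (mg _) (morph_val _)).
- move=> a; split; last exact: fsub_valP.
  exact: (morph_at_comp (mg' _) (morph_val _)).
- by move=> a; rewrite cE g'K.
- move=> t At Ut; have -> : fsub_mk At = g (fsub_mk Ut).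
    by apply: fsub_inj; rewrite fsub_mkK -cE fsub_mkK.
  by rewrite gK fsub_mkK.
Qed.

Lemma variety_of_charts T (I : finType) (U : I -> set T) : separated T ->
  (forall i, open (U i)) -> (forall i, chart (U i)) -> (forall t, exists i, U i t) -> variety T.
Proof.
move=> sT oU cU cov; split=> //; exists #|I|, (fun i => U (enum_val i)); split.
  by move=> i; split=> //; apply: chart_affine.
apply/seteqP; split=> // t _; have [i Ut] := cov t.
by exists (enum_rank i) => //; rewrite enum_rankK.
Qed.

Lemma variety_charts T : variety T -> exists n (U : 'I_n -> set T),
  [/\ forall i, open (U i), forall i, chart (U i) & forall t, exists i, U i t].
Proof.
move=> [_ [n [U [HU cov]]]]; exists n, U; split.
- by move=> i; have [] := HU i.
- by move=> i; have [oU aU] := HU i; apply: affine_chart.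
- by move=> t; have [i _ Ut] : (\bigcup_i U i) t by [rewrite cov]; exists i.
Qed.

Lemma closed_fsub_closed T (A : set T) (B : set (fsub A)) : closed A -> closed B ->
  closed [set t | exists2 b : fsub A, B b & set_val b = t].
Proof.
move=> cA cB; have [O oO eO] := closed_openC cB.
have -> : [set t | exists2 b : fsub A, B b & set_val b = t] = A `&` ~` O.
  apply/seteqP; split=> [_ [b Bb <-]|t [At nO]].
    split; first exact: fsub_valP.
    by move=> Ob; have : (~` B) b; [rewrite -eO|apply].
  exists (fsub_mk At); last exact: fsub_mkK.
  apply: contrapT => nB; apply: nO; have : (~` B) (fsub_mk At) by [].
  by rewrite -eO /= fsub_mkK.
by apply: closedI => //; apply: open_closedC.
Qed.

Lemma variety_fsub T (C : set T) : variety T -> closed C -> variety (fsub C).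
Proof.
move=> vT cC; have lrT := lr_variety vT; have [n [U [oU cU cov]]] := variety_charts vT.
apply: (variety_of_charts (U := fun i => set_val @^-1` U i : set (fsub C))).
- by apply: separated_fsub => //; case: vT.
- by move=> i; exists (U i).
- move=> i; have [m [A [c [d [cA cP dP dK cK]]]]] := cU i.
  pose A' : set (aff K m) := [set a | exists2 b : fsub A, (d @^-1` C) b & set_val b = a].
  have A'A a : A' a -> A a by move=> [b _ <-]; apply: fsub_valP.
  pose e (a : fsub A') : fsub A := fsub_mk (A'A _ (fsub_valP a)).
  have Ce a : C (d (e a)).
    by have [b Cb eb] := fsub_valP a; have -> : e a = b by apply: fsub_inj; rewrite fsub_mkK.
  have me a : morph_at e a.
    apply: morph_fsub; apply: morph_at_eq (morph_val a); apply: near_all => z.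
    by rewrite fsub_mkK.
  exists m, A', (c \o set_val), (fun a => fsub_mk (Ce a)); split.
  + apply: closed_fsub_closed => //; apply: closed_preimage => // a; by case: (dP a).
  + move=> t Ut; have [mc Ac] := cP _ Ut; split; first exact: (morph_at_comp (morph_val t)).
    exists (fsub_mk Ac); last exact: fsub_mkK.
    by rewrite /= cK //; apply: fsub_valP.
  + move=> a; split; last by rewrite /= fsub_mkK; case: (dP (e a)).
    apply: morph_fsub; apply: (morph_at_eq (g := d \o e : fsub A' -> T)); first by apply: near_all => z
        /=; rewrite fsub_mkK.
    by apply: (morph_at_comp (me a)); case: (dP (e a)).
  + by move=> a; rewrite /= fsub_mkK dK fsub_mkK.
  + move=> t At Ut; apply: fsub_inj; rewrite fsub_mkK.
    rewrite -[RHS](cK _ (A'A _ At) Ut); congr (d _); apply: fsub_inj; rewrite !fsub_mkK //.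
- by move=> t; have [i Ui] := cov (set_val t); exists i.
Qed.

Lemma chart_vprod T S (U : set T) (V : set S) : locally_ringed T -> locally_ringed S ->
  chart U -> chart V -> chart ([set p | U p.1 /\ V p.2] : set (vprod T S)).
Proof.
move=> lrT lrS [n [A [c [d [cA cP dP dK cK]]]]] [m [B [c' [d' [cB cP' dP' dK' cK']]]]].
pose A' : set (aff K (n + m)) := [set a | A (lsubmx (a : 'rV_(n + m))) /\ B (rsubmx (a : 'rV_(n + m)))].
have mL (a : aff K (n + m)) : morph_at (fun a : aff K (n + m) => lsubmx (a : 'rV_(n + m)) : aff K n) a.
  apply: morph_at_aff => [|i]; first exact: lr_aff.
  apply: regular_eq (aff_regular_coord (lshift m i) a); apply: near_all => z; by rewrite mxE.
have mR (a : aff K (n + m)) : morph_at (fun a : aff K (n + m) => rsubmx (a : 'rV_(n + m)) : aff K m) a.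
  apply: morph_at_aff => [|i]; first exact: lr_aff.
  apply: regular_eq (aff_regular_coord (rshift n i) a); apply: near_all => z; by rewrite mxE.
pose e (a : fsub A') : fsub A := fsub_mk (fsub_valP a).1.
pose e' (a : fsub A') : fsub B := fsub_mk (fsub_valP a).2.
have lrA' : locally_ringed (fsub A') by apply: lr_fsub; apply: lr_aff.
have me a : morph_at e a.
  apply: morph_fsub; apply: morph_at_eq (morph_at_comp (morph_val a) (mL _)).
  by apply: near_all => z; rewrite fsub_mkK.
have me' a : morph_at e' a.
  apply: morph_fsub; apply: morph_at_eq (morph_at_comp (morph_val a) (mR _)).
  by apply: near_all => z; rewrite fsub_mkK.
exists (n + m)%N, A', (fun p => row_mx (c p.1 : 'rV_n) (c' p.2 : 'rV_m) : aff K (n + m)),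
  (fun a => (d (e a), d' (e' a))); split.
- by apply: closedI; [apply: closed_preimage cA => a|apply: closed_preimage cB => a].
- move=> p [Up Vp]; have [mc Ac] := cP _ Up; have [mc' Bc'] := cP' _ Vp.
  split; last by rewrite /A' /= row_mxKl row_mxKr.
  apply: morph_at_aff => [|i]; first exact: lr_vprod.
  case: (splitP i) => j ij.
    have -> : i = lshift m j by exact: val_inj.
    apply: (regular_eq (h := fun q : vprod T S => (c q.1 : 'rV_n) ord0 j)).
      by apply: near_all => q; rewrite row_mxEl.
    have [_ r] := morph_at_comp (morph_fst lrT lrS p) mc.
    exact: (r _ (aff_regular_coord j _)).
  have -> : i = rshift n j by exact: val_inj.
  apply: (regular_eq (h := fun q : vprod T S => (c' q.2 : 'rV_m) ord0 j)).
    by apply: near_all => q; rewrite row_mxEr.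
  have [_ r] := morph_at_comp (morph_snd lrT lrS p) mc'.
  exact: (r _ (aff_regular_coord j _)).
- move=> a; split; last by split; [case: (dP (e a))|case: (dP' (e' a))].
  apply: morph_pair => //.
    by apply: (morph_at_comp (me a)); case: (dP (e a)).
  by apply: (morph_at_comp (me' a)); case: (dP' (e' a)).
- by move=> a /=; rewrite dK dK' !fsub_mkK hsubmxK.
- move=> [t s] At [/= Ut Vs]; congr (_, _).
    rewrite -[RHS](cK _ (cP _ Ut).2 Ut); congr (d _); apply: fsub_inj.
    by rewrite !fsub_mkK row_mxKl.
  rewrite -[RHS](cK' _ (cP' _ Vs).2 Vs); congr (d' _); apply: fsub_inj.
  by rewrite !fsub_mkK row_mxKr.
Qed.

Lemma variety_vprod T S : variety T -> variety S -> variety (vprod T S).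
Proof.
move=> vT vS; have lrT := lr_variety vT; have lrS := lr_variety vS.
have [n [U [oU cU cov]]] := variety_charts vT; have [m [V [oV cV cov']]] := variety_charts vS.
apply: (variety_of_charts (U := fun ij : ('I_n * 'I_m)%type =>
  [set p | U ij.1 p.1 /\ V ij.2 p.2] : set (vprod T S))).
- by apply: separated_vprod => //; [case: vT|case: vS].
- move=> [i j]; rewrite openE => p [/= Up Vp].
  by apply: zprod_near => //; apply: open_nbhs_nbhs.
- by move=> [i j]; apply: chart_vprod.
- by move=> [t s]; have [i ?] := cov t; have [j ?] := cov' s; exists (i, j).
Qed.

End Varieties.

(** * Grassmannians *)

Lemma dhomog_meval (K : fieldType) n d (Q : {mpoly K[n]}) (c : K) (v : 'I_n -> K) :
  Q \is d.-homog -> Q.@[fun i => c * v i] = c ^+ d * Q.@[v].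
Proof.
move=> /dhomogP hQ; rewrite !mevalE mulr_sumr; apply: eq_big_seq => m /hQ /= md.
rewrite mulrCA; congr (_ * _); rewrite -md mdegE -prodrXr -big_split /=.
by apply: eq_bigr => i _; rewrite exprMn.
Qed.

(** * Regular families of vectors *)

Section VRegular.
Variables (K : fieldType) (V : vectType K) (T : fspace K) (lrT : locally_ringed T).
Implicit Types (v w : T -> V) (t : T).

Definition vreg_at v t : Prop :=
  forall j, regular_at (fun s => coord (vbasis {:V}) j (v s)) t.

Lemma vreg_eq v w t : (\forall s \near t, v s = w s) -> vreg_at v t -> vreg_at w t.
Proof. by move=> e rv j; apply: regular_eq (rv j); apply: near_imp e => s ->. Qed.

Lemma vreg_linear v t (phi : {linear V -> K^o}) : vreg_at v t -> regular_at (fun s => phi (v s)) t.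
Proof.
move=> rv; apply: (regular_eq (h := fun s => \sum_j coord (vbasis {:V}) j (v s) * phi (vbasis {:V})`_j)).
  apply: near_all => s; rewrite {2}(coord_vbasis (memvf (v s))) linear_sum.
  by apply: eq_bigr => j _; rewrite linearZ.
by apply: lr_sum => // j _; apply: lr_mul => //; apply: lr_cst.
Qed.

Lemma vreg_cst u t : vreg_at (fun=> u) t.
Proof. by move=> j; apply: lr_cst. Qed.

Lemma vreg_add v w t : vreg_at v t -> vreg_at w t -> vreg_at (fun s => v s + w s) t.
Proof.
move=> rv rw j; apply: regular_eq (lr_add lrT (rv j) (rw j)).
by apply: near_all => s; rewrite linearD.
Qed.

Lemma vreg_scale (a : T -> K) v t : regular_at a t -> vreg_at v t -> vreg_at (fun s => a s *: v s) t.
Proof.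
move=> ra rv j; apply: regular_eq (lr_mul lrT ra (rv j)).
by apply: near_all => s; rewrite linearZ.
Qed.

Lemma vreg_sum (I : Type) (r : seq I) (P : pred I) (F : I -> T -> V) t :
  (forall i, P i -> vreg_at (F i) t) -> vreg_at (fun s => \sum_(i <- r | P i) F i s) t.
Proof.
move=> rF j; apply: (regular_eq (h := fun s => \sum_(i <- r | P i) coord (vbasis {:V}) j (F i s))).
  by apply: near_all => s; rewrite linear_sum.
by apply: lr_sum => // i Pi; apply: rF.
Qed.

Lemma vreg_near v t : vreg_at v t -> \forall s \near t, vreg_at v s.
Proof. by move=> rv; apply: filter_forall => j; apply: lr_near. Qed.

End VRegular.

Lemma vreg_comp (K : fieldType) (V : vectType K) (T S : fspace K) (g : T -> S) (v : S -> V) t :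
  morph_at g t -> vreg_at v (g t) -> vreg_at (v \o g) t.
Proof. by move=> [_ rg] rv j; apply: (rg _ (rv j)). Qed.

(** * Regular functions and maps on Grassmannians *)

Section Grass.
Variables (K : fieldType) (V : vectType K) (k : nat).
Local Notation n := (\dim {:V}).
Local Notation e := (vbasis {:V}).
Local Notation G := (Gr V k).
Local Notation I := (plucker_index V k).
Implicit Types (v : 'I_k -> V) (W : G) (s : 'I_#|I|).

Definition vspan v : {vspace V} := <<[tuple v i | i < k]>>%VS.

Lemma memv_vspan v u : u \in vspan v <-> exists c : 'I_k -> K, u = \sum_i c i *: v i.
Proof.
split=> [/coord_span->|[c ->]].
  exists (fun i => coord [tuple v i | i < k] i u); apply: eq_bigr => i _.
  by rewrite -tnth_nth tnth_mktuple.
apply: memv_suml => i _; apply: memvZ; apply: memv_span.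
by apply/tnthP; exists i; rewrite tnth_mktuple.
Qed.

Lemma vspan_sub v (U : {vspace V}) : (forall i, v i \in U) -> (vspan v <= U)%VS.
Proof.
by move=> vU; apply/span_subvP => u /tnthP[i ->]; rewrite tnth_mktuple.
Qed.

Lemma vspan_dim v : \dim (vspan v) = k <->
  forall c : 'I_k -> K, \sum_i c i *: v i = 0 -> forall i, c i = 0.
Proof.
have -> : \dim (vspan v) = k <-> free [tuple v i | i < k].
  by rewrite /free size_tuple; split=> [->|/eqP].
split=> [/freeP f c e0|H]; first by apply: f; rewrite -[RHS]e0; apply: eq_bigr => i _;
  rewrite -tnth_nth tnth_mktuple.
apply/freeP => c e0; apply: H; rewrite -[RHS]e0; apply: eq_bigr => i _.
by rewrite -tnth_nth tnth_mktuple.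
Qed.

Lemma dim_vsp W : \dim (vsp W) = k.
Proof. by apply/eqP; case: W. Qed.

Lemma vspan_eq W v : (forall i, v i \in vsp W) -> \dim (vspan v) = k -> vsp W = vspan v.
Proof.
move=> vW dv; apply/esym/eqP; rewrite eqEdim vspan_sub //=.
by rewrite dv dim_vsp.
Qed.

Definition rowmx_of v : 'M[K]_(k, n) := \matrix_(i, j) coord e j (v i).
Definition minor s (M : 'M[K]_(k, n)) : K :=
  \det (\matrix_(i, j) M i ((enum_val s : I) j)).

Lemma plucker_span W v : vsp W = vspan v ->
  exists2 c, c != 0 & forall s, plucker W s = c * minor s (rowmx_of v).
Proof.
move=> eW; pose b i := (vbasis (vsp W))`_(i : 'I_(\dim (vsp W))).
pose b' (i : 'I_k) : V := (vbasis (vsp W))`_i.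
have dW := dim_vsp W.
have b'W : forall u, u \in vsp W -> exists c : 'I_k -> K, u = \sum_i c i *: b' i.
  move=> u /coord_vbasis->; exists (fun i => coord (vbasis (vsp W)) (cast_ord (esym dW) i) u).
  rewrite (reindex (cast_ord (esym dW))) //=.
  by exists (cast_ord dW) => i _; rewrite ?cast_ordK ?cast_ordKV.
have /choice[P vP] : forall i, exists c : 'I_k -> K, v i = \sum_l c l *: b' l.
  move=> i; apply: b'W; rewrite eW; apply: memv_span.
  by apply/tnthP; exists i; rewrite tnth_mktuple.
pose M : 'M[K]_k := \matrix_(i, l) P i l.
have fv : forall c : 'I_k -> K, \sum_i c i *: v i = 0 -> forall i, c i = 0.
  by apply/vspan_dim; rewrite -eW.
have M0 : \det M != 0.
  apply/det0P => -[r r0 rM]; case/eqP: r0; apply/rowP => i; rewrite mxE.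
  apply: (fv (r ord0)); under eq_bigr => i' _ do rewrite vP scaler_sumr.
  rewrite exchange_big big1 // => l _.
  under eq_bigr => i' _ do rewrite scalerA; rewrite -scaler_suml.
  have /rowP/(_ l) := rM; rewrite !mxE => E.
  rewrite (_ : \sum_(i' < k) _ = 0) ?scale0r // -[RHS]E.
  by apply: eq_bigr => i' _; rewrite mxE.
exists (\det M)^-1; first by rewrite invr_neq0.
move=> s; apply: (mulfI M0); rewrite mulrA mulfV // mul1r /minor /plucker -det_mulmx.
congr (\det _); apply/matrixP => i j; rewrite !mxE vP linear_sum.
by apply: eq_bigr => l _; rewrite !mxE linearZ.
Qed.

Lemma meval_plucker W v d (Q : {mpoly K[#|I|]}) : vsp W = vspan v -> Q \is d.-homog ->
  exists2 c, c != 0 & Q.@[plucker W] = c ^+ d * Q.@[fun s => minor s (rowmx_of v)].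
Proof.
move=> /plucker_span[c c0 cP] hQ; exists c => //.
by rewrite -(dhomog_meval _ _ hQ); apply: meval_eq.
Qed.

Lemma gr_openE : @open (grass V k) =
  [set \bigcup_(i in D') i | D' in subset^~ (finI_from (@grass_subbase K V k) id)].
Proof. by []. Qed.

Lemma gr_near_neq0 d (Q : {mpoly K[#|I|]}) W : Q \is d.-homog -> Q.@[plucker W] != 0 ->
  \forall W' \near W, Q.@[plucker W'] != 0.
Proof.
move=> hQ QW; have oW : @open (grass V k) [set W : grass V k | Q.@[plucker W] != 0].
  by apply: (@subbase_open (grass V k) _ gr_openE); exists d, Q.
exact: (@open_nbhs_nbhs (grass V k) W _ (conj oW QW)).
Qed.

Lemma lr_gr : locally_ringed G.
Proof.
split.
- move=> c t; exists 0%N, c%:MP, 1; rewrite meval1 oner_neq0; split=> //.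
  + by rewrite -[c%:MP]mulr1 mul_mpolyC; apply: dhomogZ; apply: dhomog1.
  + exact: dhomog1.
  + by apply: near_all => y; rewrite mevalC meval1 divr1.
- move=> h l t [d [P [Q [hP hQ Q0 E]]]] [d' [P' [Q' [hP' hQ' Q0' E']]]].
  exists (d + d')%N, (P * Q' + P' * Q), (Q * Q'); split.
  + by apply: dhomogD; [apply: dhomogM|rewrite addnC; apply: dhomogM].
  + exact: dhomogM.
  + by rewrite mevalM mulf_neq0.
  + apply: near_imp4 E E' (gr_near_neq0 hQ Q0) (gr_near_neq0 hQ' Q0') => y -> -> ? ?.
    by rewrite mevalD !mevalM addf_div.
- move=> h l t [d [P [Q [hP hQ Q0 E]]]] [d' [P' [Q' [hP' hQ' Q0' E']]]].
  exists (d + d')%N, (P * P'), (Q * Q'); split.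
  + exact: dhomogM.
  + exact: dhomogM.
  + by rewrite mevalM mulf_neq0.
  + by apply: near_imp2 E E' => y -> ->; rewrite !mevalM mulf_div.
- move=> h t [d [P [Q [hP hQ Q0 E]]]] h0; exists d, Q, P; split=> //.
    by apply: contra_neq h0 => P0; rewrite (nbhs_singleton E) P0 mul0r.
  by apply: near_imp E => y ->; rewrite invf_div.
- move=> h t [d [P [Q [hP hQ Q0 E]]]] h0.
  have P0 : P.@[plucker t] != 0.
    by apply: contra_neq h0 => P0; rewrite (nbhs_singleton E) P0 mul0r.
  apply: near_imp3 E (gr_near_neq0 hQ Q0) (gr_near_neq0 hP P0) => y -> ? ?.
  by rewrite mulf_neq0 ?invr_neq0.
- move=> h t [d [P [Q [hP hQ Q0 E]]]].
  apply: near_imp2 (near_near E) (gr_near_neq0 hQ Q0) => y Ey Q0y.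
  by exists d, P, Q.
Qed.

Lemma regular_minor (T : fspace K) (v : T -> 'I_k -> V) t s : locally_ringed T ->
  (forall i, vreg_at (fun z => v z i) t) -> regular_at (fun z => minor s (rowmx_of (v z))) t.
Proof.
move=> lrT rv; apply: lr_det => // i j.
apply: regular_eq (rv i ((enum_val s : I) j)); apply: near_all => z.
by rewrite !mxE.
Qed.

(** Pluecker coordinates of [g z] are the minors of [v z] up to a factor that depends on z in no
    controlled way; it cancels in fractions of homogeneous polynomials of equal degree. *)
Lemma morph_at_gr (T : fspace K) (g : T -> G) (v : T -> 'I_k -> V) t : locally_ringed T ->
  (forall i, vreg_at (fun z => v z i) t) -> (\forall z \near t, vsp (g z) = vspan (v z)) ->
  morph_at g t.
Proof.
move=> lrT rv E; have rm s := regular_minor s lrT rv.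
have cg P : nbhs (g t) P -> nbhs t (g @^-1` P).
  move: P; apply: (@subbase_cont (grass V k) _ gr_openE).
  move=> _ [d [Q [hQ ->]]] /= Qg.
  have [c c0 ec] := meval_plucker (nbhs_singleton E) hQ.
  have rQ := lr_meval lrT Q rm.
  have Q0 : Q.@[fun s => minor s (rowmx_of (v t))] != 0.
    by apply: contra_neq Qg => Q0; rewrite ec Q0 mulr0.
  apply: near_imp2 E (lr_neq0 lrT rQ Q0) => z Ez Qz.
  have [c' c0' ec'] := meval_plucker Ez hQ.
  by rewrite /= ec' mulf_neq0 // expf_neq0.
split=> // h [d [P [Q [hP hQ Q0 Eh]]]].
apply: (regular_eq (h := fun z => P.@[fun s => minor s (rowmx_of (v z))] / Q.@[fun s => minor s
    (rowmx_of (v z))])).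
  apply: near_imp2 E (cg _ Eh) => z Ez /= ->.
  have [c c0 cP] := plucker_span Ez.
  rewrite -[P.@[plucker _]](@meval_eq _ _ (fun s => c * minor s (rowmx_of (v z)))) //.
  rewrite -[Q.@[plucker _]](@meval_eq _ _ (fun s => c * minor s (rowmx_of (v z)))) //.
  rewrite (dhomog_meval _ _ hP) (dhomog_meval _ _ hQ).
  by rewrite -mulf_div divff ?mul1r // expf_neq0.
apply: lr_div => //; try exact: lr_meval.
have [c c0 ec] := meval_plucker (nbhs_singleton E) hQ.
by apply: contra_neq Q0 => Q0; rewrite ec Q0 mulr0.
Qed.

Lemma homogX s : ('X_s : {mpoly K[#|I|]}) \is 1.-homog.
Proof. by rewrite dhomogX; apply/eqP/mdeg1. Qed.

Lemma regular_plucker_ratio W s s' : plucker W s != 0 ->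
  regular_at (fun W' : G => plucker W' s' / plucker W' s) W.
Proof.
move=> Ws; exists 1%N, 'X_s', 'X_s; rewrite !homogX mevalXU; split=> //.
by apply: near_all => W'; rewrite !mevalXU.
Qed.

Lemma near_plucker W s : plucker W s != 0 -> \forall W' \near W, plucker W' s != 0.
Proof.
move=> Ws; have := @gr_near_neq0 _ _ W (homogX s); rewrite mevalXU => /(_ Ws).
by apply: near_imp => W'; rewrite mevalXU.
Qed.

Definition subst_index s (i : 'I_k) (j : 'I_n) : 'I_#|I| :=
  enum_rank ([ffun l => if l == i then j else (enum_val s : I) l] : I).

(* By Cramer's rule, the basis of [W] normalised on the columns [s]. *)
Definition frame_mx s W : 'M[K]_(k, n) :=
  \matrix_(i, j) (plucker W (subst_index s i j) / plucker W s).
Definition frame s W (i : 'I_k) : V := \sum_j frame_mx s W i j *: e`_j.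

(** Laplace expansion along the replaced column i, whose cofactors are those of the square block on
    the columns [s]. *)
Lemma minor_subst s (M : 'M[K]_(k, n)) i j :
  minor (subst_index s i j) M =
    (\adj (\matrix_(i, j) M i ((enum_val s : I) j)) *m M) i j.
Proof.
rewrite /minor (expand_det_col _ i) mxE; apply: eq_bigr => l _.
rewrite !mxE enum_rankK ffunE eqxx mulrC; congr (_ * _).
rewrite /cofactor; congr (_ * \det _); apply/matrixP => a b; rewrite !mxE.
by rewrite ffunE eq_sym (negPf (neq_lift _ _)).
Qed.

Lemma plucker_vbasis W s :
  plucker W s = minor s (\matrix_(i, j) coord e j (vbasis (vsp W))`_i).
Proof.
by rewrite /plucker /minor; congr (\det _); apply/matrixP => i j; rewrite !mxE.
Qed.

Lemma frame_mxE s W : plucker W s != 0 ->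
  let B := \matrix_(i < k, j < n) coord e j (vbasis (vsp W))`_i in
  frame_mx s W = invmx (\matrix_(i, j) B i ((enum_val s : I) j)) *m B.
Proof.
move=> Ws B; have uB : (\matrix_(i, j) B i ((enum_val s : I) j)) \in unitmx.
  by rewrite unitmxE unitfE; move: Ws; rewrite plucker_vbasis.
rewrite /invmx uB -scalemxAl; apply/matrixP => i j.
rewrite mxE plucker_vbasis minor_subst [RHS]mxE mulrC; congr (_^-1 * _).
by rewrite plucker_vbasis.
Qed.

Lemma frame_span s W : plucker W s != 0 -> vsp W = vspan (frame s W).
Proof.
move=> Ws; pose B := \matrix_(i < k, j < n) coord e j (vbasis (vsp W))`_i.
pose Bs : 'M_k := \matrix_(i, j) B i ((enum_val s : I) j).
have uB : Bs \in unitmx.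
  by rewrite unitmxE unitfE; move: Ws; rewrite plucker_vbasis.
have fE := frame_mxE Ws; rewrite -/B -/Bs /= in fE.
have fr i : frame s W i = \sum_l invmx Bs i l *: (vbasis (vsp W))`_l.
  rewrite /frame fE; under eq_bigr => j _ do rewrite mxE scaler_suml.
  rewrite exchange_big; apply: eq_bigr => l _.
  under eq_bigr => j _ do rewrite -scalerA; rewrite -scaler_sumr; congr (_ *: _).
  rewrite [RHS](coord_vbasis (memvf _)); apply: eq_bigr => j _; by rewrite mxE.
have dW := dim_vsp W.
have bW (l : 'I_k) : (vbasis (vsp W))`_l \in vsp W.
  by apply: vbasis_mem; apply: mem_nth; rewrite size_tuple dW.
apply: vspan_eq => [i|]; first by rewrite fr; apply: memv_suml => l _; apply: memvZ.
apply/vspan_dim => c.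
have -> : \sum_i c i *: frame s W i = \sum_l ((\row_i c i) *m invmx Bs) ord0 l *: (vbasis (vsp W))`_l.
  under eq_bigr => i _ do rewrite fr scaler_sumr.
  rewrite exchange_big; apply: eq_bigr => l _; rewrite mxE scaler_suml.
  by apply: eq_bigr => i _; rewrite mxE scalerA.
move=> E; have z l : ((\row_i c i) *m invmx Bs) ord0 l = 0.
  have /freeP fb := basis_free (vbasisP (vsp W)).
  have := fb (fun l => ((\row_i c i) *m invmx Bs) ord0 (cast_ord dW l)).
  rewrite (reindex (cast_ord (esym dW))) /=; last first.
    by exists (cast_ord dW) => i _; rewrite ?cast_ordK ?cast_ordKV.
  under eq_bigr => i _ do rewrite cast_ordKV.
  by move=> /(_ E (cast_ord (esym dW) l)); rewrite cast_ordKV.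
have : \row_i c i = 0.
  by rewrite -[LHS](mulmxKV uB) [X in X *m _](_ : _ = 0) ?mul0mx //; apply/rowP => l; rewrite z mxE.
by move=> /rowP + i => /(_ i); rewrite !mxE.
Qed.

Lemma coord_frame s W i j : coord e j (frame s W i) = frame_mx s W i j.
Proof. by rewrite /frame coord_sum_free //; apply: (basis_free (vbasisP _)). Qed.

Lemma vreg_frame s W i : plucker W s != 0 -> vreg_at (fun W' : G => frame s W' i) W.
Proof.
move=> Ws j; apply: regular_eq (regular_plucker_ratio (subst_index s i j) Ws).
by apply: near_all => W'; rewrite coord_frame mxE.
Qed.

Lemma plucker_neq0 W : exists s, plucker W s != 0.
Proof.
pose B := \matrix_(i < k, j < n) coord e j (vbasis (vsp W))`_i.
have dW := dim_vsp W.
have fB : row_free B.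
  apply: inj_row_free => r rB; have /freeP fb := basis_free (vbasisP (vsp W)).
  have E0 : \sum_(i < k) r ord0 i *: (vbasis (vsp W))`_i = 0.
    rewrite [LHS](coord_vbasis (memvf _)) big1 // => j _.
    have /rowP/(_ j) := rB; rewrite !mxE => E; rewrite linear_sum /= (_ : \sum_(i < k) _ = 0) ?scale0r //.
    by rewrite -[RHS]E; apply: eq_bigr => i _; rewrite linearZ mxE.
  apply/rowP => i; rewrite mxE.
  have := fb (fun l => r ord0 (cast_ord dW l)).
  rewrite (reindex (cast_ord (esym dW))) /=; last first.
    by exists (cast_ord dW) => l _; rewrite ?cast_ordK ?cast_ordKV.
  under eq_bigr => l _ do rewrite cast_ordKV.
  by move=> /(_ E0 (cast_ord (esym dW) i)); rewrite cast_ordKV.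
have fBT : row_full B^T by rewrite /row_full mxrank_tr.
have := fullrowsub_unit fBT; rewrite unitmxE unitfE => u.
exists (enum_rank ([ffun i => fullrankfun fBT i] : I)); rewrite plucker_vbasis /minor -det_tr.
apply: contra_neq u => E; rewrite -[RHS]E; congr (\det _); apply/matrixP => i j.
by rewrite !mxE enum_rankK [in RHS]ffunE.
Qed.

End Grass.

(** * Grassmannians are varieties *)

Section GrassVariety.
Variables (K : fieldType) (V : vectType K) (k : nat).
Local Notation n := (\dim {:V}).
Local Notation e := (vbasis {:V}).
Local Notation G := (Gr V k).
Local Notation I := (plucker_index V k).
Implicit Types (v : 'I_k -> V) (W : G) (s : 'I_#|I|).

Lemma gr_inj W W' : vsp W = vsp W' -> W = W'.
Proof. by move=> E; apply: val_inj. Qed.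

Lemma frame_delta s W i l : plucker W s != 0 ->
  coord e ((enum_val s : I) l) (frame s W i) = (i == l)%:R.
Proof.
move=> Ws; rewrite coord_frame frame_mxE //=.
set B := \matrix_(i < k, j < n) _; set Bs := (X in invmx X).
have uB : Bs \in unitmx.
  by rewrite unitmxE unitfE; move: Ws; rewrite plucker_vbasis.
have /matrixP/(_ i l) := mulVmx uB; rewrite [X in _ = X]mxE => <-.
by rewrite !mxE; apply: eq_bigr => a _; rewrite !mxE.
Qed.

Lemma frame_mem s W i : plucker W s != 0 -> frame s W i \in vsp W.
Proof.
move=> Ws; rewrite (frame_span Ws); apply: memv_span.
by apply/tnthP; exists i; rewrite tnth_mktuple.
Qed.

Lemma frame_proj s W u : plucker W s != 0 ->
  u \in vsp W <-> u = \sum_i coord e ((enum_val s : I) i) u *: frame s W i.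
Proof.
move=> Ws; split=> [|->]; last by apply: memv_suml => i _; apply/memvZ/frame_mem.
rewrite (frame_span Ws) => /memv_vspan[c ->]; apply: eq_bigr => i _; congr (_ *: _).
rewrite linear_sum (bigD1 i) //= linearZ /= frame_delta // eqxx mulr1 big1 ?addr0 // => j /negPf ji.
by rewrite linearZ /= frame_delta // ji mulr0.
Qed.

Lemma plucker_inj W W' : (forall a b, plucker W a * plucker W' b = plucker W b * plucker W' a) ->
  W = W'.
Proof.
move=> E; have [s Ws] := plucker_neq0 W.
have Ws' : plucker W' s != 0.
  apply/eqP => z; have [b Wb] := plucker_neq0 W'.
  by have /eqP := E s b; rewrite z mulr0 mulf_eq0 (negPf Ws) (negPf Wb).
apply: gr_inj; rewrite (frame_span Ws) (frame_span Ws'); congr vspan.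
apply/funext => i; rewrite /frame; apply: eq_bigr => j _; congr (_ *: _).
by rewrite !mxE; apply/eqP; rewrite eqr_div // E mulrC.
Qed.

(** Distinct subspaces have Pluecker vectors that are not proportional, and a nonzero 2 by 2 minor
    of the pair of vectors vanishes on the diagonal. *)
Lemma separated_gr : separated G.
Proof.
have lrG := @lr_gr K V k; have lrGG := lr_vprod lrG lrG.
apply: closedP => // -[W W'] /= ne.
have [s Ws] := plucker_neq0 W; have [s' Ws'] := plucker_neq0 W'.
have [a [b ab]] : exists a b, plucker W a * plucker W' b != plucker W b * plucker W' a.
  apply: contrapT => no; apply: ne; apply: plucker_inj => a b; apply: contrapT => ab; apply: no.
  by exists a, b; apply/eqP.
have r1 c : regular_at (fun p : vprod G G => plucker p.1 c / plucker p.1 s) (W, W').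
  by have [_ r] := morph_fst lrG lrG (W, W'); apply: (r _ (regular_plucker_ratio c Ws)).
have r2 c : regular_at (fun p : vprod G G => plucker p.2 c / plucker p.2 s') (W, W').
  by have [_ r] := morph_snd lrG lrG (W, W'); apply: (r _ (regular_plucker_ratio c Ws')).
exists (fun p => (plucker p.1 a / plucker p.1 s) * (plucker p.2 b / plucker p.2 s')
   - (plucker p.1 b / plucker p.1 s) * (plucker p.2 a / plucker p.2 s')); split.
- by apply: (lr_sub lrGG); apply: (lr_mul lrGG).
- rewrite /= !mulf_div -mulrBl mulf_neq0 ?subr_eq0 //.
  by rewrite invr_neq0 // mulf_neq0.
- by apply: near_all => -[W1 W2] E; have {E}-> : W1 = W2 := E; rewrite /=; ring.
Qed.

(** A chart consists of the matrices whose columns [s] form the identity. Keeping these columns as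
    equations lets [s] range over all sequences, including those with repetitions, whose chart is
    empty. *)
Let A s : set (aff K (k * n)) := [set a |
  forall i l, vec_mx (a : 'rV_(k * n)) i ((enum_val s : I) l) = (i == l)%:R].

Let v (a : aff K (k * n)) (i : 'I_k) : V := \sum_j vec_mx (a : 'rV_(k * n)) i j *: e`_j.

Let coord_v a i j : coord e j (v a i) = vec_mx (a : 'rV_(k * n)) i j.
Proof. by rewrite /v coord_sum_free //; apply: (basis_free (vbasisP _)). Qed.

Let v_dim s (a : aff K (k * n)) : A s a -> \dim (vspan (v a)) == k.
Proof.
move=> Aa; apply/eqP/vspan_dim => c E l.
have := congr1 (coord e ((enum_val s : I) l)) E; rewrite linear0 linear_sum /= (bigD1 l) //=.
rewrite linearZ /= coord_v Aa eqxx mulr1 big1 ?addr0 // => j /negPf jl.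
by rewrite linearZ /= coord_v Aa jl mulr0.
Qed.

Lemma chart_gr s : chart [set W : G | plucker W s != 0].
Proof.
have lrG := @lr_gr K V k; have lra := lr_aff K (k * n).
pose d (a : fsub (A s)) : G := exist (fun U : {vspace V} => \dim U == k) _ (v_dim (fsub_valP a)).
have de a : vsp (d a) = vspan (v (set_val a)) by [].
have ds a : plucker (d a) s != 0.
  have [c c0 ->] := plucker_span (de a); rewrite mulf_neq0 //.
  suff -> : minor s (rowmx_of (v (set_val a))) = 1 by apply: oner_neq0.
  rewrite -(@det1 K k) /minor; congr (\det _); apply/matrixP => i j.
  by rewrite !mxE coord_v (fsub_valP a).
exists (k * n)%N, (A s), (fun W => mxvec (frame_mx s W)), d; split.
- apply: closedP => // a /existsNP[i /existsNP[l /eqP ne]].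
  exists (fun y : aff K (k * n) => vec_mx (y : 'rV_(k * n)) i ((enum_val s : I) l) - (i == l)%:R); split.
  + apply: (lr_sub lra); last exact: lr_cst.
    apply: regular_eq (aff_regular_coord (mxvec_index i ((enum_val s : I) l)) a).
    by apply: near_all => y; rewrite mxE.
  + by rewrite subr_eq0.
  + by apply: near_all => y Ay; rewrite Ay subrr.
- move=> W Ws; split.
    apply: morph_at_aff => // i; case/mxvec_indexP: i => i j.
    apply: regular_eq (regular_plucker_ratio (subst_index s i j) Ws).
    by apply: near_all => W'; rewrite mxvecE mxE.
  move=> i l; rewrite mxvecK -coord_frame; exact: frame_delta.
- move=> a; split; last exact: ds.
  apply: (morph_at_gr (v := fun z : fsub (A s) => v (set_val z))).
  + exact: lr_fsub.
  + move=> i j; have [_ r] := morph_val a.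
    apply: regular_eq (r _ (aff_regular_coord (mxvec_index i j) _)).
    by apply: near_all => z; rewrite /= coord_v mxE.
  + exact: near_all.
- move=> a; rewrite -[RHS]vec_mxK; congr (mxvec _); apply/matrixP => i j.
  rewrite -coord_frame -coord_v; congr (coord _ _ _).
  have vd : v (set_val a) i \in vsp (d a).
    by rewrite de; apply: memv_span; apply/tnthP; exists i; rewrite tnth_mktuple.
  rewrite [RHS](proj1 (frame_proj _ (ds a)) vd) (bigD1 i) //= coord_v (fsub_valP a) eqxx scale1r.
  by rewrite big1 ?addr0 // => l /negPf li; rewrite coord_v (fsub_valP a) eq_sym li scale0r.
- move=> W AW Ws; apply: gr_inj; rewrite de fsub_mkK (frame_span Ws); congr vspan.
  by apply/funext => i; rewrite /v mxvecK.
Qed.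

Lemma variety_gr : variety G.
Proof.
apply: (variety_of_charts (U := fun s => [set W : G | plucker W s != 0])).
- exact: separated_gr.
- by move=> s; rewrite openE => W /near_plucker.
- exact: chart_gr.
- exact: plucker_neq0.
Qed.

End GrassVariety.

(** * Cubic forms *)

Section Euler.
Variables (K : fieldType) (n : nat).
Implicit Types p : {mpoly K[n]}.

Lemma dhomog_mderiv d p i : p \is d.+1.-homog -> p^`M(i) \is d.-homog.
Proof.
move=> /dhomogP hp; apply/dhomogP => m; rewrite mcoeff_msupp mcoeff_deriv => nz.
have /hp : (m + U_(i))%MM \in msupp p.
  by rewrite mcoeff_msupp; apply: contraNneq nz => ->; rewrite mul0rn.
by rewrite /= mdegD mdeg1 addn1 => -[].
Qed.

Lemma euler d p : p \is d.-homog -> \sum_i 'X_i * p^`M(i) = d%:R *: p.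
Proof.
move=> /dhomogP hp; rewrite {2}[p]mpolyE scaler_sumr.
under eq_bigr => i _ do rewrite {1}[p]mpolyE mderiv_sum mulr_sumr.
rewrite exchange_big; apply: eq_big_seq => m /hp /= md.
under eq_bigr => i _ do rewrite mderivZ mderivX.
rewrite scalerA mulrC -scalerA -md mdegE natr_sum scaler_suml scaler_sumr.
apply: eq_bigr => i _; rewrite -scalerAr -scalerAr; congr (_ *: _).
have [->|mi] := posnP (m i); first by rewrite !scale0r.
congr (_ *: _); rewrite -mpolyXD addmC submK //; apply/mnm_lepP => j.
by rewrite mnm1E; case: eqP => [<-|].
Qed.

End Euler.

(** * The symmetric trilinear form of a cubic and linear substitutions *)

Section Trilinear.
Variable K : numClosedFieldType.
Local Notation V := 'rV[K]_6.
Implicit Types (f : dhomog 6 K 3) (u v w : V).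

Definition tens3 f (a b c : 'I_6) : K := ((val f)^`M(a)^`M(b)^`M(c))@_0%MM / 6%:R.

Definition tri f u v w : K := \sum_a \sum_b \sum_c tens3 f a b c * (u ord0 a * v ord0 b * w ord0 c).

(** Euler's identity is applied in degrees 3, 2 and 1; this produces the factor 6 = 1 * 2 * 3 that
    [tens3] divides by. *)
Lemma cubic_expand f :
  val f = \sum_a \sum_b \sum_c (tens3 f a b c)%:MP * ('X_a * 'X_b * 'X_c).
Proof.
have h3 : val f \is 3.-homog by exact: dhomog_is_dhomog.
have cst a b c : (val f)^`M(a)^`M(b)^`M(c) = (6%:R * tens3 f a b c)%:MP.
  have h0 : (val f)^`M(a)^`M(b)^`M(c) \is 0.-homog by do 3!apply: dhomog_mderiv.
  rewrite /tens3 mulrC divfK ?pnatr_eq0 //; apply/mpolyP => m; rewrite mcoeffC.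
  have [->|m0] := eqVneq m 0%MM; first by rewrite mulr1.
  rewrite mulr0; apply: (dhomog_nemf_coeff h0); by rewrite /= mdeg_eq0.
have n6 : 6%:R != 0 :> K by rewrite pnatr_eq0.
apply: (scalerI n6); have -> : 6%:R = 1%:R * 2%:R * 3%:R :> K by rewrite -!natrM.
rewrite -scalerA -(euler h3) -scalerA !scaler_sumr; apply: eq_bigr => a _.
rewrite scalerAr scalerAr -(euler (dhomog_mderiv a h3)) scaler_sumr mulr_sumr scaler_sumr.
apply: eq_bigr => b _; rewrite scalerAr -(euler (dhomog_mderiv b (dhomog_mderiv a h3))).
rewrite !mulr_sumr scaler_sumr; apply: eq_bigr => c _.
by rewrite cst mul_mpolyC mpolyCM -!mul_mpolyC; set x := 6%:R; set t := (tens3 _ _ _ _)%:MP; ring.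
Qed.

Lemma tens3C12 f a b c : tens3 f a b c = tens3 f b a c.
Proof. by rewrite /tens3 (mderiv_comm a b). Qed.

Lemma tens3C23 f a b c : tens3 f a b c = tens3 f a c b.
Proof. by rewrite /tens3 (mderiv_comm b c). Qed.

Lemma triC12 f u v w : tri f u v w = tri f v u w.
Proof.
rewrite /tri exchange_big; apply: eq_bigr => b _; apply: eq_bigr => a _; apply: eq_bigr => c _.
by rewrite tens3C12 [u _ _ * _]mulrC.
Qed.

Lemma triC23 f u v w : tri f u v w = tri f u w v.
Proof.
rewrite /tri; apply: eq_bigr => a _; rewrite exchange_big; apply: eq_bigr => c _; apply: eq_bigr => b _.
by rewrite tens3C23 -!mulrA [v _ _ * _]mulrC.
Qed.

Lemma triD1 f u u' v w : tri f (u + u') v w = tri f u v w + tri f u' v w.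
Proof.
rewrite /tri -big_split; apply: eq_bigr => a _; rewrite -big_split; apply: eq_bigr => b _.
by rewrite -big_split; apply: eq_bigr => c _; rewrite mxE /=; ring.
Qed.

Lemma triZ1 f x u v w : tri f (x *: u) v w = x * tri f u v w.
Proof.
rewrite /tri mulr_sumr; apply: eq_bigr => a _; rewrite mulr_sumr; apply: eq_bigr => b _.
by rewrite mulr_sumr; apply: eq_bigr => c _; rewrite mxE /=; ring.
Qed.

Lemma triD2 f u v v' w : tri f u (v + v') w = tri f u v w + tri f u v' w.
Proof. by rewrite triC12 triD1 !(triC12 f u). Qed.

Lemma triZ2 f x u v w : tri f u (x *: v) w = x * tri f u v w.
Proof. by rewrite triC12 triZ1 (triC12 f u). Qed.

Lemma triD3 f u v w w' : tri f u v (w + w') = tri f u v w + tri f u v w'.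
Proof. by rewrite triC23 triD2 !(triC23 f u v). Qed.

Lemma triZ3 f x u v w : tri f u v (x *: w) = x * tri f u v w.
Proof. by rewrite triC23 triZ2 (triC23 f u v). Qed.

Definition triE := (triD1, triD2, triD3, triZ1, triZ2, triZ3).

Lemma tri0 f v w : tri f 0 v w = 0.
Proof. by rewrite -(scale0r 0) triZ1 mul0r. Qed.

Lemma evalf_tri f v : evalf f v = tri f v v v.
Proof.
rewrite /evalf cubic_expand meval_sum; apply: eq_bigr => a _; rewrite meval_sum; apply: eq_bigr => b _.
by rewrite meval_sum; apply: eq_bigr => c _; rewrite !mevalM mevalC !mevalXU.
Qed.

Lemma dirder_tri f v w : dirder f v w = 3%:R * tri f v v w.
Proof.
have d i : ((val f)^`M(i)).@[v ord0] = \sum_a \sum_b \sum_c tens3 f a b c *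
   (((a == i)%:R * v ord0 b + v ord0 a * (b == i)%:R) * v ord0 c + v ord0 a * v ord0 b * (c == i)%:R).
  rewrite {1}cubic_expand mderiv_sum meval_sum; apply: eq_bigr => a _.
  rewrite mderiv_sum meval_sum; apply: eq_bigr => b _.
  rewrite mderiv_sum meval_sum; apply: eq_bigr => c _.
  rewrite mderiv_mulC !mderivM !mderivXU; rewrite !(mevalM, mevalD, mevalC, mevalXU) //.
have e (v' : 'I_6 -> K) (i : 'I_6) : \sum_j (i == j)%:R * v' j = v' i :> K.
  rewrite (bigD1 i) //= eqxx mul1r big1 ?addr0 // => j /negPf; rewrite eq_sym => ->; exact: mul0r.
have s : dirder f v w = tri f w v v + tri f v w v + tri f v v w.
  rewrite /dirder; under eq_bigr => i _ do rewrite d mulr_suml.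
  rewrite exchange_big /tri -!big_split; apply: eq_bigr => a _ /=.
  under eq_bigr => i _ do rewrite mulr_suml.
  rewrite exchange_big -!big_split; apply: eq_bigr => b _ /=.
  under eq_bigr => i _ do rewrite mulr_suml.
  rewrite exchange_big -!big_split; apply: eq_bigr => c _ /=.
  rewrite -(e (w ord0) a) -(e (w ord0) b) -(e (w ord0) c).
  rewrite !mulr_suml !mulr_sumr !mulr_suml !mulr_sumr -!big_split; apply: eq_bigr => i _ /=; ring.
by rewrite s (triC12 f w) (triC23 f v w); ring.
Qed.

Section Polarization.
Variable F : V -> V -> V -> K.
Hypothesis FD : forall u u' v w, F (u + u') v w = F u v w + F u' v w.
Hypothesis F12 : forall u v w, F u v w = F v u w.
Hypothesis F23 : forall u v w, F u v w = F u w v.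

Lemma polarization u v w : 6%:R * F u v w =
  F (u + v + w) (u + v + w) (u + v + w) - F (u + v) (u + v) (u + v) - F (u + w) (u + w) (u + w)
  - F (v + w) (v + w) (v + w) + F u u u + F v v v + F w w w.
Proof.
have FD2 x y y' z : F x (y + y') z = F x y z + F x y' z by rewrite F12 FD !(F12 x).
have FD3 x y z z' : F x y (z + z') = F x y z + F x y z' by rewrite F23 FD2 !(F23 x y).
have p1 x y : F x y x = F x x y by rewrite F23.
have p2 x y : F y x x = F x x y by rewrite F12 F23.
rewrite !FD !FD2 !FD3 (p1 u v) (p1 u w) (p1 v u) (p1 v w) (p1 w u) (p1 w v).
rewrite (p2 u v) (p2 u w) (p2 v u) (p2 v w) (p2 w u) (p2 w v).
rewrite (F23 u w v) (F12 v u w) (F23 v w u) (F12 v u w) (F23 w v u) (F12 w u v) (F23 u w v).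
ring.
Qed.
End Polarization.

(** Polarisation recovers a symmetric trilinear form from its diagonal values, 6 being
    invertible. *)
Lemma tri_uniq f (F : V -> V -> V -> K) :
  (forall u u' v w, F (u + u') v w = F u v w + F u' v w) ->
  (forall u v w, F u v w = F v u w) -> (forall u v w, F u v w = F u w v) ->
  (forall v, evalf f v = F v v v) -> forall u v w, tri f u v w = F u v w.
Proof.
move=> FD F12 F23 E u v w; have n6 : 6%:R != 0 :> K by rewrite pnatr_eq0.
apply: (mulfI n6); rewrite (polarization FD F12 F23) -!E !evalf_tri.
exact: (polarization (triD1 f) (triC12 f) (triC23 f)).
Qed.

Lemma cubic_of_tensor (t : 'I_6 -> 'I_6 -> 'I_6 -> K) :
  (\sum_a \sum_b \sum_c (t a b c)%:MP * ('X_a * 'X_b * 'X_c) : {mpoly K[6]}) \is 3.-homog.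
Proof.
do 3!(apply: rpred_sum => ? _); rewrite mul_mpolyC; apply: dhomogZ.
rewrite -!mpolyXD dhomogX /=; apply/eqP; rewrite [LHS]mdegD mdegD !mdeg1 //.
Qed.

Definition cub t : dhomog 6 K 3 := DHomog (cubic_of_tensor t).

Lemma evalf_cub t v : evalf (cub t) v = \sum_a \sum_b \sum_c t a b c * (v ord0 a * v ord0 b * v ord0 c).
Proof.
rewrite /evalf /= meval_sum; apply: eq_bigr => a _; rewrite meval_sum; apply: eq_bigr => b _.
by rewrite meval_sum; apply: eq_bigr => c _; rewrite !mevalM mevalC !mevalXU.
Qed.

Lemma cub_tens3 f : cub (tens3 f) = f.
Proof. by apply: val_inj; rewrite /= -cubic_expand. Qed.

Definition actc (G : 'M[K]_6) f : dhomog 6 K 3 :=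
  cub (fun a b c => tri f (row a G) (row b G) (row c G)).

Lemma evalf_actc G f v : evalf (actc G f) v = evalf f (v *m G).
Proof.
have E w : w *m G = \sum_a w ord0 a *: row a G by rewrite {1}mulmx_sum_row.
have S1 (r : seq 'I_6) (x : 'I_6 -> K) (X : 'I_6 -> V) u w :
    tri f (\sum_(a <- r) x a *: X a) u w = \sum_(a <- r) x a * tri f (X a) u w.
  elim: r => [|a r IH]; first by rewrite !big_nil tri0.
  by rewrite !big_cons triD1 triZ1 IH.
rewrite evalf_cub evalf_tri {1}E S1; apply: eq_bigr => a _.
rewrite triC12 {1}E S1 mulr_sumr; apply: eq_bigr => b _.
rewrite triC12 triC23 triC12 {1}E S1 !mulr_sumr; apply: eq_bigr => c _.
by rewrite (triC12 f (row c G)) (triC23 f (row a G)); ring.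
Qed.

Lemma tri_actc G f u v w : tri (actc G f) u v w = tri f (u *m G) (v *m G) (w *m G).
Proof.
apply: (tri_uniq (F := fun u v w => tri f (u *m G) (v *m G) (w *m G))).
- by move=> *; rewrite mulmxDl triD1.
- by move=> *; rewrite triC12.
- by move=> *; rewrite triC23.
- by move=> x; rewrite evalf_actc evalf_tri.
Qed.

Lemma tri_delta f a b c : tri f (delta_mx 0 a) (delta_mx 0 b) (delta_mx 0 c) = tens3 f a b c.
Proof.
have pick (i : 'I_6) (F : 'I_6 -> K) : \sum_j (delta_mx 0 i : V) ord0 j * F j = F i.
  rewrite (bigD1 i) //= !mxE !eqxx mul1r big1 ?addr0 // => j /negPf ji.
  by rewrite mxE ji andbF mul0r.
rewrite /tri -(pick a (fun a => tens3 f a b c)); apply: eq_bigr => a' _.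
rewrite -(pick b (fun b => tens3 f a' b c)) mulr_sumr; apply: eq_bigr => b' _.
rewrite -(pick c (fun c => tens3 f a' b' c)) !mulr_sumr; apply: eq_bigr => c' _; ring.
Qed.

Lemma cubic_eq f f' : (forall u v w, tri f u v w = tri f' u v w) -> f = f'.
Proof.
move=> E; rewrite -[f]cub_tens3 -[f']cub_tens3; congr cub.
apply/funext => a; apply/funext => b; apply/funext => c.
by rewrite -!tri_delta.
Qed.

Lemma actcM G H f : actc G (actc H f) = actc (G *m H) f.
Proof. by apply: cubic_eq => u v w; rewrite !tri_actc !mulmxA. Qed.

Lemma actc1 f : actc 1%:M f = f.
Proof. by apply: cubic_eq => u v w; rewrite tri_actc !mulmx1. Qed.

End Trilinear.

(** * General cubics *)

Section Hypersurface.
Variable K : fieldType.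

Lemma card_bmultinom_leq m d : (#|{: 'X_{1..m < d}}| <= d ^ m)%N.
Proof.
pose h (x : 'X_{1..m < d}) : {ffun 'I_m -> 'I_d} :=
  [ffun i => insubd (Ordinal (leq_ltn_trans (leq0n _) (bmdeg x))) (bmnm x i)].
have hE x i : h x i = bmnm x i :> nat.
  rewrite ffunE val_insubd; case: ifP => // /negP []; apply: leq_ltn_trans (bmdeg x).
  by rewrite mdegE (bigD1 i) //= leq_addr.
have hi : injective h.
  move=> x y E; apply: val_inj; apply/mnmP => i.
  by rewrite -[LHS]hE E hE.
by have := leq_card h hi; rewrite card_ffun !card_ord.
Qed.

Lemma msize_prod_exp m n (p : 'I_n -> {mpoly K[m]}) (k : 'I_n -> nat) e d :
  (forall i, (msize (p i) <= e.+1)%N) -> (forall i, (k i <= d)%N) ->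
  (msize (\prod_i p i ^+ k i) <= (n * (d * e)).+1)%N.
Proof.
move=> pe kd.
have M a b (u v : {mpoly K[m]}) : (msize u <= a.+1)%N -> (msize v <= b.+1)%N -> (msize (u * v) <= (a +
    b).+1)%N.
  move=> ua vb; have [->|u0] := eqVneq u 0; first by rewrite mul0r msize0.
  have [->|v0] := eqVneq v 0; first by rewrite mulr0 msize0.
  rewrite msizeM // -subn1 leq_subLR add1n; apply: leq_trans (leq_add ua vb) _.
  by rewrite addSn addnS.
have X i : (msize (p i ^+ k i) <= (d * e).+1)%N.
  apply: leq_trans (_ : (k i * e).+1 <= _)%N; last by rewrite ltnS leq_mul2r kd orbT.
  elim: (k i) => [|l IH]; first by rewrite expr0 msize1.
  by rewrite exprS mulSn; apply: M.
have -> : (n * (d * e) = \sum_(i < n) d * e)%N by rewrite sum_nat_const card_ord.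
elim/big_ind2: _ => //; first by rewrite msize1.
by move=> u a v b; apply: M.
Qed.

(* A polynomial map from a space of smaller dimension satisfies an equation:
   there are more monomials of bounded exponents in the target coordinates than
   coefficients in their pullbacks. *)
Lemma polynomial_image_equation m N (Phi : 'I_N -> {mpoly K[m]}) : (m < N)%N ->
  exists Q : {mpoly K[N]}, Q != 0 /\
    forall p, Q.@[fun i => (Phi i).@[p]] = 0.
Proof.
move=> mN; pose e := (\max_i msize (Phi i))%N.
have Pe i : (msize (Phi i) <= e.+1)%N by apply: leqW; apply: leq_bigmax.
(* There are d^N monomials with exponents below d, and their pullbacks have degree at most N d e,
   hence at most (N d e + 1)^m coefficients. This is bounded by (N e + 2)^m d^m, so d is chosen
   above (N e + 2)^m to stay below d^(m + 1), which is at most d^N. *)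
pose d := (((N * e).+2) ^ m)%N.+1.
pose T : finType := {ffun 'I_N -> 'I_d}.
pose mon (k : T) : 'X_{1..N} := [multinom (k i : nat) | i < N].
pose c (j : 'I_#|T|) := \prod_i Phi i ^+ (enum_val j : T) i.
have cd j : (msize (c j) <= (N * (d * e)).+1)%N.
  by apply: msize_prod_exp => // i; apply: ltnW.
have dpos : (0 < d)%N by [].
have lt : (#|{: 'X_{1..m < (N * (d * e)).+1}}| < #|T|)%N.
  apply: leq_ltn_trans (card_bmultinom_leq _ _) _.
  rewrite card_ffun !card_ord.
  apply: leq_ltn_trans (_ : (((N * e).+2 * d) ^ m < d ^ N)%N).
    have [->|m0] := posnP m; first by rewrite !expn0.
    rewrite leq_exp2r // mulSn mulSn addnA -[(N * e * d)%N]mulnA [(e * d)%N]mulnC.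
    by rewrite -addn1 addnC leq_add // addn_gt0 dpos.
  rewrite expnMn; apply: leq_trans (_ : d ^ m.+1 <= _)%N; last by rewrite leq_pexp2l.
  by rewrite expnS ltn_pmul2r ?expn_gt0.
have [l l0 El] := bounded_mpoly_dependent lt cd.
exists (\sum_j l ord0 j *: 'X_[mon (enum_val j)]); split; last first.
  move=> p; rewrite meval_sum; have := congr1 (meval p) El; rewrite meval0 meval_sum.
  apply: etrans.
  apply: eq_bigr => j _; rewrite !mevalZ mevalX rmorph_prod; congr (_ * _).
  by apply: eq_bigr => i _; rewrite rmorphXn mnmE.
have [j lj] : exists j, l ord0 j != 0.
  apply: contrapT => nol; case/eqP: l0; apply/rowP => j; rewrite mxE.
  by apply/eqP; apply: contrapT => lj; apply: nol; exists j; apply/negP.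
apply/eqP => /(congr1 (mcoeff (mon (enum_val j)))); rewrite mcoeff0 raddf_sum (bigD1 j) //=.
rewrite mcoeffZ mcoeffX eqxx mulr1 big1 ?addr0; first by apply/eqP.
move=> j' jj'; rewrite mcoeffZ mcoeffX; case: eqP => [E|_]; last by rewrite mulr0.
case/eqP: jj'; apply: enum_val_inj; apply/ffunP => i; apply: val_inj.
by have /mnmP/(_ i) := E; rewrite !mnmE.
Qed.

End Hypersurface.

Lemma mpoly_neq0_point (K : closedFieldType) n (Q : {mpoly K[n]}) : uncountable_field K ->
  Q != 0 -> exists z, Q.@[z] != 0.
Proof.
move=> Ku Q0; have i0 : is_ideal [set p : {mpoly K[n]} | p = 0].
  by split=> [//|x y -> ->|a x ->]; rewrite ?addr0 ?mulr0.
have [N /= /eqP|z [_ Qz]] := nullstellensatz (h := Q) Ku i0; last by exists z.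
by rewrite expf_eq0 (negPf Q0) andbF.
Qed.

(** * Families of cubics depending on few parameters *)

Section Small.
Variable K : numClosedFieldType.
Local Notation V := 'rV[K]_6.
Local Notation Cub := (dhomog 6 K 3).
Local Notation T := ('I_6 * 'I_6 * 'I_6)%type.
Implicit Types (f : Cub) (S : Cub -> Prop).

Definition t3 f (a : T) : K := tens3 f a.1.1 a.1.2 a.2.

(* [S] is covered by finitely many polynomial images of [K^m]. *)
Definition small m S : Prop :=
  exists L : seq {ffun T -> {mpoly K[m]}}, forall f, S f ->
    exists2 Phi, Phi \in L & exists p : 'I_m -> K, forall a, t3 f a = (Phi a).@[p].

Lemma small_sub m S S' : (forall f, S f -> S' f) -> small m S' -> small m S.
Proof. by move=> SS' [L HL]; exists L => f /SS' /HL. Qed.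

Lemma small_bigU m (I : finType) (S : I -> Cub -> Prop) :
  (forall i, small m (S i)) -> small m (fun f => exists i, S i f).
Proof.
move=> /choice[L HL]; exists (flatten [seq L i | i <- enum I]) => f [i /(HL i)[Phi PL [p fp]]].
exists Phi; last by exists p.
by apply/flattenP; exists (L i) => //; apply: map_f; rewrite mem_enum.
Qed.

(** The covering maps are followed by a linear change of the coefficients that is polynomial in r
    further parameters. *)
Lemma small_op m r S (P : T -> T -> {mpoly K[r]}) : small m S ->
  small (m + r) (fun f' => exists f, S f /\ exists q : 'I_r -> K,
    forall a, t3 f' a = \sum_b t3 f b * (P a b).@[q]).
Proof.
move=> [L HL].
pose wl : m.-tuple {mpoly K[m + r]} := [tuple 'X_(lshift r i) | i < m].
pose wr : r.-tuple {mpoly K[m + r]} := [tuple 'X_(rshift m i) | i < r].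
exists (map (fun Phi : {ffun T -> {mpoly K[m]}} => [ffun a => \sum_b (Phi b \mPo wl) * (P a b \mPo wr)]) L).
move=> f' [f [/HL[Phi PL [p fp]] [q fq]]].
eexists; first by apply: map_f PL.
exists (fun i => match fintype.split i with inl j => p j | inr j => q j end) => a.
rewrite fq ffunE meval_sum; apply: eq_bigr => b _; rewrite mevalM !comp_mpoly_meval fp.
congr (_ * _); apply: meval_eq => i; rewrite tnth_mktuple mevalXU.
  by rewrite (unsplitK (inl i)).
by rewrite (unsplitK (inr i)).
Qed.

(** Permutations of the coordinates cost no parameter, being finite in number. *)
Lemma small_perm m S : small m S ->
  small m (fun f => exists s : 'S_6, S (actc (perm_mx s) f)).
Proof.
move=> sS; apply: small_bigU => s; have [L HL] := sS.
exists (map (fun Phi : {ffun T -> {mpoly K[m]}} => [ffun a : T => Phi ((s^-1)%g a.1.1, (s^-1)%g a.1.2,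
    (s^-1)%g a.2)]) L).
move=> f /HL[Phi PL [p fp]]; eexists; first by apply: map_f PL.
exists p => a; rewrite ffunE -fp.
have row_perm b : delta_mx 0 ((s^-1)%g b) *m perm_mx s = delta_mx 0 b :> V.
  by rewrite -rowE; apply/rowP => j; rewrite !mxE permKV eqxx eq_sym.
by rewrite /t3 -!tri_delta tri_actc !row_perm.
Qed.

Lemma tri_sum f (x y z : V) :
  tri f x y z = \sum_(b : T) t3 f b * (x ord0 b.1.1 * y ord0 b.1.2 * z ord0 b.2).
Proof.
rewrite /tri [RHS](eq_bigr (fun b : T => let F (c : 'I_6 * 'I_6) d := tens3 f c.1 c.2 d * (x ord0 c.1 *
    y ord0 c.2 * z ord0 d) in F b.1 b.2)) //=.
by rewrite -(pair_bigA _ (fun (c : 'I_6 * 'I_6) d => tens3 f c.1 c.2 d * (x ord0 c.1 * y ord0 c.2 * z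
    ord0 d))) /=
  -(pair_bigA _ (fun c c' => \sum_d tens3 f c c' d * (x ord0 c * y ord0 c' * z ord0 d))).
Qed.

Definition shear (i j : 'I_6) (t : K) : 'M[K]_6 := 1%:M + t *: delta_mx i j.

Lemma shearM i j s t : i != j -> shear i j s *m shear i j t = shear i j (s + t).
Proof.
move=> ij; rewrite /shear mulmxDl mul1mx mulmxDr mulmx1 -scalemxAl -scalemxAr.
by rewrite mul_delta_mx_0 1?eq_sym // !scaler0 addr0 scalerDl -addrA [t *: _ + _]addrC.
Qed.

Lemma shear0 i j : shear i j 0 = 1%:M.
Proof. by rewrite /shear scale0r addr0. Qed.

Lemma shear_unit i j t : i != j -> shear i j t \in unitmx.
Proof.
move=> ij; case: (mulmx1_unit (B := shear i j (- t)) (A := shear i j t)) => //.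
by rewrite shearM // subrr shear0.
Qed.

Lemma invmx_shear i j t : i != j -> invmx (shear i j t) = shear i j (- t).
Proof.
move=> ij; rewrite -[RHS]mulmx1 -(mulmxV (shear_unit t ij)) mulmxA shearM //.
by rewrite addrC subrr shear0 mul1mx.
Qed.

Lemma mul_shear i j t (v : V) l : (v *m shear i j t) ord0 l = v ord0 l + t * v ord0 i * (j == l)%:R.
Proof.
rewrite /shear mulmxDr mulmx1 mxE; congr (_ + _).
rewrite -scalemxAr mxE -mulrA; congr (_ * _); rewrite mxE (bigD1 i) //= mxE eqxx eq_sym /=.
by rewrite big1 ?addr0 // => k /negPf ki; rewrite mxE ki mulr0.
Qed.

(** The inverse shear recovers the cubic from its transform, polynomially in t: this is the one
    additional parameter. *)
Lemma small_shear m S (i j : 'I_6) : i != j -> small m S ->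
  small m.+1 (fun f => exists t, S (actc (shear i j t) f)).
Proof.
move=> ij sS; rewrite -addn1.
pose g (a b : 'I_6) : {mpoly K[1]} := (a == b)%:R%:MP + ((a == i) && (j == b))%:R%:MP * 'X_ord0.
apply: (small_sub _ (small_op (fun a b : T => g a.1.1 b.1.1 * g a.1.2 b.1.2 * g a.2 b.2) sS)).
move=> f [t St]; exists (actc (shear i j t) f); split=> //; exists (fun=> - t) => a.
have {1}-> : f = actc (shear i j (- t)) (actc (shear i j t) f).
  by rewrite actcM shearM // addrC subrr shear0 actc1.
rewrite {1}/t3 -!tri_delta tri_actc tri_sum; apply: eq_bigr => b _; congr (_ * _).
have E (c d : 'I_6) : ((delta_mx 0 c : V) *m shear i j (- t)) ord0 d = (g c d).@[fun=> - t].
  rewrite mul_shear !mxE mevalD mevalM !mevalC mevalXU eqxx /= [d == c]eq_sym [i == c]eq_sym.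
  by case: (c == i); case: (j == d); rewrite /= ?mulr0 ?mul0r ?mulr1 ?mul1r.
by rewrite !mevalM !E.
Qed.

End Small.

(** * Moving vectors attached to a cubic to multiples of basis vectors *)

Section Reduction.
Variable K : numClosedFieldType.
Local Notation V := 'rV[K]_6.
Local Notation Cub := (dhomog 6 K 3).
Local Notation N := (\dim {: Cub}).
Implicit Types (f : Cub) (S : Cub -> Prop) (v : 'I_6 -> V).

Variables (k : nat) (B : Cub -> ('I_6 -> V) -> Prop).
Hypothesis BG : forall f G v, G \in unitmx -> B f v -> B (actc G f) (fun i => v i *m invmx G).

(** Only the first k of the six vectors matter; indexing the family by ['I_6] lets a vector and its
    pivot coordinate share an index. *)
Definition indep v : Prop := forall c : 'I_6 -> K,
  \sum_(i < 6 | (i < k)%N) c i *: v i = 0 -> forall i : 'I_6, (i < k)%N -> c i = 0.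

Lemma indep_act v (G : 'M[K]_6) : G \in unitmx -> indep v -> indep (fun i => v i *m invmx G).
Proof.
move=> uG iv c E; apply: iv; rewrite -[LHS](mulmxKV uG) mulmx_suml.
rewrite (_ : \sum_(i < 6 | _) _ = 0) ?mul0mx // -[RHS]E; apply: eq_bigr => i _.
by rewrite scalemxAl.
Qed.

Definition reduced a v : Prop := forall b : 'I_6, (b < a)%N ->
  v b ord0 b != 0 /\ forall j, j != b -> v b ord0 j = 0.

Definition stage a f : Prop := exists v, [/\ B f v, indep v & reduced a v].

Definition substage (a : 'I_6) (J : seq 'I_6) f : Prop := exists v,
  [/\ B f v, indep v, reduced a v, v a ord0 a != 0 &
      forall j, j \in J -> j != a -> v a ord0 j = 0].

(** One shear clears the coordinate j of the a-th vector. It leaves the earlier vectors alone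
    because their a-th coordinate is 0. *)
Lemma substage_cons m (a j : 'I_6) J : a != j -> small m (substage a (j :: J)) ->
  small m.+1 (substage a J).
Proof.
move=> aj /(small_shear aj); apply: small_sub => f [v [Bv iv rv va vJ]].
pose t := v a ord0 j / v a ord0 a; have uG := shear_unit t aj.
exists t, (fun i => v i *m invmx (shear a j t)).
have E i l : (v i *m invmx (shear a j t)) ord0 l = v i ord0 l - t * v i ord0 a * (j == l)%:R.
  by rewrite invmx_shear // mul_shear mulNr mulNr.
split; [exact: BG|exact: indep_act| |by rewrite E [j == a]eq_sym (negPf aj) mulr0 subr0|].
- move=> b ba; have [vb vbj] := rv b ba.
  have ab : a != b by apply: contraTneq ba => ->; rewrite ltnn.
  by split=> [|l lb]; rewrite E (vbj a ab) mulr0 mul0r subr0 // vbj.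
- move=> l; rewrite inE => /orP[/eqP->|lJ] la; rewrite E.
    by rewrite eqxx mulr1 /t divfK ?subrr.
  by have [<-|_] := eqVneq j l; [rewrite mulr1 /t divfK ?subrr|rewrite mulr0 subr0 vJ].
Qed.

Lemma substage_all m (a : 'I_6) (s J : seq 'I_6) : a \notin s ->
  small m (substage a (s ++ J)) -> small (m + size s) (substage a J).
Proof.
elim: s J m => [|j s IH] J m; first by rewrite addn0.
rewrite inE negb_or => /andP[aj /IH {}IH] /(substage_cons aj)/IH.
by rewrite addSnnS.
Qed.

(* Five shears move the [a]-th vector to a multiple of the [a]-th basis vector. *)
Lemma stage_step m (a : 'I_6) : (a < k)%N -> small m (stage a.+1) -> small (m + 5) (stage a).
Proof.
move=> ak sm; pose s := rem a (enum 'I_6).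
have ss : size s = 5 by rewrite size_rem ?mem_enum // size_enum_ord.
have as_ : a \notin s by rewrite mem_rem_uniq ?enum_uniq // !inE eqxx.
have : small m (substage a (s ++ [::])).
  apply: small_sub sm => f [v [Bv iv rv va vJ]]; exists v; split=> // b.
  rewrite ltnS leq_eqVlt => /orP[/eqP/val_inj->|]; last exact: rv.
  split=> // j ja; apply: vJ => //.
  by rewrite cats0 mem_rem_uniq ?enum_uniq // !inE ja mem_enum.
move=> /(substage_all as_); rewrite ss => /small_perm.
apply: small_sub => f [v [Bv iv rv]].
(* A pivot exists at or beyond position a: otherwise [v a] would be a combination of the earlier
   vectors, and [c] is the resulting relation. *)
have [p ap vp] : exists2 p : 'I_6, (a <= p)%N & v a ord0 p != 0.
  apply: contrapT => no.
  pose c (i : 'I_6) := if i == a then 1 else if (i < a)%N then - (v a ord0 i / v i ord0 i) else 0.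
  have : c a = 0; last by rewrite /c eqxx => /eqP; rewrite oner_eq0.
  have rowP0 (x y : V) : (forall l, x ord0 l = y ord0 l) -> x = y by move=> H; apply/rowP.
  apply: (iv c) => //; apply: rowP0 => l; rewrite summxE mxE.
  rewrite (bigD1 a) //= /c eqxx scale1r.
  have [la|al] := ltnP l a; last first.
    have -> : v a ord0 l = 0 by apply/eqP; apply: contrapT => /negP vl; apply: no; exists l.
    rewrite add0r big1 // => i /andP[_ /negPf ia]; rewrite ia mxE.
    case: ifP => [il|]; last by rewrite mul0r.
    have li : l != i by apply/eqP => li; move: al; rewrite li leqNgt il.
    by have [_ z] := rv i il; rewrite (z l li) mulr0.
  have lna : l != a by apply: contraTneq la => ->; rewrite ltnn.
  rewrite (bigD1 l) ?(ltn_trans la ak) //= (negPf lna) la mxE mulNr divfK; last by case: (rv l la).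
  rewrite addrA subrr add0r big1 // => i /andP[/andP[_ /negPf ia] il]; rewrite ia mxE.
  case: ifP => [ia'|]; last by rewrite mul0r.
  have li : l != i by rewrite eq_sym.
  by have [_ z] := rv i ia'; rewrite (z l li) mulr0.
exists (tperm a p), (fun i => v i *m invmx (perm_mx (tperm a p))).
have uG : perm_mx (tperm a p) \in @unitmx K 6 by apply: unitmx_perm.
have Pi : invmx (perm_mx (tperm a p)) = perm_mx (tperm a p) :> 'M[K]_6.
  by rewrite -[RHS]mulmx1 -(mulmxV uG) mulmxA -perm_mxM tperm2 perm_mx1 mul1mx.
have E i l : (v i *m invmx (perm_mx (tperm a p))) ord0 l = v i ord0 (tperm a p l).
  rewrite Pi mxE (bigD1 (tperm a p l)) //= !mxE tpermK eqxx mulr1.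
  rewrite big1 ?addr0 // => j; rewrite !mxE => /negPf jl.
  by rewrite -(inj_eq (@perm_inj _ (tperm a p))) tpermK in jl; rewrite jl mulr0.
split=> //; [exact: BG|exact: indep_act| |by rewrite E tpermL].
move=> b ba; have [vb vbj] := rv b ba.
have ab : a != b by apply: contraTneq ba => ->; rewrite ltnn.
have pb : p != b by apply: contraTneq ba => <-; rewrite -leqNgt.
split=> [|j jb]; first by rewrite E tpermD.
by rewrite E vbj //; case: tpermP => // ->.
Qed.

(** The cost is the dimension of k copies of P^5, since [reduced] leaves each vector free up to a
    scalar. *)
Lemma stage_reduce m : (k <= 6)%N -> small m (stage k) -> small (m + 5 * k) (stage 0).
Proof.
move=> k6; suff H a : (a <= k)%N -> small m (stage k) -> small (m + 5 * a) (stage (k - a)).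
  by move/(H k (leqnn _)); rewrite subnn.
elim: a => [|a IH] ak sm; first by rewrite muln0 addn0 subn0.
have lt : (k - a.+1 < 6)%N by apply: leq_trans k6; rewrite ltn_subrL (leq_ltn_trans _ ak).
have := @stage_step (m + 5 * a) (Ordinal lt); rewrite /= ltn_subrL (leq_ltn_trans _ ak) //.
rewrite -subSn // subSS => /(_ isT); rewrite mulnS [(5 + _)%N]addnC addnA; apply.
by apply: IH => //; apply: ltnW.
Qed.

End Reduction.

(** * Cubics with prescribed vanishing coefficients *)

Section Base.
Variable K : numClosedFieldType.
Local Notation V := 'rV[K]_6.
Local Notation Cub := (dhomog 6 K 3).
Local Notation T := ('I_6 * 'I_6 * 'I_6)%type.
Local Notation N := (\dim {: Cub}).
Implicit Types (f : Cub) (S : Cub -> Prop).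

Lemma tens3_cub (t : 'I_6 -> 'I_6 -> 'I_6 -> K) a b c :
  (forall a b c, t a b c = t b a c) -> (forall a b c, t a b c = t a c b) ->
  tens3 (cub t) a b c = t a b c.
Proof.
move=> t12 t23.
pose F (u v w : V) := \sum_a \sum_b \sum_c t a b c * (u ord0 a * v ord0 b * w ord0 c).
have <- : F (delta_mx 0 a) (delta_mx 0 b) (delta_mx 0 c) = t a b c.
  have pick (i : 'I_6) (G : 'I_6 -> K) : \sum_j (delta_mx 0 i : V) ord0 j * G j = G i.
    rewrite (bigD1 i) //= !mxE !eqxx mul1r big1 ?addr0 // => j /negPf ji.
    by rewrite mxE ji andbF mul0r.
  rewrite /F -(pick a (fun a => t a b c)); apply: eq_bigr => a' _.
  rewrite -(pick b (fun b => t a' b c)) mulr_sumr; apply: eq_bigr => b' _.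
  rewrite -(pick c (fun c => t a' b' c)) !mulr_sumr; apply: eq_bigr => c' _; ring.
rewrite -tri_delta; apply: (tri_uniq (F := F)).
- move=> u u' v w; rewrite /F -big_split; apply: eq_bigr => i _; rewrite -big_split; apply: eq_bigr => j _.
  by rewrite -big_split; apply: eq_bigr => l _; rewrite mxE /=; ring.
- move=> u v w; rewrite /F exchange_big; apply: eq_bigr => i _; apply: eq_bigr => j _; apply: eq_bigr => l _.
  by rewrite t12 [u _ _ * _]mulrC.
- move=> u v w; rewrite /F; apply: eq_bigr => i _; rewrite exchange_big; apply: eq_bigr => j _; apply:
    eq_bigr => l _.
  by rewrite t23 -!mulrA [v _ _ * _]mulrC.
- exact: evalf_cub.
Qed.

Definition tl (a : T) : seq 'I_6 := [:: a.1.1; a.1.2; a.2].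

(** All orderings of [s] get the coefficient 1, so that the tensor is symmetric and [tens3_cub]
    reads it off. *)
Definition monom (s : seq 'I_6) : Cub := cub (fun a b c => (perm_eq [:: a; b; c] s)%:R).

Lemma t3_monom s a : t3 (monom s) a = (perm_eq (tl a) s)%:R.
Proof.
rewrite /t3 tens3_cub // => b c d; congr (_%:R); congr (nat_of_bool _).
  exact: (perm_catCA [:: b] [:: c] [:: d] s).
have /permPl H : perm_eq [:: b; c; d] [:: b; d; c].
  by rewrite perm_cons; apply: permEl; apply: (perm_catC [:: c] [:: d]).
exact: H.
Qed.

Definition t3at (a : T) f : K^o := t3 f a.

Lemma t3_linear a : linear (t3at a).
Proof.
move=> c f g; rewrite /t3at /t3 /tens3.
have -> : val (c *: f + g) = c *: val f + val g by [].
by rewrite !(mderivD, mderivZ) mcoeffD mcoeffZ mulrDl -mulrA.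
Qed.

HB.instance Definition _ a := GRing.isLinear.Build K Cub K^o _ (t3at a) (t3_linear a).

Lemma small_vspace (L : {vspace Cub}) : small (\dim L) (fun f => f \in L).
Proof.
exists [:: [ffun a : T => \sum_(i < \dim L) (t3 (vbasis L)`_i a)%:MP * 'X_i]] => f fL.
eexists; first exact: mem_head.
exists (fun i => coord (vbasis L) i f) => a; rewrite ffunE meval_sum.
rewrite {1}(coord_vbasis fL) -[LHS]/(t3at a _) linear_sum; apply: eq_bigr => i _.
by rewrite mevalM mevalC mevalXU linearZ /= mulrC.
Qed.

Definition evals (ts : seq T) f : 'rV[K]_(size ts) := \row_i t3 f (tnth (in_tuple ts) i).

Lemma evals_linear ts : linear (evals ts).
Proof.
move=> c f g; apply/rowP => i; rewrite !mxE.
exact: (linearP (t3at (tnth (in_tuple ts) i))).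
Qed.

HB.instance Definition _ ts := GRing.isLinear.Build K Cub 'rV[K]_(size ts) _ (evals ts) (evals_linear ts).

(** Coefficients at distinct monomials are independent linear forms, the cubics [monom] being dual
    to them. The bound on [size ts] is recorded because the dimension is a truncated subtraction. *)
Lemma small_base (ts : seq T) : pairwise (fun t t' => ~~ perm_eq (tl t) (tl t')) ts ->
  (size ts <= N)%N /\ small (N - size ts) (fun f => forall t, t \in ts -> t3 f t = 0).
Proof.
move=> /(pairwiseP ((ord0, ord0), ord0)) pw.
have delta (i j : 'I_(size ts)) : perm_eq (tl (tnth (in_tuple ts) i)) (tl (tnth (in_tuple ts) j)) = (i == j).
  rewrite !(tnth_nth ((ord0, ord0), ord0)) /=.
  case: (ltngtP i j) => [ij|ji|/val_inj->]; last by rewrite eqxx perm_refl.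
    rewrite (negPf (pw _ _ _ _ ij)) ?inE //; apply/esym/negbTE.
    by apply: contraTneq ij => ->; rewrite ltnn.
  rewrite perm_sym (negPf (pw _ _ _ _ ji)) ?inE //; apply/esym/negbTE.
  by apply: contraTneq ji => ->; rewrite ltnn.
pose phi := linfun (evals ts).
have img : limg phi = fullv.
  apply/eqP; rewrite eqEsubv subvf; apply/subvP => r _.
  have -> : r = phi (\sum_i r ord0 i *: monom (tl (tnth (in_tuple ts) i))).
    rewrite lfunE; apply/rowP => j; rewrite mxE -[RHS]/(t3at _ _) linear_sum (bigD1 j) //=.
    rewrite linearZ /= {1}/t3at t3_monom perm_refl [_ *: _]mulr1 big1 ?addr0 // => i ij.
    by rewrite linearZ /= /t3at t3_monom delta eq_sym (negPf ij) [_ *: _]mulr0.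
  by apply: memv_img; apply: memvf.
have dq : \dim (fullv : {vspace 'rV[K]_(size ts)}) = size ts by rewrite dimvf dim_matrix mul1r.
have := limg_ker_dim phi fullv; rewrite img capfv dq => dimE.
split; first by rewrite -dimE leq_addl.
have -> : (N - size ts = \dim (lker phi))%N by rewrite -dimE addnK.
apply: small_sub (small_vspace (lker phi)) => f H.
rewrite memv_ker lfunE; apply/eqP/rowP => i; rewrite !mxE; apply: H.
exact: mem_tnth.
Qed.

End Base.

(** * Singular cubics and cubics with a degenerate triple line *)

Section Bad.
Variable K : numClosedFieldType.
Local Notation V := 'rV[K]_6.
Local Notation Cub := (dhomog 6 K 3).
Local Notation T := ('I_6 * 'I_6 * 'I_6)%type.
Local Notation N := (\dim {: Cub}).
Implicit Types (f : Cub) (v : 'I_6 -> V).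

Local Notation o0 := (@Ordinal 6 0 isT).
Local Notation o1 := (@Ordinal 6 1 isT).
Local Notation o2 := (@Ordinal 6 2 isT).
Local Notation o3 := (@Ordinal 6 3 isT).
Local Notation o4 := (@Ordinal 6 4 isT).
Local Notation o5 := (@Ordinal 6 5 isT).

Definition singular f : Prop := exists2 u : V, u != 0 & forall w, tri f u u w = 0.

Definition has_plane f : Prop := exists u : 'I_3 -> V,
  (forall c : 'I_3 -> K, \sum_i c i *: u i = 0 -> forall i, c i = 0) /\
  forall a b c, tri f (u a) (u b) (u c) = 0.

(* The conditions under which the differentials of the nine equations satisfied
   by a frame of a triple line become dependent, after normalising the frame. *)
Definition triple_degenerate f (v0 v1 v2 : V) : Prop :=
  [/\ [/\ tri f v0 v0 v0 = 0, tri f v0 v0 v1 = 0, tri f v0 v1 v1 = 0 & tri f v1 v1 v1 = 0],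
      tri f v0 v0 v2 = 0 /\ tri f v1 v1 v2 = 0, tri f v0 v2 v2 = 0 /\ tri f v1 v2 v2 = 0 &
      exists a b, forall w, [/\ tri f w v0 v1 = 0, tri f w v1 v2 = a * tri f w v0 v0 &
        tri f w v0 v2 = b * tri f w v1 v1]].

Definition has_degenerate_triple f : Prop := exists v0 v1 v2 : V,
  (forall a b c, a *: v0 + b *: v1 + c *: v2 = 0 -> [/\ a = 0, b = 0 & c = 0]) /\
  triple_degenerate f v0 v1 v2.

Lemma reduced_delta k v (i : 'I_6) : reduced k v -> (i < k)%N ->
  exists2 x, x != 0 & v i = x *: delta_mx ord0 i.
Proof.
move=> rv ik; have [x0 xj] := rv i ik; exists (v i ord0 i) => //.
apply/rowP => j; rewrite !mxE eqxx /=; have [->|ji] := eqVneq j i; first by rewrite mulr1.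
by rewrite mulr0; apply: xj.
Qed.

Lemma tri_deltaE f a b c : tri f (delta_mx ord0 a) (delta_mx ord0 b) (delta_mx ord0 c) = t3 f (a, b, c).
Proof. exact: tri_delta. Qed.

Lemma t3Z c f a : t3 (c *: f) a = c * t3 f a.
Proof. exact: (scalarZ (t3at a) c f). Qed.

Lemma t3B f g a : t3 (f - g) a = t3 f a - t3 g a.
Proof. exact: (linearB (t3at a) f g). Qed.

Lemma t3_sum (I : Type) (s : seq I) (P : pred I) (F : I -> Cub) a :
  t3 (\sum_(i <- s | P i) F i) a = \sum_(i <- s | P i) t3 (F i) a.
Proof. exact: (linear_sum (t3at a)). Qed.

Lemma mul2_eq0 (c d r : K) : c != 0 -> d != 0 -> c * (d * r) = 0 -> r = 0.
Proof. by move=> /negPf c0 /negPf d0 /eqP; rewrite !mulf_eq0 c0 d0 /= => /eqP. Qed.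

(** Once the singular point is the first basis vector, the six coefficients of X0^2 Xj vanish;
    moving it there costs five parameters. *)
Lemma small_singular : (6 <= N)%N /\ small (N - 6 + 5) singular.
Proof.
pose ts : seq T := [:: (o0, o0, o0); (o0, o0, o1); (o0, o0, o2); (o0, o0, o3); (o0, o0, o4); (o0, o0, o5)].
have [N6 sb] := @small_base K ts isT; split=> //.
pose B f v := forall w, tri f (v o0) (v o0) w = 0.
have BG f (G : 'M[K]_6) v : G \in unitmx -> B f v -> B (actc G f) (fun i => v i *m invmx G).
  by move=> uG Bv w; rewrite tri_actc !mulmxKV.
have := @stage_reduce K 1 B BG (N - 6) isT; rewrite muln1 => H.
apply: small_sub (H _) => [f [u u0 uw]|].
  exists (fun=> u); split=> // c; rewrite (bigD1 o0) //= big1 ?addr0; last first.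
    by move=> i /andP[i1 i0]; case/eqP: i0; apply: val_inj; case: i i1 => -[].
  move=> /eqP; rewrite scaler_eq0 (negPf u0) orbF => /eqP c0 i i1.
  by have -> : i = o0 by apply: val_inj; case: i i1 => -[].
apply: small_sub sb => f [v [Bv _ rv]] t.
have [x x0 vx] := reduced_delta (i := o0) rv isT.
have z j : t3 f (o0, o0, j) = 0.
  have := Bv (delta_mx ord0 j); rewrite vx !triE tri_deltaE.
  exact: mul2_eq0.
by rewrite !inE => /or3P[/eqP->|/eqP->|/or4P[]/eqP->].
Qed.

Local Notation J := [:: o3; o4; o5].

(** The coefficients killed in the normal form: eight by the conditions on values at the frame, four
    of the form (0, 1, j) with j at least 2, and six of the forms (1, 2, j) and (0, 2, j) with j at
    least 3. *)
Let ts3 : seq T := [:: (o0, o0, o0); (o0, o0, o1); (o0, o1, o1); (o1, o1, o1);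
  (o0, o0, o2); (o1, o1, o2); (o0, o2, o2); (o1, o2, o2);
  (o0, o1, o2); (o0, o1, o3); (o0, o1, o4); (o0, o1, o5);
  (o1, o2, o3); (o1, o2, o4); (o1, o2, o5); (o0, o2, o3); (o0, o2, o4); (o0, o2, o5)].

(** The correction removes the coefficients at (1, 2, j) and (0, 2, j) that the frame prescribes
    through al and be. Only the j in [J] need it: for j at most 2 both sides of the prescription
    vanish already. *)
Lemma triple_twist (X : T -> K) al be :
  X (o0, o0, o0) = 0 -> X (o0, o0, o1) = 0 -> X (o0, o1, o1) = 0 -> X (o1, o1, o1) = 0 ->
  X (o0, o0, o2) = 0 -> X (o1, o1, o2) = 0 -> X (o0, o2, o2) = 0 -> X (o1, o2, o2) = 0 ->
  (forall j, X (o0, o1, j) = 0) -> (forall j, X (o1, o2, j) = al * X (j, o0, o0)) ->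
  (forall j, X (o0, o2, j) = be * X (j, o1, o1)) -> forall t, t \in ts3 ->
  X t - \sum_(j <- J) al * X (j, o0, o0) * (perm_eq (tl t) [:: o1; o2; j])%:R
   - \sum_(j <- J) be * X (j, o1, o1) * (perm_eq (tl t) [:: o0; o2; j])%:R = 0.
Proof.
move=> h1 h2 h3 h4 h5 h6 h7 h8 g01 g12 g02.
have zero t : all (fun j => ~~ perm_eq (tl t) [:: o1; o2; j] && ~~ perm_eq (tl t) [:: o0; o2; j]) J ->
    X t = 0 -> X t - \sum_(j <- J) al * X (j, o0, o0) * (perm_eq (tl t) [:: o1; o2; j])%:R
   - \sum_(j <- J) be * X (j, o1, o1) * (perm_eq (tl t) [:: o0; o2; j])%:R = 0.
  move=> /allP H ->; rewrite !big_seq !big1 ?subr0 // => j /H /andP[/negPf n1 /negPf n2].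
    by rewrite n2 mulr0.
  by rewrite n1 mulr0.
have one t i : X t = al * X (i, o0, o0) -> all (fun j => (perm_eq (tl t) [:: o1; o2; j] == (j == i))
    && ~~ perm_eq (tl t) [:: o0; o2; j]) J -> i \in J ->
    X t - \sum_(j <- J) al * X (j, o0, o0) * (perm_eq (tl t) [:: o1; o2; j])%:R
   - \sum_(j <- J) be * X (j, o1, o1) * (perm_eq (tl t) [:: o0; o2; j])%:R = 0.
  move=> -> /allP H iJ; rewrite [X in _ - X](_ : _ = 0) ?subr0; last first.
    by rewrite big_seq big1 // => j /H /andP[_ /negPf ->]; rewrite mulr0.
  rewrite (bigD1_seq i) //= (eqP (proj1 (andP (H i iJ)))) eqxx mulr1 big_seq_cond big1 ?addr0 ?subrr //.
  by move=> j /andP[jJ ji]; rewrite (eqP (proj1 (andP (H j jJ)))) (negPf ji) mulr0.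
have two t i : X t = be * X (i, o1, o1) -> all (fun j => (perm_eq (tl t) [:: o0; o2; j] == (j == i))
    && ~~ perm_eq (tl t) [:: o1; o2; j]) J -> i \in J ->
    X t - \sum_(j <- J) al * X (j, o0, o0) * (perm_eq (tl t) [:: o1; o2; j])%:R
   - \sum_(j <- J) be * X (j, o1, o1) * (perm_eq (tl t) [:: o0; o2; j])%:R = 0.
  move=> -> /allP H iJ; rewrite [X in _ - X - _](_ : _ = 0) ?subr0; last first.
    by rewrite big_seq big1 // => j /H /andP[_ /negPf ->]; rewrite mulr0.
  rewrite (bigD1_seq i) //= (eqP (proj1 (andP (H i iJ)))) eqxx mulr1 big_seq_cond big1 ?addr0 ?subrr //.
  by move=> j /andP[jJ ji]; rewrite (eqP (proj1 (andP (H j jJ)))) (negPf ji) mulr0.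
move=> t; rewrite !in_cons in_nil orbF.
do ![case/orP|move/eqP->]; try by apply: zero; rewrite ?g01.
- by apply: (one _ o3).
- by apply: (one _ o4).
- by apply: (one _ o5).
- by apply: (two _ o3).
- by apply: (two _ o4).
- by apply: (two _ o5).
Qed.

(** The conditions are linear in f only for fixed scalars. So f is written as the twist, with
    parameters al and be, of a cubic with 18 vanishing coefficients; three vectors cost 15
    parameters, and 17 < 18. *)
Lemma small_triple : (18 <= N)%N /\ small (N - 18 + 2 + 15) has_degenerate_triple.
Proof.
have [N18 sb] := @small_base K ts3 isT; split=> //.
pose B f v := triple_degenerate f (v o0) (v o1) (v o2).
have BG f (G : 'M[K]_6) v : G \in unitmx -> B f v -> B (actc G f) (fun i => v i *m invmx G).
  move=> uG [[h1 h2 h3 h4] [h5 h6] [h7 h8] [a [b h]]].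
  rewrite /B /triple_degenerate !tri_actc !mulmxKV //; split=> //.
  by exists a, b => w; rewrite !tri_actc !mulmxKV.
have := @stage_reduce K 3 B BG (N - 18 + 2) isT => H.
apply: small_sub (H _) => [f [v0 [v1 [v2 [iv tv]]]]|].
  exists (fun i => nth 0 [:: v0; v1; v2] i); split=> // c.
  rewrite big_mkcond !big_ord_recl big_ord0 /= !addr0 addrA => /iv[z0 z1 z2].
  case=> -[|[|[|//]]] p _; [rewrite -[RHS]z0|rewrite -[RHS]z1|rewrite -[RHS]z2];
    by congr (c _); apply: val_inj.
pose P (a b : T) : {mpoly K[2]} := (a == b)%:R%:MP +
  'X_ord0 * (\sum_(j <- J) (perm_eq (tl a) [:: o1; o2; j] && (b == (j, o0, o0)))%:R)%:MP +
  'X_(lift ord0 ord0) * (\sum_(j <- J) (perm_eq (tl a) [:: o0; o2; j] && (b == (j, o1, o1)))%:R)%:MP.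
apply: small_sub (small_op P sb) => f [v [[[h1 h2 h3 h4] [h5 h6] [h7 h8] [a [b h]]] _ rv]].
have [x x0 vx] := reduced_delta (i := o0) rv isT.
have [y y0 vy] := reduced_delta (i := o1) rv isT.
have [z z0 vz] := reduced_delta (i := o2) rv isT.
have d3 i j l : tri f (delta_mx ord0 i) (delta_mx ord0 j) (delta_mx ord0 l) = t3 f (i, j, l).
  exact: tri_deltaE.
move: h1 h2 h3 h4 h5 h6 h7 h8; rewrite vx vy vz !triE !d3 => h1 h2 h3 h4 h5 h6 h7 h8.
have n0 (c d e r : K) : c != 0 -> d != 0 -> e != 0 -> c * (d * (e * r)) = 0 -> r = 0.
  by move=> /negPf c0 /negPf d0 /negPf e0 /eqP; rewrite !mulf_eq0 c0 d0 e0 /= => /eqP.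
have {}h1 := n0 _ _ _ _ x0 x0 x0 h1. have {}h2 := n0 _ _ _ _ x0 x0 y0 h2.
have {}h3 := n0 _ _ _ _ x0 y0 y0 h3. have {}h4 := n0 _ _ _ _ y0 y0 y0 h4.
have {}h5 := n0 _ _ _ _ x0 x0 z0 h5. have {}h6 := n0 _ _ _ _ y0 y0 z0 h6.
have {}h7 := n0 _ _ _ _ x0 z0 z0 h7. have {}h8 := n0 _ _ _ _ y0 z0 z0 h8.
(* The scalars a and b rescaled from the vectors x e0, y e1, z e2 to the basis vectors
   themselves. *)
pose al := a * x ^+ 2 / (y * z); pose be := b * y ^+ 2 / (x * z).
have sw i j l : t3 f (l, i, j) = t3 f (i, j, l) by rewrite /t3 /= tens3C12 tens3C23.
have sw2 i j l : t3 f (i, l, j) = t3 f (i, j, l) by rewrite /t3 /= tens3C23.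
have g01 j : t3 f (o0, o1, j) = 0.
  have [E _ _] := h (delta_mx ord0 j); move: E; rewrite vx vy !triE d3 (sw o0 o1 j).
  exact: mul2_eq0.
have g12 j : t3 f (o1, o2, j) = al * t3 f (j, o0, o0).
  have [_ E _] := h (delta_mx ord0 j); move: E; rewrite vx vy vz !triE !d3 (sw o1 o2 j) => E.
  apply: (mulfI y0); apply: (mulfI z0); rewrite mulrCA E /al; field.
  by rewrite y0 z0.
have g02 j : t3 f (o0, o2, j) = be * t3 f (j, o1, o1).
  have [_ _ E] := h (delta_mx ord0 j); move: E; rewrite vx vy vz !triE !d3 (sw o0 o2 j) => E.
  apply: (mulfI x0); apply: (mulfI z0); rewrite mulrCA E /be; field.
  by rewrite x0 z0.
(* The untwisted cubic. It has the same coefficients as f at (j, 0, 0) and (j, 1, 1) for j in [J],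
   so the twist [P] recovers f from it. *)
pose f0 : Cub := f - \sum_(j <- J) (al * t3 f (j, o0, o0)) *: monom K [:: o1; o2; j]
  - \sum_(j <- J) (be * t3 f (j, o1, o1)) *: monom K [:: o0; o2; j].
have f0E t : t3 f0 t = t3 f t - \sum_(j <- J) al * t3 f (j, o0, o0) * (perm_eq (tl t) [:: o1; o2; j])%:R
   - \sum_(j <- J) be * t3 f (j, o1, o1) * (perm_eq (tl t) [:: o0; o2; j])%:R.
  rewrite /f0 !t3B !t3_sum; congr (_ - _ - _); by apply: eq_bigr => j _; rewrite t3Z t3_monom.
exists f0; split.
  by move=> t tts; rewrite f0E; apply: triple_twist tts.
exists (fun i => if i == ord0 then al else be) => t.
have pick (X : T -> K) c : \sum_b X b * (b == c)%:R = X c.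
  by rewrite (bigD1 c) //= eqxx mulr1 big1 ?addr0 // => d /negPf->; rewrite mulr0.
have PE b' : (P t b').@[fun i => if i == ord0 then al else be] = (b' == t)%:R
  + \sum_(j <- J) (al * (perm_eq (tl t) [:: o1; o2; j])%:R * (b' == (j, o0, o0))%:R)
  + \sum_(j <- J) (be * (perm_eq (tl t) [:: o0; o2; j])%:R * (b' == (j, o1, o1))%:R).
  rewrite /P !mevalD !mevalM !mevalC !mevalXU eqxx /= eq_sym !mulr_sumr; congr (_ + _ + _);
    by apply: eq_bigr => j _; rewrite -mulrA -natrM mulnb.
under eq_bigr => b' _ do rewrite PE !mulrDr !mulr_sumr.
rewrite !big_split /= pick.
have S (X : T -> K) (c : 'I_6 -> K) (g : 'I_6 -> T) :
    \sum_b' \sum_(j <- J) X b' * (c j * (b' == g j)%:R) = \sum_(j <- J) c j * X (g j).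
  rewrite exchange_big; apply: eq_bigr => j _ /=.
  rewrite -(pick X) mulr_sumr; apply: eq_bigr => b' _; ring.
rewrite (S _ _ (fun j => (j, o0, o0))) (S _ _ (fun j => (j, o1, o1))).
have f0Z t' : all (fun j => ~~ perm_eq (tl t') [:: o1; o2; j] && ~~ perm_eq (tl t') [:: o0; o2; j]) J ->
    t3 f0 t' = t3 f t'.
  move=> /allP HJ; rewrite f0E !big_seq !big1 ?subr0 // => j /HJ /andP[/negPf n1 /negPf n2].
    by rewrite n2 mulr0.
  by rewrite n1 mulr0.
have fJ0 j : j \in J -> t3 f0 (j, o0, o0) = t3 f (j, o0, o0).
  by rewrite !inE => /or3P[] /eqP->; apply: f0Z.
have fJ1 j : j \in J -> t3 f0 (j, o1, o1) = t3 f (j, o1, o1).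
  by rewrite !inE => /or3P[] /eqP->; apply: f0Z.
rewrite [X in _ + X + _](eq_big_seq (fun j => al * t3 f (j, o0, o0) * (perm_eq (tl t) [:: o1; o2;
    j])%:R)); last first.
  by move=> j /fJ0->; ring.
rewrite [X in _ + _ + X](eq_big_seq (fun j => be * t3 f (j, o1, o1) * (perm_eq (tl t) [:: o0; o2;
    j])%:R)); last first.
  by move=> j /fJ1->; ring.
by rewrite f0E; ring.
Qed.

End Bad.

(** * Cubics containing a plane *)

Section Plane.
Variable K : numClosedFieldType.
Local Notation V := 'rV[K]_6.
Local Notation Cub := (dhomog 6 K 3).
Local Notation T := ('I_6 * 'I_6 * 'I_6)%type.
Local Notation N := (\dim {: Cub}).
Implicit Types (f : Cub).

(** Only the plane matters and not a basis of it. Starting from a basis in echelon form on the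
    columns [p] leaves nine entries to clear, whereas moving three independent vectors would cost 15
    parameters against ten conditions. *)
Definition normal_plane (p : 'I_3 -> 'I_6) (J : seq ('I_3 * 'I_6)) f : Prop :=
  exists w : 'I_3 -> V, [/\ forall a b c, tri f (w a) (w b) (w c) = 0,
    forall a b, w a ord0 (p b) = (a == b)%:R & forall aj, aj \in J -> w aj.1 ord0 aj.2 = 0].

Lemma normal_plane_step m p J a j : (forall b, p b != j) ->
  small m (normal_plane p ((a, j) :: J)) -> small m.+1 (normal_plane p J).
Proof.
move=> pj /(small_shear (pj a)); apply: small_sub => f [w [fw wp wJ]].
exists (w a ord0 j), (fun b => w b *m invmx (shear (p a) j (w a ord0 j))).
have uG := shear_unit (w a ord0 j) (pj a).
have E b l : (w b *m invmx (shear (p a) j (w a ord0 j))) ord0 l =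
    w b ord0 l - w a ord0 j * (b == a)%:R * (j == l)%:R.
  by rewrite invmx_shear // mul_shear !mulNr wp.
split=> [b c d|b c|[b l]].
- by rewrite tri_actc !mulmxKV.
- by rewrite E wp eq_sym [j == _]eq_sym (negPf (pj c)) mulr0 subr0 eq_sym.
- rewrite inE => /orP[/eqP[-> ->]|blJ]; rewrite /= E ?eqxx ?mulr1 ?subrr //.
  have := wJ _ blJ => /= bl; rewrite bl.
  have [ba|_] := eqVneq b a; last by rewrite mulr0 mul0r subr0.
  by have [jl|_] := eqVneq j l; rewrite ?mulr0 ?subr0 // -ba jl bl !mul0r subr0.
Qed.

Lemma normal_plane_steps m p (s J : seq ('I_3 * 'I_6)) : (forall b aj, aj \in s -> p b != aj.2) ->
  small m (normal_plane p (s ++ J)) -> small (m + size s) (normal_plane p J).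
Proof.
elim: s J m => [|[a j] s IH] J m ps; first by rewrite addn0.
move=> sm; rewrite /= -addSnnS; apply: IH => [b aj ajs|].
  by apply: ps; rewrite inE ajs orbT.
by apply: normal_plane_step sm => b; apply: (ps b (a, j)); rewrite mem_head.
Qed.

(** Ten is the number of cubic monomials in three variables and nine the dimension of the
    Grassmannian of planes; the pivot columns take finitely many values. *)
Lemma small_plane : (10 <= N)%N /\ small (N - 10 + 9) (@has_plane K).
Proof.
pose i0 := @Ordinal 3 0 isT; pose i1 := @Ordinal 3 1 isT; pose i2 := @Ordinal 3 2 isT.
pose us : seq (seq 'I_3) := [:: [:: i0; i0; i0]; [:: i0; i0; i1]; [:: i0; i0; i2]; [:: i0; i1; i1];
  [:: i0; i1; i2]; [:: i0; i2; i2]; [:: i1; i1; i1]; [:: i1; i1; i2]; [:: i1; i2; i2]; [:: i2; i2; i2]].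
pose tr (p : 'I_3 -> 'I_6) (s : seq 'I_3) : T := (p (nth i0 s 0), p (nth i0 s 1), p (nth i0 s 2)).
have base (p : 'I_3 -> 'I_6) : injective p -> (10 <= N)%N /\
    small (N - 10) (fun f => forall t, t \in map (tr p) us -> t3 f t = 0).
  move=> ip; apply: (@small_base K (map (tr p) us)); rewrite pairwise_map.
  have tlE s : size s = 3 -> tl (tr p s) = map p s by case: s => [|x [|y [|z []]]].
  have : pairwise (fun s s' => [&& size s == 3, size s' == 3 & ~~ perm_eq s s']) us by [].
  apply: sub_pairwise => s s' /and3P[/eqP s3 /eqP s3' ns]; rewrite /= !tlE //.
  by apply: contra ns; apply: perm_map_inj.
have [N10 _] : (10 <= N)%N /\ small (N - 10) (fun f => forall t, t \in map (tr (lshift 3)) us -> t3 f t = 0).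
  by apply: base; apply: lshift_inj.
split=> //.
suff H (p : {ffun 'I_3 -> 'I_6}) : small (N - 10 + 9) (fun f => injectiveb p /\ normal_plane p [::] f).
  apply: small_sub (small_bigU H) => f [u [iu fu]].
  pose M : 'M[K]_(3, 6) := \matrix_(i, j) u i ord0 j.
  have fM : row_free M.
    apply: inj_row_free => r rM; apply/rowP => i; rewrite mxE; apply: (iu (r ord0)).
    apply/rowP => j; rewrite summxE; have /rowP/(_ j) := rM; rewrite !mxE => {2}<-.
    by apply: eq_bigr => a _; rewrite !mxE.
  have fMT : row_full M^T by rewrite /row_full mxrank_tr.
  have uC := fullrowsub_unit fMT; set C := rowsub _ _ in uC.
  exists (fullrankfun fMT); split; first by apply/injectiveP; apply: fullrankfun_inj.
  pose D := invmx C; pose w i := \sum_l D l i *: u l.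
  have wE i j : w i ord0 j = (M^T *m D) j i.
    by rewrite /w summxE mxE; apply: eq_bigr => l _; rewrite !mxE mulrC.
  exists w; split=> //.
  - have lin (x y : V) : (forall l, tri f (u l) x y = 0) -> forall i, tri f (w i) x y = 0.
      move=> H0 i; rewrite /w; elim/big_ind: _ => [|z z' hz hz'|l _]; first exact: tri0.
        by rewrite triD1 hz hz' addr0.
      by rewrite triZ1 H0 mulr0.
    move=> a b c; apply: (lin) => l; rewrite triC12; apply: (lin) => l'; rewrite triC23 triC12; apply:
        (lin) => l''.
    exact: fu.
  - move=> a b; rewrite wE.
    have /matrixP/(_ b a) := mulmxV uC; rewrite [RHS]mxE eq_sym => <-.
    by rewrite !mxE; apply: eq_bigr => l _; rewrite !mxE.
have [ip|nip] := boolP (injectiveb p); last first.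
  by exists [::] => f [].
have pI := injectiveP _ ip; have [_ sb] := base p pI.
pose js := enum (predC (mem (codom p))).
have sjs : size js = 3.
  by have := cardC (mem (codom p)); rewrite card_codom // !card_ord -cardE => /(@addnI 3 _ 3).
pose s := [seq (a, j) | a <- enum 'I_3, j <- js].
have ss : size s = 9 by rewrite size_allpairs sjs size_enum_ord.
have ps b aj : aj \in s -> p b != aj.2.
  move=> /allpairsP[[a j] /= [_]]; rewrite mem_enum => nj ->.
  by apply: contraNneq nj => /= <-; apply: codom_f.
have := @normal_plane_steps (N - 10) p s [::] ps; rewrite ss cats0 => H.
apply: small_sub (H _) => [f [] //|].
apply: small_sub sb => f [w [fw wp wJ]] t /mapP[q _ ->].
have wE a : w a = delta_mx ord0 (p a).
  apply/rowP => j; rewrite !mxE eqxx /=.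
  have [/codomP[b ->]|nj] := boolP (j \in codom p).
    by rewrite -[LHS]/(w a ord0 (p b)) wp (inj_eq pI) eq_sym.
  rewrite -[LHS]/(w a ord0 (a, j).2) (wJ (a, j)).
    by case: eqP nj => // ->; rewrite codom_f.
  by apply/allpairsP; exists (a, j); rewrite /= !mem_enum.
by rewrite -tri_deltaE -!wE.
Qed.

End Plane.

Section GrBasis.
Variables (K : fieldType) (V : vectType K) (k : nat).
Local Notation G := (Gr V k).
Local Notation I := (plucker_index V k).

Lemma gr_nbhs_basis (W : G) (P : set G) : nbhs W P -> exists d (Q : {mpoly K[#|I|]}),
  [/\ Q \is d.-homog, Q.@[plucker W] != 0 & forall W', Q.@[plucker W'] != 0 -> P W'].
Proof.
pose F : set_system G := [set P | exists d (Q : {mpoly K[#|I|]}),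
  [/\ Q \is d.-homog, Q.@[plucker W] != 0 & forall W', Q.@[plucker W'] != 0 -> P W']].
have FF : Filter F.
  split.
  - by exists 0%N, 1; split=> //; [exact: dhomog1|rewrite meval1 oner_neq0].
  - move=> P1 P2 [d [Q [hQ QW QP]]] [d' [Q' [hQ' QW' QP']]]; exists (d + d')%N, (Q * Q').
    split; [exact: dhomogM|by rewrite mevalM mulf_neq0|].
    by move=> W'; rewrite mevalM mulf_eq0 negb_or => /andP[/QP ? /QP'].
  - by move=> P1 P2 P12 [d [Q [hQ QW QP]]]; exists d, Q; split=> // W' /QP/P12.
apply: (@subbase_filter (grass V k) _ (@gr_openE K V k) F W FF) => _ [d [Q [hQ ->]]] QW.
by exists d, Q.
Qed.

End GrBasis.

(** * The dense open set of good cubics *)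

Section OpenDense.
Variable K : numClosedFieldType.
Hypothesis Kunc : uncountable_field K.
Local Notation Cub := (dhomog 6 K 3).
Local Notation T := ('I_6 * 'I_6 * 'I_6)%type.
Local Notation N := (\dim {: Cub}).
Local Notation I := (plucker_index Cub 1).
Implicit Types (f : Cub) (S : Cub -> Prop).

Definition coords f (s : 'I_#|I|) : K := coord (vbasis {: Cub}) ((enum_val s : I) ord0) f.

Lemma plucker_coords (W : cubics K) f : f \in vsp W -> f != 0 ->
  exists2 c, c != 0 & forall s, plucker W s = c * coords f s.
Proof.
move=> fW f0; have [|c c0 cP] := @plucker_span K Cub 1 W (fun=> f).
  apply: vspan_eq => //; apply/vspan_dim => c; rewrite big_ord1 => /eqP.
  by rewrite scaler_eq0 (negPf f0) orbF => /eqP + i; rewrite (ord1 i).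
exists c => // s; rewrite cP /minor det_mx11 !mxE; congr (_ * coord _ _ _).
Qed.

(** On the line through x, Q is a polynomial in the scalar c, with the values of the homogeneous
    components as coefficients; the roots 1, 2, 3, ... are too many. *)
Lemma homog_components_vanish n (Q : {mpoly K[n]}) (x : 'I_n -> K) :
  (forall c, c != 0 -> Q.@[fun i => c * x i] = 0) ->
  forall d, (pihomog mdeg d Q).@[x] = 0.
Proof.
move=> van d.
pose P : {poly K} := \poly_(e < msize Q) (pihomog mdeg e Q).@[x].
have EP c : P.[c] = Q.@[fun i => c * x i].
  rewrite horner_poly [in RHS](pihomog_partitionE (leqnn (msize Q))) meval_sum; apply: eq_bigr => e _.
  by rewrite (dhomog_meval _ _ (pihomogP _ _ _)) mulrC.
have P0 : P = 0.
  apply/eqP; apply: contrapT => /negP P0.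
  have := @max_poly_roots _ P [seq i.+1%:R | i <- iota 0 (size P)] P0.
  rewrite size_map size_iota ltnn => H; suff : false by []; apply: H.
    apply/allP => _ /mapP[i _ ->]; rewrite rootE EP; apply/eqP/van.
    by rewrite pnatr_eq0.
  rewrite map_inj_uniq ?iota_uniq // => i j /eqP; rewrite eqr_nat => /eqP[].
  done.
have [lt|le] := ltnP d (msize Q).
  by have := congr1 (fun p : {poly K} => p`_d) P0; rewrite coef_poly lt coef0.
suff -> : pihomog mdeg d Q = 0 by rewrite meval0.
rewrite pihomogE big_seq_cond big1 // => m /andP[mQ /eqP md].
by have := msize_mdeg_lt mQ; rewrite md ltnNge le.
Qed.

(** Elimination gives an equation for each covering map. Their product need not be homogeneous, but
    stability of S under scalars makes each homogeneous component vanish on S, and a nonzero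
    component makes sense on lines of cubics. *)
Lemma small_equation m S : small m S -> (m < N)%N -> (forall c f, c != 0 -> S f -> S (c *: f)) ->
  exists d (Q : {mpoly K[#|I|]}), [/\ Q \is d.-homog, Q != 0 &
    forall (W : cubics K) f, f \in vsp W -> f != 0 -> S f -> Q.@[plucker W] = 0].
Proof.
move=> [L HL] mN Sc.
have cardI : #|I| = N by rewrite card_ffun !card_ord expn1.
pose X3 (b : T) : Cub := cub (fun x y z => ((x, y, z) == b)%:R).
have expand f : f = \sum_(b : T) t3 f b *: X3 b.
  apply: val_inj; rewrite [LHS]cubic_expand.
  have vs (F : T -> Cub) : val (\sum_b F b) = \sum_b val (F b).
    by rewrite (big_morph (fun f : Cub => val f) (id1 := 0) (op1 := +%R)).
  rewrite vs.
  have -> : \sum_a \sum_b \sum_c (tens3 f a b c)%:MP * ('X_a * 'X_b * 'X_c) =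
     \sum_(b : T) (t3 f b)%:MP * ('X_b.1.1 * 'X_b.1.2 * 'X_b.2) :> {mpoly K[6]}.
    by rewrite -(pair_bigA _ (fun (c : 'I_6 * 'I_6) d => (tens3 f c.1 c.2 d)%:MP * ('X_c.1 * 'X_c.2 *
        'X_d))) /=
      -(pair_bigA _ (fun c c' => \sum_d (tens3 f c c' d)%:MP * ('X_c * 'X_c' * 'X_d))).
  apply: eq_bigr => -[[x y] z] _; rewrite mul_mpolyC; congr (_ *: _); rewrite /= .
  rewrite (bigD1 x) //= (bigD1 y) //= (bigD1 z) //= eqxx mpolyC1 mul1r.
  rewrite big1 ?addr0 => [|z' /negPf zz]; last by rewrite !xpair_eqE zz !andbF mpolyC0 mul0r.
  rewrite big1 ?addr0 => [|y' /negPf yy]; last first.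
    by rewrite big1 // => z' _; rewrite !xpair_eqE yy !andbF /= mpolyC0 mul0r.
  rewrite big1 ?addr0 // => x' /negPf xx; rewrite big1 // => y' _; rewrite big1 // => z' _.
  by rewrite !xpair_eqE xx mpolyC0 mul0r.
pose Phi (p : {ffun T -> {mpoly K[m]}}) (s : 'I_#|I|) : {mpoly K[m]} :=
  \sum_b p b * (coords (X3 b) s)%:MP.
have mI : (m < #|I|)%N by rewrite cardI.
have /choice[q qP] p := polynomial_image_equation (Phi p) mI.
pose Q := \prod_(p <- L) q p.
have Q0 : Q != 0 by rewrite prodf_seq_neq0; apply/allP => p _; case: (qP p).
have QS f : S f -> Q.@[coords f] = 0.
  move=> /HL[p pL [y fp]]; rewrite /Q rmorph_prod; apply/eqP; rewrite prodf_seq_eq0.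
  apply/hasP; exists p => //=; have [_ /(_ y) E] := qP p; apply/eqP; rewrite -[RHS]E.
  apply: meval_eq => s; rewrite meval_sum {1}(expand f) /coords linear_sum; apply: eq_bigr => b _.
  by rewrite linearZ /= fp mevalM mevalC.
have [d Qd] : exists d, pihomog mdeg d Q != 0.
  apply: contrapT => no; case/eqP: Q0; rewrite (pihomog_partitionE (leqnn (msize Q))) big1 // => d _.
  by apply/eqP; apply: contrapT => Qd; apply: no; exists d; apply/negP.
exists d, (pihomog mdeg d Q); split=> //; first exact: pihomogP.
move=> W f fW f0 Sf; have [c c0 cP] := plucker_coords fW f0.
rewrite (meval_eq _ cP) (dhomog_meval _ _ (pihomogP _ _ _)) homog_components_vanish ?mulr0 //.
move=> x x0; rewrite -[RHS](QS _ (Sc x f x0 Sf)); apply: meval_eq => s.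
by rewrite /coords linearZ.
Qed.

Lemma tri_scale c f u v w : tri (c *: f) u v w = c * tri f u v w.
Proof. by rewrite !tri_sum mulr_sumr; apply: eq_bigr => b _; rewrite t3Z; ring. Qed.

Definition good_cubic f : Prop :=
  [/\ ~ singular f, ~ has_plane f & ~ has_degenerate_triple f].

Lemma generic_good_cubic : exists U : set (cubics K), [/\ open U, dense U &
  forall (D : cubics K) f, U D -> f \in vsp D -> f != 0 -> good_cubic f].
Proof.
have [N6 s1] := small_singular K; have [N10 s2] := small_plane K; have [N18 s3] := small_triple K.
have aux a b n : (a <= n)%N -> (b < a)%N -> (n - a + b < n)%N.
  by move=> an ba; rewrite -ltn_subRL subKn.
have [||d1 [Q1 [hQ1 Q10 Q1S]]] := small_equation s1.
- exact: aux.
- move=> c f c0 [u u0 fu]; exists u => // w; by rewrite tri_scale fu mulr0.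
have [||d2 [Q2 [hQ2 Q20 Q2S]]] := small_equation s2.
- exact: aux.
- by move=> c f c0 [u [iu fu]]; exists u; split=> // x y z; rewrite tri_scale fu mulr0.
have [||d3 [Q3 [hQ3 Q30 Q3S]]] := small_equation s3.
- by rewrite -addnA; apply: aux.
- move=> c f c0 [v0 [v1 [v2 [iv [[h1 h2 h3 h4] [h5 h6] [h7 h8] [a [b h]]]]]]].
  exists v0, v1, v2; split=> //.
  split; rewrite ?tri_scale ?h1 ?h2 ?h3 ?h4 ?h5 ?h6 ?h7 ?h8 ?mulr0 //.
  exists a, b => w; have [E1 E2 E3] := h w; rewrite !tri_scale E1 E2 E3.
  by split; rewrite ?mulr0 // mulrCA.
pose Q := Q1 * Q2 * Q3; have hQ : Q \is (d1 + d2 + d3).-homog by do !apply: dhomogM.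
have Q0 : Q != 0 by rewrite !mulf_neq0.
exists [set W : cubics K | Q.@[plucker W] != 0]; split.
- by rewrite openE => W; apply: gr_near_neq0 hQ.
- move=> O [W0 OW0] oO.
  have [d [P [hP PW0 PO]]] := gr_nbhs_basis (open_nbhs_nbhs (conj oO OW0)).
  have P0 : P != 0 by apply: contraNneq PW0 => ->; rewrite meval0.
  have [s _] := plucker_neq0 W0.
  have X0 : 'X_s != 0 :> {mpoly K[#|I|]}.
    by rewrite -mleadc_eq0 mleadXm mcoeffX eqxx oner_eq0.
  (* The factor ['X_s] ensures that x is the coordinate vector of a nonzero cubic. *)
  have [x] := mpoly_neq0_point Kunc (mulf_neq0 (mulf_neq0 P0 Q0) X0).
  rewrite (mevalM _ (P * Q)) (mevalM _ P) mevalXU !mulf_eq0 !negb_or => /andP[/andP[Px Qx] xs].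
  pose idx j : 'I_#|I| := enum_rank ([ffun=> j] : I).
  pose f : Cub := \sum_j x (idx j) *: (vbasis {: Cub})`_j.
  have cf t : coords f t = x t.
    rewrite /coords coord_sum_free ?(basis_free (vbasisP _)) //; congr (x _).
    rewrite -[RHS]enum_valK; congr enum_rank; apply/ffunP => i; by rewrite ffunE (ord1 i).
  have f0 : f != 0 by apply: contraNneq xs => f0; rewrite -cf f0 /coords linear0.
  have fd : \dim <[f]>%VS == 1%N by rewrite dim_vline f0.
  pose W : cubics K := exist (fun U : {vspace Cub} => \dim U == 1%N) _ fd.
  have [c c0 cW] := @plucker_coords W f (memv_line f) f0.
  have ev d' (R : {mpoly K[#|I|]}) : R \is d'.-homog -> R.@[x] != 0 -> R.@[plucker W] != 0.
    move=> hR Rx; rewrite (meval_eq _ cW) (dhomog_meval _ _ hR) mulf_neq0 ?expf_neq0 //.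
    by rewrite (meval_eq _ cf).
  by exists W; split; [apply: PO; apply: ev hP Px|apply: ev hQ Qx].
- move=> D f; rewrite /= !mevalM !mulf_eq0 !negb_or => /andP[/andP[n1 n2] n3] fD f0; split=> B.
  + by move/eqP: n1; apply; apply: Q1S B.
  + by move/eqP: n2; apply; apply: Q2S B.
  + by move/eqP: n3; apply; apply: Q3S B.
Qed.

End OpenDense.

(** * Differentials of the equations of a flag *)

Section Triple.
Variable K : numClosedFieldType.
Local Notation V := 'rV[K]_6.
Variable f : dhomog 6 K 3.
Local Notation t := (tri f).
Implicit Types (p q u v w : V).

Definition free2 p q := forall a b, a *: p + b *: q = 0 -> a = 0 /\ b = 0.
Definition free3 p q u := forall a b c, a *: p + b *: q + c *: u = 0 -> [/\ a = 0, b = 0 & c = 0].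

Hypothesis nsing : ~ singular f.

Lemma nonsingular_comb p q a b : free2 p q -> (a != 0) || (b != 0) ->
  ~ (forall w, a ^+ 2 * t w p p + 2%:R * a * b * t w p q + b ^+ 2 * t w q q = 0).
Proof.
move=> fr ab0 H; apply: nsing; exists (a *: p + b *: q).
  by apply/eqP => /fr[a0 b0]; move: ab0; rewrite a0 b0 eqxx.
move=> w; rewrite -[RHS](H w) !triE !(triC23 f _ _ w) !(triC12 f _ w) (triC23 f w q p); ring.
Qed.

(** The relations come from the derivatives of a binary cubic with last coefficient 0. If c2 were
    nonzero, T(., p, q) and T(., q, q) would be multiples of T(., p, p), and a root of a quadratic
    equation would give a singular point on the line. *)
Lemma two_relations p q c0 c1 c2 : free2 p q ->
  (forall w, c1 * t w p p + 2%:R * c2 * t w p q = 0) ->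
  (forall w, 3%:R * c0 * t w p p + 2%:R * c1 * t w p q + c2 * t w q q = 0) ->
  [/\ c0 = 0, c1 = 0 & c2 = 0].
Proof.
move=> fr R1 R2; have n2 : 2%:R != 0 :> K by rewrite pnatr_eq0.
have n3 : 3%:R != 0 :> K by rewrite pnatr_eq0.
have pp : ~ forall w, t w p p = 0.
  move=> H; apply: (nonsingular_comb (a := 1) (b := 0) fr); first by rewrite oner_eq0.
  by move=> w; rewrite H; ring.
have c20 : c2 = 0.
  apply/eqP; apply: contrapT => /negP c2n.
  pose k := - c1 / (2%:R * c2); pose k' := - (3%:R * c0 + 2%:R * c1 * k) / c2.
  have Epq w : t w p q = k * t w p p.
    apply: (mulfI (mulf_neq0 n2 c2n)); have := R1 w; move/eqP; rewrite addrC addr_eq0 => /eqP->.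
    by rewrite /k; field; rewrite ?n2 ?c2n.
  have Eqq w : t w q q = k' * t w p p.
    apply: (mulfI c2n); have := R2 w; move/eqP; rewrite addrC addr_eq0 => /eqP->.
    by rewrite Epq /k'; field; rewrite ?c2n.
  pose s := sqrtC (k ^+ 2 - k'); have s2 : s ^+ 2 = k ^+ 2 - k' by apply: sqrtCK.
  apply: (nonsingular_comb (a := - k + s) (b := 1) fr); first by rewrite oner_eq0 orbT.
  move=> w; rewrite Epq Eqq.
  transitivity ((s ^+ 2 - (k ^+ 2 - k')) * t w p p); first by ring.
  by rewrite s2 subrr mul0r.
have c10 : c1 = 0.
  apply/eqP; apply: contrapT => /negP c1n; apply: pp => w; have := R1 w.
  by rewrite c20 mulr0 mul0r addr0 => /eqP; rewrite mulf_eq0 (negPf c1n) /= => /eqP.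
have c00 : c0 = 0.
  apply/eqP; apply: contrapT => /negP c0n; apply: pp => w; have := R2 w.
  rewrite c20 c10 mulr0 !mul0r !addr0 => /eqP.
  by rewrite mulf_eq0 mulf_eq0 (negPf n3) (negPf c0n) /= => /eqP.
by [].
Qed.

Hypothesis ndeg : ~ has_degenerate_triple f.

(* The relations expressing that a linear form with coefficients [a], [b] on
   cubic forms annihilates the variations of the first-order data along the
   line; they are the derivatives of a binary cubic and a binary quadric. *)
Definition rel0 p q u (a0 a1 a2 b0 b1 : K) := forall w,
  3%:R * a0 * t w p p + 2%:R * a1 * t w p q + a2 * t w q q + 2%:R * b0 * t w p u + b1 * t w q u = 0.
Definition rel1 p q u (a1 a2 a3 b1 b2 : K) := forall w,
  a1 * t w p p + 2%:R * a2 * t w p q + 3%:R * a3 * t w q q + b1 * t w p u + 2%:R * b2 * t w q u = 0.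
Definition rel2 p q (b0 b1 b2 : K) := forall w,
  b0 * t w p p + b1 * t w p q + b2 * t w q q = 0.

Definition triple_zero p q u :=
  [/\ [/\ t p p p = 0, t p p q = 0, t p q q = 0 & t q q q = 0],
      [/\ t p p u = 0, t p q u = 0 & t q q u = 0] & t p u u = 0 /\ t q u u = 0].

(** The case of a binary quadric b1 x y. Then T(., p, q) = 0, and adding (a1/b1) p + (a2/b1) q to u
    removes the term in T(., p, p) from T(., p, u) and the term in T(., q, q) from T(., q, u): this
    is a degenerate triple. *)
Lemma triple_rel_normal p q u a0 a1 a2 a3 b1 : free3 p q u -> triple_zero p q u ->
  rel0 p q u a0 a1 a2 0 b1 -> rel1 p q u a1 a2 a3 b1 0 -> rel2 p q 0 b1 0 -> b1 = 0.
Proof.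
move=> fr [[h1 h2 h3 h4] [h5 h5' h6] [h7 h8]] R0 R1 R2; apply/eqP; apply: contrapT => /negP b10.
have Epq w : t w p q = 0.
  by have := R2 w; rewrite !mul0r add0r addr0 => /eqP; rewrite mulf_eq0 (negPf b10) /= => /eqP.
have s (x y z : V) := triC12 f x y z.
apply: ndeg; exists p, q, (u + (a1 / b1) *: p + (a2 / b1) *: q); split.
  move=> a b c; rewrite !scalerDr !scalerA => E.
  have [|e1 e2 e3] := fr (a + c * (a1 / b1)) (b + c * (a2 / b1)) c.
    by rewrite -[RHS]E; apply/rowP => j; rewrite !mxE; ring.
  by move: e1 e2; rewrite e3 !mul0r !addr0.
have tpqp : t p q p = 0 by rewrite triC23.
have tqpp : t q p p = 0 by rewrite triC12.
have tqpq : t q p q = 0 by rewrite triC12.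
have tqqp : t q q p = 0 by rewrite triC23.
have tqpu : t q p u = 0 by rewrite triC12.
have tpup : t p u p = 0 by rewrite triC23.
have tpuq : t p u q = 0 by rewrite triC23.
have tqup : t q u p = 0 by rewrite triC23.
have tquq : t q u q = 0 by rewrite triC23.
have z := (h1, h2, h3, h4, h5, h5', h6, h7, h8, tpqp, tqpp, tqpq, tqqp, tqpu, tpup, tpuq, tqup, tquq).
split; [by rewrite !z|by split; rewrite !triE !z; ring|by split; rewrite !triE !z; ring|].
exists (- (3%:R * a0 / b1)), (- (3%:R * a3 / b1)) => w; split=> //.
- have := R0 w; rewrite Epq !mulr0 !mul0r !addr0 => E0.
  rewrite !triE (triC23 f w q p) Epq mulr0 addr0.
  have -> : t w q u = - (3%:R * a0 * t w p p + a2 * t w q q) / b1.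
    by apply: (mulfI b10); rewrite mulrCA divff // mulr1; apply/eqP; rewrite -addr_eq0 addrC E0.
  by field.
- have := R1 w; rewrite Epq !mulr0 !mul0r !addr0 => E0.
  rewrite !triE Epq mulr0 addr0.
  have -> : t w p u = - (a1 * t w p p + 3%:R * a3 * t w q q) / b1.
    by apply: (mulfI b10); rewrite mulrCA divff // mulr1; apply/eqP; rewrite -addr_eq0 addrC E0.
  by field.
Qed.

(** The discriminant of the quadric b decides. If it vanishes and b does not, b is a square up to a
    factor and exhibits a singular point; if it is nonzero, the basis given by the roots of b leads
    to [triple_rel_normal]. Once b = 0, a root of the cubic a reduces to [two_relations]. *)
Lemma triple_relations p q u a0 a1 a2 a3 b0 b1 b2 : free3 p q u -> triple_zero p q u ->
  rel0 p q u a0 a1 a2 b0 b1 -> rel1 p q u a1 a2 a3 b1 b2 -> rel2 p q b0 b1 b2 ->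
  [/\ b0 = 0, b1 = 0 & b2 = 0] /\ [/\ a0 = 0, a1 = 0, a2 = 0 & a3 = 0].
Proof.
move=> fr tz R0 R1 R2.
have fr2 : free2 p q.
  by move=> a b E; have [|-> -> _] := fr a b 0; rewrite ?scale0r ?addr0.
have n2 : 2%:R != 0 :> K by rewrite pnatr_eq0.
have n4 : 4%:R != 0 :> K by rewrite pnatr_eq0.
have b_zero : [/\ b0 = 0, b1 = 0 & b2 = 0].
  pose disc := b1 ^+ 2 - 4%:R * b0 * b2.
  have [d0|dn] := eqVneq disc 0.
    have b00 : b0 = 0.
      apply/eqP; apply: contrapT => /negP b0n.
      apply: (nonsingular_comb (a := 2%:R * b0) (b := b1) fr2); first by rewrite mulf_neq0.
      move=> w; have E : b1 ^+ 2 = 4%:R * b0 * b2 by apply/eqP; rewrite -subr_eq0 -/disc d0.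
      rewrite E; transitivity (4%:R * b0 * (b0 * t w p p + b1 * t w p q + b2 * t w q q)); first by ring.
      by rewrite R2 mulr0.
    have b10 : b1 = 0.
      by apply/eqP; move: d0; rewrite /disc b00 mulr0 mul0r subr0 => /eqP; rewrite sqrf_eq0.
    have b20 : b2 = 0.
      apply/eqP; apply: contrapT => /negP b2n.
      apply: (nonsingular_comb (a := 0) (b := 1) fr2); first by rewrite oner_eq0 orbT.
      move=> w; have := R2 w; rewrite b00 b10 !mul0r !add0r => /eqP.
      by rewrite mulf_eq0 (negPf b2n) /= => /eqP->; ring.
    by [].
  exfalso.
  (* The pairs (al, ga) and (be, de) are the two roots of b. *)
  have [al [be [ga [de [dt r1 r2]]]]] : exists al be ga de : K, [/\ al * de - be * ga != 0,
      b0 * al ^+ 2 + b1 * al * ga + b2 * ga ^+ 2 = 0 &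
      b0 * be ^+ 2 + b1 * be * de + b2 * de ^+ 2 = 0].
    have [b00|b0n] := eqVneq b0 0.
      exists 1, (- b2), 0, b1; rewrite mul1r mulr0 subr0; split.
      + by apply: contra_neq dn => b10; rewrite /disc b00 b10; ring.
      + by rewrite b00; ring.
      + by rewrite b00; ring.
    pose s := sqrtC disc; have s2 : s ^+ 2 = disc by apply: sqrtCK.
    have sn : s != 0 by rewrite -sqrf_eq0 s2.
    exists (- b1 + s), (- b1 - s), (2%:R * b0), (2%:R * b0); split.
    + have -> : (- b1 + s) * (2%:R * b0) - (- b1 - s) * (2%:R * b0) = 4%:R * b0 * s by ring.
      by rewrite !mulf_neq0.
    + transitivity (b0 * (s ^+ 2 - disc)); first by rewrite /disc; ring.
      by rewrite s2 subrr mulr0.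
    + transitivity (b0 * (s ^+ 2 - disc)); first by rewrite /disc; ring.
      by rewrite s2 subrr mulr0.
  pose d := al * de - be * ga.
  pose p' := d^-1 *: (de *: p - be *: q); pose q' := d^-1 *: (al *: q - ga *: p).
  have ep : p = al *: p' + be *: q'.
    apply/rowP => j; rewrite /p' /q' /d !mxE; field; exact: dt.
  have eq_ : q = ga *: p' + de *: q'.
    apply/rowP => j; rewrite /p' /q' /d !mxE; field; exact: dt.
  have fr' : free3 p' q' u.
    move=> x y z E.
    have [|e1 e2 e3] := fr ((x * de - y * ga) / d) ((y * al - x * be) / d) z.
      rewrite -[RHS]E; apply/rowP => j; rewrite /p' /q' /d !mxE; field; exact: dt.
    have e1' : x * de - y * ga = 0 by apply: (mulIf (invr_neq0 dt)); rewrite mul0r.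
    have e2' : y * al - x * be = 0 by apply: (mulIf (invr_neq0 dt)); rewrite mul0r.
    split=> //; apply: (mulIf dt); rewrite mul0r /d.
      by transitivity ((x * de - y * ga) * al + (y * al - x * be) * ga); [ring|rewrite e1' e2'; ring].
    by transitivity ((x * de - y * ga) * be + (y * al - x * be) * de); [ring|rewrite e1' e2'; ring].
  have tz' : triple_zero p' q' u.
    have [[h1 h2 h3 h4] [h5 h5' h6] [h7 h8]] := tz.
    have tpqp : t p q p = 0 by rewrite triC23.
    have tqpp : t q p p = 0 by rewrite triC12.
    have tqpq : t q p q = 0 by rewrite triC12.
    have tqqp : t q q p = 0 by rewrite triC23.
    have tqpu : t q p u = 0 by rewrite triC12.
    have z := (h1, h2, h3, h4, h5, h5', h6, h7, h8, tpqp, tqpp, tqpq, tqqp, tqpu).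
    have N (x y z' : V) : t (- x) y z' = - t x y z' by rewrite -scaleN1r triZ1 mulN1r.
    have N2 (x y z' : V) : t x (- y) z' = - t x y z' by rewrite -scaleN1r triZ2 mulN1r.
    have N3 (x y z' : V) : t x y (- z') = - t x y z' by rewrite -scaleN1r triZ3 mulN1r.
    by rewrite /p' /q'; split; split; rewrite !(triE, N, N2, N3) !z; ring.
  clearbody p' q'.
  (* The middle coefficient of b after the substitution x = al X + be Y, y = ga X + de Y; the outer
     ones vanish, so its square is the discriminant times the squared determinant. Likewise A0 to A3
     are the new coefficients of a. *)
  pose b1' := 2%:R * b0 * al * be + b1 * (al * de + be * ga) + 2%:R * b2 * ga * de.
  have b1n : b1' != 0.
    rewrite -sqrf_eq0.
    have -> : b1' ^+ 2 = d ^+ 2 * disc.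
      transitivity (d ^+ 2 * disc + 4%:R * (b0 * al ^+ 2 + b1 * al * ga + b2 * ga ^+ 2) *
        (b0 * be ^+ 2 + b1 * be * de + b2 * de ^+ 2)); first by rewrite /b1' /d /disc; ring.
      by rewrite r1 mulr0 mul0r addr0.
    by rewrite mulf_neq0 // expf_neq0.
  move/eqP: b1n; apply.
  pose A0 := a0 * al ^+ 3 + a1 * al ^+ 2 * ga + a2 * al * ga ^+ 2 + a3 * ga ^+ 3.
  pose A1 := 3%:R * a0 * al ^+ 2 * be + a1 * (al ^+ 2 * de + 2%:R * al * be * ga)
     + a2 * (be * ga ^+ 2 + 2%:R * al * ga * de) + 3%:R * a3 * ga ^+ 2 * de.
  pose A2 := 3%:R * a0 * al * be ^+ 2 + a1 * (be ^+ 2 * ga + 2%:R * al * be * de)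
     + a2 * (al * de ^+ 2 + 2%:R * be * ga * de) + 3%:R * a3 * ga * de ^+ 2.
  pose A3 := a0 * be ^+ 3 + a1 * be ^+ 2 * de + a2 * be * de ^+ 2 + a3 * de ^+ 3.
  have b0' : 2%:R * (b0 * al ^+ 2 + b1 * al * ga + b2 * ga ^+ 2) = 0 by rewrite r1 mulr0.
  have b2' : 2%:R * (b0 * be ^+ 2 + b1 * be * de + b2 * de ^+ 2) = 0 by rewrite r2 mulr0.
  have E0 w := R0 w; have E1 w := R1 w; have E2 w := R2 w.
  apply: (@triple_rel_normal p' q' u A0 A1 A2 A3 b1' fr' tz') => w.
  - transitivity (al * (3%:R * a0 * t w p p + 2%:R * a1 * t w p q + a2 * t w q q + 2%:R * b0 * t w p u +
      b1 * t w q u)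
     + ga * (a1 * t w p p + 2%:R * a2 * t w p q + 3%:R * a3 * t w q q + b1 * t w p u + 2%:R * b2 * t w q u)
     - 2%:R * (b0 * al ^+ 2 + b1 * al * ga + b2 * ga ^+ 2) * t w p' u).
      rewrite ep eq_ !triE (triC23 f w q' p') /A0 /A1 /A2 /b1'; ring.
    by rewrite R0 R1 b0' !mulr0 mul0r subr0 addr0.
  - transitivity (be * (3%:R * a0 * t w p p + 2%:R * a1 * t w p q + a2 * t w q q + 2%:R * b0 * t w p u +
      b1 * t w q u)
     + de * (a1 * t w p p + 2%:R * a2 * t w p q + 3%:R * a3 * t w q q + b1 * t w p u + 2%:R * b2 * t w q u)
     - 2%:R * (b0 * be ^+ 2 + b1 * be * de + b2 * de ^+ 2) * t w q' u).
      rewrite ep eq_ !triE (triC23 f w q' p') /A1 /A2 /A3 /b1'; ring.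
    by rewrite R0 R1 b2' !mulr0 mul0r subr0 addr0.
  - transitivity (b0 * t w p p + b1 * t w p q + b2 * t w q q
     - (b0 * al ^+ 2 + b1 * al * ga + b2 * ga ^+ 2) * t w p' p'
     - (b0 * be ^+ 2 + b1 * be * de + b2 * de ^+ 2) * t w q' q').
      rewrite ep eq_ !triE (triC23 f w q' p') /b1'; ring.
    by rewrite R2 r1 r2 !mul0r !subr0.
split=> //; have [b00 b10 b20] := b_zero.
have {}R0 w : 3%:R * a0 * t w p p + 2%:R * a1 * t w p q + a2 * t w q q = 0.
  by have := R0 w; rewrite b00 b10 !(mulr0, mul0r, addr0).
have {}R1 w : a1 * t w p p + 2%:R * a2 * t w p q + 3%:R * a3 * t w q q = 0.
  by have := R1 w; rewrite b10 b20 !(mulr0, mul0r, addr0).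
have fr2' : free2 q p by move=> a b; rewrite addrC => /fr2[-> ->].
have [a00|a0n] := eqVneq a0 0.
  have [||-> -> ->] := @two_relations q p a3 a2 a1 fr2'; last by [].
  - by move=> w; have := R0 w; rewrite a00 mulr0 mul0r add0r (triC23 f w q p) addrC.
  - move=> w; have := R1 w; rewrite (triC23 f w q p) => E; rewrite -[RHS]E; ring.
exfalso.
have [be rbe] : exists be, a0 * be ^+ 3 + a1 * be ^+ 2 + a2 * be + a3 = 0.
  pose P : {poly K} := a0 *: 'X^3 + a1 *: 'X^2 + a2 *: 'X + a3%:P.
  have sP : size P != 1.
    have : P`_3 != 0.
      by rewrite /P !coefD !coefZ !coefXn coefX coefC /= !(mulr0, mulr1, addr0).
    by apply: contraNneq => s1; rewrite nth_default // s1.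
  have /closed_rootP[x /rootP rx] := sP; exists x; rewrite -[RHS]rx /P.
  by rewrite !hornerE.
(* In the basis p', q the cubic a loses its last coefficient, because (be, 1) is a root. *)
pose p' := p - be *: q.
have ep : p = p' + be *: q by rewrite subrK.
have fr' : free2 p' q.
  move=> x y; rewrite /p' scalerBr scalerA -addrA -scaleNr -scalerDl => /fr2[x0].
  by rewrite x0 mul0r oppr0 add0r.
clearbody p'.
have [||z _ _] := @two_relations p' q a0 (3%:R * a0 * be + a1) (3%:R * a0 * be ^+ 2 + 2%:R * a1 * be +
    a2) fr'.
- move=> w; transitivity (be * (3%:R * a0 * t w p p + 2%:R * a1 * t w p q + a2 * t w q q)
    + (a1 * t w p p + 2%:R * a2 * t w p q + 3%:R * a3 * t w q q)
    - 3%:R * (a0 * be ^+ 3 + a1 * be ^+ 2 + a2 * be + a3) * t w q q).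
    rewrite ep !triE (triC23 f w q p'); ring.
  by rewrite R0 R1 rbe !mulr0 mul0r addr0 subr0.
- move=> w; transitivity (3%:R * a0 * t w p p + 2%:R * a1 * t w p q + a2 * t w q q); last exact: R0.
  rewrite ep !triE (triC23 f w q p'); ring.
by move: a0n; rewrite z eqxx.
Qed.

End Triple.

(** * The equations of flags as polynomials on the space of frames *)

Section FramePolynomials.
Variable K : numClosedFieldType.
Local Notation V := 'rV[K]_6.
Variable f : dhomog 6 K 3.
Local Notation t := (tri f).
Local Notation n := (3 * 6)%N.
Local Notation i0 := (@Ordinal 3 0 isT).
Local Notation i1 := (@Ordinal 3 1 isT).
Local Notation i2 := (@Ordinal 3 2 isT).
Local Notation I3 := ('I_3 * 'I_3 * 'I_3)%type.

Definition pt (i : 'I_3) (x : 'rV[K]_n) : V := row i (vec_mx x).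

Definition gp (s : I3) : {mpoly K[n]} := \sum_a \sum_b \sum_c (tens3 f a b c)%:MP *
  ('X_(mxvec_index s.1.1 a) * 'X_(mxvec_index s.1.2 b) * 'X_(mxvec_index s.2 c)).

Definition tp (s : I3) (x : 'rV[K]_n) : K := t (pt s.1.1 x) (pt s.1.2 x) (pt s.2 x).

Lemma gpE s (x : 'rV[K]_n) : (gp s).@[x ord0] = tp s x.
Proof.
rewrite /gp meval_sum; apply: eq_bigr => a _; rewrite meval_sum; apply: eq_bigr => b _.
by rewrite meval_sum; apply: eq_bigr => c _; rewrite !mevalM mevalC !mevalXU !mxE.
Qed.

Definition dird m (x w : 'rV[K]_m) (p : {mpoly K[m]}) : K := \sum_l (p^`M(l)).@[x ord0] * w ord0 l.

Lemma dird_sum m (x w : 'rV[K]_m) (I : finType) (F : I -> {mpoly K[m]}) :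
  dird x w (\sum_i F i) = \sum_i dird x w (F i).
Proof.
rewrite /dird exchange_big; apply: eq_bigr => l _ /=.
by rewrite mderiv_sum meval_sum mulr_suml.
Qed.

Lemma dirdM m (x w : 'rV[K]_m) p q :
  dird x w (p * q) = dird x w p * q.@[x ord0] + p.@[x ord0] * dird x w q.
Proof.
rewrite /dird mulr_suml mulr_sumr -big_split; apply: eq_bigr => l _ /=.
by rewrite mderivM mevalD !mevalM; ring.
Qed.

Lemma dirdC m (x w : 'rV[K]_m) c : dird x w c%:MP = 0.
Proof. by rewrite /dird big1 // => l _; rewrite mderivC meval0 mul0r. Qed.

Lemma dirdX m (x w : 'rV[K]_m) i : dird x w 'X_i = w ord0 i.
Proof.
rewrite /dird (bigD1 i) //= mderivXU eqxx meval1 mul1r big1 ?addr0 // => j ji.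
by rewrite mderivXU eq_sym (negPf ji) meval0 mul0r.
Qed.

Lemma gp_deriv s (x w : 'rV[K]_n) : dird x w (gp s) =
  t (pt s.1.1 w) (pt s.1.2 x) (pt s.2 x) + t (pt s.1.1 x) (pt s.1.2 w) (pt s.2 x)
  + t (pt s.1.1 x) (pt s.1.2 x) (pt s.2 w).
Proof.
rewrite dird_sum /tri -!big_split; apply: eq_bigr => a _ /=.
rewrite dird_sum -!big_split; apply: eq_bigr => b _ /=.
rewrite dird_sum -!big_split; apply: eq_bigr => c _ /=.
rewrite !dirdM dirdC !dirdX !mevalM mevalC !mevalXU !mxE; ring.
Qed.

(** The order matters, as [frame_eqs r] takes the first r equations: seven of them describe the
    frames of flags in [Ftilde], the eighth adds the contact condition s_0 = 0, and all nine
    describe [Vtilde]. The default repeats the first equation, so [frame_eqs_zero] holds for every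
    index. *)
Definition frame_monomial (i : nat) : I3 := nth (i0, i0, i0)
  [:: (i0, i0, i0); (i0, i0, i1); (i0, i1, i1); (i1, i1, i1); (i0, i0, i2); (i0, i1, i2); (i1, i1, i2);
      (i0, i2, i2); (i1, i2, i2)] i.

Definition frame_eqs r (i : 'I_r) : {mpoly K[n]} := gp (frame_monomial i).

Definition dirv (i : 'I_3) (w : V) : 'rV[K]_n := mxvec (\matrix_(a < 3, b < 6) (if a == i then w ord0 b
    else 0)).

Lemma pt_dirv i j w : pt j (dirv i w) = if j == i then w else 0.
Proof. by rewrite /pt /dirv mxvecK; apply/rowP => b; rewrite !mxE; case: eqP => // _; rewrite mxE. Qed.

Lemma tri02 u w : t u 0 w = 0. Proof. by rewrite triC12 tri0. Qed.
Lemma tri03 u w : t u w 0 = 0. Proof. by rewrite triC23 tri02. Qed.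

Section At.
Variable x : 'rV[K]_n.
Local Notation v0 := (pt i0 x).
Local Notation v1 := (pt i1 x).
Local Notation v2 := (pt i2 x).
Hypotheses (fr : free3 v0 v1 v2) (tz : triple_zero f v0 v1 v2) (t222 : t v2 v2 v2 != 0).
Hypotheses (nsing : ~ singular f) (ndeg : ~ has_degenerate_triple f).

(** The relation is tested on variations of one vector at a time. At w = v2 every term except the
    one with T(v2, v2, v2) vanishes, so c 7 = c 8 = 0, and what remains are the hypotheses of
    [triple_relations]. *)
Lemma frame_eqs_relations (c : nat -> K) :
  (forall w, \sum_(i < 9) c i * dird x w (frame_eqs i) = 0) -> forall i, (i < 9)%N -> c i = 0.
Proof.
move=> H.
have W0 w : 3%:R * c 0 * t w v0 v0 + 2%:R * c 1 * t w v0 v1 + c 2 * t w v1 v1 + 2%:R * c 4 * t w v0 v2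
   + c 5 * t w v1 v2 + c 7 * t w v2 v2 = 0.
  rewrite -[RHS](H (dirv i0 w)) !big_ord_recl big_ord0 !gp_deriv /= !pt_dirv /= !(tri0, tri02, tri03).
  rewrite !(triC23 f _ _ w) !(triC12 f _ w) ?(triC23 f w v1 v0); ring.
have W1 w : c 1 * t w v0 v0 + 2%:R * c 2 * t w v0 v1 + 3%:R * c 3 * t w v1 v1 + c 5 * t w v0 v2
   + 2%:R * c 6 * t w v1 v2 + c 8 * t w v2 v2 = 0.
  rewrite -[RHS](H (dirv i1 w)) !big_ord_recl big_ord0 !gp_deriv /= !pt_dirv /= !(tri0, tri02, tri03).
  rewrite !(triC23 f _ _ w) !(triC12 f _ w) ?(triC23 f w v1 v0); ring.
have W2 w : c 4 * t w v0 v0 + c 5 * t w v0 v1 + c 6 * t w v1 v1 + 2%:R * c 7 * t w v0 v2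
   + 2%:R * c 8 * t w v1 v2 = 0.
  rewrite -[RHS](H (dirv i2 w)) !big_ord_recl big_ord0 !gp_deriv /= !pt_dirv /= !(tri0, tri02, tri03).
  rewrite !(triC23 f _ _ w) !(triC12 f _ w) ?(triC23 f w v1 v0) ?(triC23 f w v2 v0) ?(triC23 f w v2 v1); ring.
have [[z000 z001 z011 z111] [z002 z012 z112] [z022 z122]] := tz.
have E2 u w : t v2 u w = t u w v2 by rewrite triC12 triC23.
have c7 : c 7 = 0.
  by have /eqP := W0 v2; rewrite !E2 z002 z012 z112 z022 z122 !mulr0 !add0r mulf_eq0 (negPf t222) orbF
      => /eqP.
have c8 : c 8 = 0.
  by have /eqP := W1 v2; rewrite !E2 z002 z012 z112 z022 z122 !mulr0 !add0r mulf_eq0 (negPf t222) orbF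
      => /eqP.
have R0 : rel0 f v0 v1 v2 (c 0) (c 1) (c 2) (c 4) (c 5).
  by move=> w; have := W0 w; rewrite c7 mul0r addr0.
have R1 : rel1 f v0 v1 v2 (c 1) (c 2) (c 3) (c 5) (c 6).
  by move=> w; have := W1 w; rewrite c8 mul0r addr0.
have R2 : rel2 f v0 v1 (c 4) (c 5) (c 6).
  by move=> w; have := W2 w; rewrite c7 c8 !(mulr0, mul0r) !addr0.
have [[b0 b1 b2] [a0 a1 a2 a3]] := triple_relations nsing ndeg fr tz R0 R1 R2.
by case=> [|[|[|[|[|[|[|[|[|]]]]]]]]].
Qed.

Lemma frame_eqs_free r : (r <= 9)%N ->
  row_free (\matrix_(i < r, l < n) ((@frame_eqs r i)^`M(l)).@[x ord0]).
Proof.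
move=> r9; rewrite -kermx_eq0; apply/eqP/row_matrixP => j; rewrite row0.
set k := row j _; have kM : k *m (\matrix_(i < r, l < n) ((@frame_eqs r i)^`M(l)).@[x ord0]) = 0.
  by rewrite /k -row_mul mulmx_ker row0.
clearbody k.
pose c (i : nat) := if insub i is Some i' then k ord0 (i' : 'I_r) else 0.
have cE (i : 'I_r) : c i = k ord0 i by rewrite /c insubT // => lt; congr (k _ _); apply: val_inj.
have H w : \sum_(i < 9) c i * dird x w (frame_eqs i) = 0.
  transitivity (\sum_(i < r) c i * dird x w (gp (frame_monomial i))).
    rewrite (big_ord_widen _ (fun i => c i * dird x w (gp (frame_monomial i))) r9) [LHS](bigID (fun i :
        'I_9 => (i < r)%N)) /=.
    rewrite [X in _ + X]big1 ?addr0 // => i; rewrite -leqNgt => ri.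
    by rewrite /c insubF ?mul0r // ltnNge ri.
  transitivity (\sum_l (k *m (\matrix_(i < r, l < n) ((@frame_eqs r i)^`M(l)).@[x ord0])) ord0 l * w ord0 l).
    under [RHS]eq_bigr => l _ do rewrite mxE mulr_suml.
    rewrite exchange_big /=; apply: eq_bigr => i _; rewrite cE /dird mulr_sumr; apply: eq_bigr => l _.
    by rewrite mxE mulrA.
  by rewrite kM big1 // => l _; rewrite mxE mul0r.
apply/rowP => i; rewrite mxE -cE; apply: (frame_eqs_relations H).
exact: (leq_trans (ltn_ord i) r9).
Qed.

Lemma frame_eqs_zero (i : nat) : (gp (frame_monomial i)).@[x ord0] = 0.
Proof.
have [[z000 z001 z011 z111] [z002 z012 z112] [z022 z122]] := tz.
rewrite gpE /tp; case: (ltnP i 9) => [|i9]; first by case: i => [|[|[|[|[|[|[|[|[|i]]]]]]]]].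
by rewrite /frame_monomial nth_default.
Qed.

(** Differentiating a membership of q times the ninth equation at the common zero x leaves a
    relation among the nine differentials whose last coefficient is - q(x), which is nonzero. *)
Lemma last_eq_not_in_ideal :
  ~ germ_ideal (x ord0) (gen_ideal (@frame_eqs 8)) (gp (i1, i2, i2)).
Proof.
case=> q [qx [d E]].
pose c (i : nat) := if insub i is Some i' then (d (i' : 'I_8)).@[x ord0] else - q.@[x ord0].
have /(_ 8%N isT) : forall i, (i < 9)%N -> c i = 0; last first.
  by rewrite /c insubF // => /eqP; rewrite oppr_eq0 (negPf qx).
apply: frame_eqs_relations => w; rewrite big_ord_recr /= {2}/c insubF //=.
have := congr1 (dird x w) E; rewrite dird_sum dirdM (frame_eqs_zero 8) mulr0 add0r mulNr => ->.
apply/eqP; rewrite subr_eq0; apply/eqP/eq_bigr => i _; rewrite dirdM (frame_eqs_zero i) mulr0 add0r.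
by rewrite /c insubT //= => lt; congr ((d _).@[_] * _); apply: val_inj.
Qed.

End At.
End FramePolynomials.

(** * Moving frames *)

Section Lifts.
Variable K : fieldType.
Implicit Types T S X Y : fspace K.

Lemma aff_nbhs_basis n (x : aff K n) (P : set (aff K n)) : nbhs x P ->
  exists q : {mpoly K[n]}, q.@[(x : 'rV_n) ord0] != 0 /\
    forall z : aff K n, q.@[(z : 'rV_n) ord0] != 0 -> P z.
Proof.
pose F : set_system (aff K n) := [set P | exists q : {mpoly K[n]}, q.@[(x : 'rV_n) ord0] != 0 /\
    forall z : aff K n, q.@[(z : 'rV_n) ord0] != 0 -> P z].
have FF : Filter F.
  split.
  - by exists 1; split=> //; rewrite meval1 oner_neq0.
  - move=> P1 P2 [q [qx qP]] [q' [qx' qP']]; exists (q * q').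
    split; first by rewrite mevalM mulf_neq0.
    by move=> z; rewrite mevalM mulf_eq0 negb_or => /andP[/qP ? /qP'].
  - by move=> P1 P2 P12 [q [qx qP]]; exists q; split=> // z /qP/P12.
apply: (@subbase_filter (zaff K n) _ (@aff_openE K n) F x FF) => _ [q ->] qx.
by exists q.
Qed.

(** A local lift has to be a morphism at all nearby points before it can be compared with the lifts
    chosen there. *)
Definition near_morph T S (g : T -> S) (t : T) : Prop := \forall s \near t, morph_at g s.

Lemma near_morph_at T S (g : T -> S) (t : T) : near_morph g t -> morph_at g t.
Proof. exact: nbhs_singleton. Qed.

Lemma near_morphW T S (g : T -> S) (t : T) : (forall s, morph_at g s) -> near_morph g t.
Proof. by move=> H; apply: near_all. Qed.

Lemma near_morph_fsub T Y (A : set Y) (g : T -> Y) t : near_morph g t ->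
  (\forall s \near t, A (g s)) -> A (g t) ->
  exists k : T -> fsub A, near_morph k t /\ \forall s \near t, set_val (k s) = g s.
Proof.
move=> mg nA At.
pose k s : fsub A := if pselect (A (g s)) is left As then fsub_mk As else fsub_mk At.
have kE : \forall s \near t, set_val (k s) = g s.
  by apply: near_imp nA => s As; rewrite /k; case: pselect => // A'; rewrite fsub_mkK.
exists k; split=> //; apply: near_imp2 mg (near_near kE) => s ms ks.
by apply: morph_fsub; apply: morph_at_eq ms; apply: near_imp ks.
Qed.

Section Frames.
Variables (V : vectType K).
Local Notation e := (vbasis {:V}).

(** A local section of the tautological bundle through u: its coordinates in the frame normalised on
    the columns [s] are kept constant. *)
Lemma vreg_lift k (W : Gr V k) u : u \in vsp W -> exists v : Gr V k -> V,
  [/\ vreg_at v W, v W = u & \forall W' \near W, v W' \in vsp W'].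
Proof.
have [s sW] := plucker_neq0 W; rewrite (frame_proj _ sW) => uE.
exists (fun W' => \sum_i coord e ((enum_val s : plucker_index V k) i) u *: frame s W' i); split.
- apply: vreg_sum => [|i _]; first exact: lr_gr.
  apply: vreg_scale; [exact: lr_gr|apply: lr_cst; exact: lr_gr|exact: vreg_frame].
- by rewrite -uE.
- apply: near_imp (near_plucker sW) => W' sW'.
  by apply: memv_suml => i _; apply: memvZ; apply: frame_mem.
Qed.

Lemma near_free T (lrT : locally_ringed T) k (v : T -> 'I_k -> V) (t : T) :
  (forall i, vreg_at (fun z => v z i) t) -> \dim (vspan (v t)) = k ->
  \forall s \near t, \dim (vspan (v s)) = k.
Proof.
move=> rv d; pose W : Gr V k := exist _ (vspan (v t)) (introT eqP d).
have [s sW] := plucker_neq0 W; have [c c0 cP] := @plucker_span K V k W (v t) erefl.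
have m0 : minor s (rowmx_of (v t)) != 0 by apply: contra_neq sW => m0; rewrite cP m0 mulr0.
apply: near_imp (lr_neq0 lrT (regular_minor s lrT rv) m0) => z mz.
apply/vspan_dim => d' E i.
have ME : (\row_i d' i) *m (\matrix_(i, j) rowmx_of (v z) i ((enum_val s : plucker_index V k) j)) = 0.
  apply/rowP => j; rewrite !mxE.
  transitivity (coord e ((enum_val s : plucker_index V k) j) (\sum_i d' i *: v z i)).
    by rewrite linear_sum; apply: eq_bigr => l _; rewrite !mxE linearZ.
  by rewrite E linear0.
have U : (\matrix_(i, j) rowmx_of (v z) i ((enum_val s : plucker_index V k) j)) \in unitmx.
  by rewrite unitmxE unitfE.
have := congr1 (mulmxr (invmx (\matrix_(i, j) rowmx_of (v z) i ((enum_val s : plucker_index V k) j)))) ME.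
by rewrite /= mulmxK // mul0mx => /rowP/(_ i); rewrite !mxE.
Qed.

Lemma near_morph_gr T (lrT : locally_ringed T) k (v : T -> 'I_k -> V) (t : T) :
  (forall i, vreg_at (fun z => v z i) t) -> \dim (vspan (v t)) = k ->
  exists g : T -> Gr V k, near_morph g t /\ \forall s \near t, vsp (g s) = vspan (v s).
Proof.
move=> rv d; have nd := near_free lrT rv d.
pose W : Gr V k := exist _ (vspan (v t)) (introT eqP d).
pose g s : Gr V k := if pselect (\dim (vspan (v s)) = k) is left ds then
  exist _ (vspan (v s)) (introT eqP ds) else W.
have gE : \forall s \near t, vsp (g s) = vspan (v s).
  by apply: near_imp nd => s ds; rewrite /g; case: pselect.
exists g; split=> //.
have nv : \forall s \near t, forall i, vreg_at (fun z => v z i) s.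
  by apply: near_forall_fin => i; exact: vreg_near.
by apply: near_imp2 nv (near_near gE) => s rs gs; apply: morph_at_gr rs gs.
Qed.

(** Take a section of L through a vector outside P(t) and subtract its projection to P along the
    normalised frame: some coordinate of the difference is nonzero at t, and it vanishes wherever
    the inclusion holds. *)
Lemma closed_vsp_sub T (lrT : locally_ringed T) k l (L : T -> Gr V k) (P : T -> Gr V l) :
  (forall t, morph_at L t) -> (forall t, morph_at P t) ->
  closed [set t | (vsp (L t) <= vsp (P t))%VS].
Proof.
move=> mL mP; apply: closedP => // t /= /negP /subvPn[u uL uP].
have [v [rv vt nv]] := vreg_lift uL; have [s sP] := plucker_neq0 (P t).
pose pr (t' : T) := v (L t') - \sum_i coord e ((enum_val s : plucker_index V l) i) (v (L t')) *: frame s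
    (P t') i.
have rvL : vreg_at (v \o L) t by apply: vreg_comp (mL t) _.
have rpr : vreg_at pr t.
  apply: (vreg_add lrT rvL); apply: (vreg_eq (v := fun t' => (-1) *: \sum_i coord e ((enum_val s :
      plucker_index V l) i) (v (L t')) *: frame s (P t') i)).
    by apply: near_all => t'; rewrite scaleN1r.
  apply: vreg_scale => //; first exact: lr_cst.
  apply: vreg_sum => // i _; apply: vreg_scale => //.
  exact: (vreg_comp (g := P) (v := fun W => frame s W i) (mP t) (vreg_frame i sP)).
have pr0 : pr t != 0.
  by apply: contraNneq uP => /eqP; rewrite subr_eq0 vt => /eqP E; apply/(frame_proj _ sP).
have [j jn] : exists j, coord e j (pr t) != 0.
  apply: contrapT => /forallNP H; move/eqP: pr0; apply.
  rewrite (coord_vbasis (memvf (pr t))) big1 // => j _.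
  by move/negP: (H j); rewrite negbK => /eqP->; rewrite scale0r.
exists (fun t' => coord e j (pr t')); split=> //.
have [cL _] := mL t; have [cP _] := mP t.
apply: near_imp2 (cL _ nv) (cP _ (near_plucker sP)) => t' vL' sP' /= /subvP sub.
by rewrite (_ : pr t' = 0) ?linear0 //; apply/eqP; rewrite subr_eq0; apply/eqP/(frame_proj _ sP')/sub.
Qed.

Lemma closed_vanishing T (lrT : locally_ringed T) k l (L : T -> Gr V k) (P : T -> Gr V l)
    (F : V -> V -> K) : (forall t, morph_at L t) -> (forall t, morph_at P t) ->
  (forall (v w : T -> V) t, vreg_at v t -> vreg_at w t -> regular_at (fun s => F (v s) (w s)) t) ->
  closed [set t | forall v w, v \in vsp (L t) -> w \in vsp (P t) -> F v w = 0].
Proof.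
move=> mL mP rF; apply: closedP => // t /= /existsNP[v0 /existsNP[w0 /not_implyP[v0L /not_implyP[w0P nz]]]].
have [v [rv vt nv]] := vreg_lift v0L; have [w [rw wt nw]] := vreg_lift w0P.
exists (fun s => F (v (L s)) (w (P s))); split.
- by apply: rF; [exact: vreg_comp (mL t) rv|exact: vreg_comp (mP t) rw].
- by rewrite vt wt; apply/eqP.
- have [cL _] := mL t; have [cP _] := mP t.
  by apply: near_imp2 (cL _ nv) (cP _ nw) => s /= vs ws; apply.
Qed.

End Frames.

(* A regular function near [y0] becomes a fraction of polynomials once [Y] is
   covered near [y0] by a closed set [Z] of affine space that has a section [v]. *)
Lemma regular_fraction Y n (Z : set (aff K n)) (th : fsub Z -> Y) (v : Y -> aff K n) (y0 : Y)
    (Z0 : Z (v y0)) (h : Y -> K) :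
  morph_at v y0 -> morph_at th (fsub_mk Z0) ->
  (\forall y \near y0, exists Zy : Z (v y), th (fsub_mk Zy) = y) -> regular_at h y0 ->
  exists P Q : {mpoly K[n]}, [/\ Q.@[(v y0 : 'rV_n) ord0] != 0,
    forall z : fsub Z, Q.@[(set_val z : 'rV_n) ord0] != 0 ->
      h (th z) = P.@[(set_val z : 'rV_n) ord0] / Q.@[(set_val z : 'rV_n) ord0] &
    \forall y \near y0, Q.@[(v y : 'rV_n) ord0] != 0 /\
      h y = P.@[(v y : 'rV_n) ord0] / Q.@[(v y : 'rV_n) ord0]].
Proof.
move=> mv [cth rth] sec rh.
have th0 : th (fsub_mk Z0) = y0.
  by have [Zy thy] := nbhs_singleton sec; rewrite -[RHS]thy; congr th; apply: fsub_inj; rewrite !fsub_mkK.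
have [g [[P [Q [Q0 gE]]] hE]] : regular_at (h \o th) (fsub_mk Z0) by apply: rth; rewrite th0.
rewrite fsub_mkK in Q0 gE.
have [N nN NE] := fsub_nearE hE; rewrite fsub_mkK in nN.
have [q [q0 qP]] := aff_nbhs_basis (filterI gE nN).
(* The factor q confines the fraction to the neighbourhood where it represents h, since the new
   denominator vanishes wherever q does. *)
exists (q * P), (q * Q); split.
- by rewrite mevalM mulf_neq0.
- move=> z; rewrite !mevalM mulf_eq0 negb_or => /andP[qz Qz].
  have [gz Nz] := qP _ qz; have /= -> := NE _ Nz; rewrite gz.
  by rewrite -mulf_div divff ?mul1r.
- have [cv _] := mv.
  have n0 : (q * Q).@[(v y0 : 'rV_n) ord0] != 0 by rewrite mevalM mulf_neq0.
  apply: near_imp2 sec (cv _ (aff_near_neq0 n0)) => y [Zy thy] /= qQ.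
  split=> //; move: qQ; rewrite !mevalM mulf_eq0 negb_or => /andP[qz Qz].
  have [gz Nz] := qP _ qz; have Nz' : N (set_val (fsub_mk Zy)) by rewrite fsub_mkK.
  have := NE _ Nz'; rewrite /= thy => ->.
  by rewrite gz -mulf_div divff ?mul1r.
Qed.

End Lifts.

(** * Tangent planes *)

Section Flags.
Variable K : numClosedFieldType.
Local Notation V := 'rV[K]_6.
Implicit Types p q u w : V.

Definition fam1 p : 'I_1 -> V := fun=> p.
Definition fam2 p q : 'I_2 -> V := fun i => nth 0 [:: p; q] i.
Definition fam3 p q u : 'I_3 -> V := fun i => nth 0 [:: p; q; u] i.

Lemma memv_span1 p w : w \in vspan (fam1 p) <-> exists a, w = a *: p.
Proof.
rewrite memv_vspan; split=> [[c ->]|[a ->]]; first by exists (c ord0); rewrite big_ord1.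
by exists (fun=> a); rewrite big_ord1.
Qed.

Lemma memv_span2 p q w : w \in vspan (fam2 p q) <-> exists a b, w = a *: p + b *: q.
Proof.
rewrite memv_vspan; split=> [[c ->]|[a [b ->]]].
  by exists (c ord0), (c (lift ord0 ord0)); rewrite !big_ord_recl big_ord0 addr0.
by exists (fun i => nth 0 [:: a; b] i); rewrite !big_ord_recl big_ord0 addr0.
Qed.

Lemma memv_span3 p q u w : w \in vspan (fam3 p q u) <-> exists a b c, w = a *: p + b *: q + c *: u.
Proof.
rewrite memv_vspan; split=> [[c ->]|[a [b [c ->]]]].
  exists (c ord0), (c (lift ord0 ord0)), (c (lift ord0 (lift ord0 ord0))).
  by rewrite !big_ord_recl big_ord0 addr0 addrA.
by exists (fun i => nth 0 [:: a; b; c] i); rewrite !big_ord_recl big_ord0 addr0 addrA.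
Qed.

Lemma dim_span1 p : \dim (vspan (fam1 p)) = 1%N <-> p != 0.
Proof.
rewrite vspan_dim; split=> [H|p0 c].
  apply/eqP => p0; have := H (fun=> 1) _ ord0.
  by rewrite big_ord1 /fam1 p0 scaler0 => /(_ erefl)/eqP; rewrite oner_eq0.
by rewrite big_ord1 => /eqP; rewrite scaler_eq0 (negPf p0) orbF => /eqP c0 i; rewrite (ord1 i).
Qed.

Lemma dim_span2 p q : \dim (vspan (fam2 p q)) = 2%N <-> free2 p q.
Proof.
rewrite vspan_dim; split=> [H a b E|H c].
  have /(_ _) I := H (fun i => nth 0 [:: a; b] i).
  have E' : \sum_(i < 2) nth 0 [:: a; b] i *: fam2 p q i = 0 by rewrite !big_ord_recl big_ord0 addr0.
  by have := I E' ord0; have := I E' (lift ord0 ord0).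
rewrite !big_ord_recl big_ord0 addr0 => /H[c0 c1] i.
by case: (unliftP ord0 i) => [j|] -> //; rewrite (ord1 j).
Qed.

Lemma dim_span3 p q u : \dim (vspan (fam3 p q u)) = 3%N <-> free3 p q u.
Proof.
rewrite vspan_dim; split=> [H a b c E|H c].
  have /(_ _) I := H (fun i => nth 0 [:: a; b; c] i).
  have E' : \sum_(i < 3) nth 0 [:: a; b; c] i *: fam3 p q u i = 0.
    by rewrite !big_ord_recl big_ord0 addr0 addrA.
  by have := I E' ord0; have := I E' (lift ord0 ord0); have := I E' (lift ord0 (lift ord0 ord0)).
rewrite !big_ord_recl big_ord0 addr0 addrA => /H[c0 c1 c2] i.
case: (unliftP ord0 i) => [j|] -> //; case: (unliftP ord0 j) => [k|] -> //; by rewrite (ord1 k).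
Qed.

Lemma free3_free2 p q u : free3 p q u -> free2 p q.
Proof. by move=> H a b E; have [] := H a b 0; rewrite ?E ?scale0r ?addr0. Qed.

Lemma span1_eq (X : Gr V 1) p : p != 0 -> p \in vsp X -> vsp X = vspan (fam1 p).
Proof. by move=> /dim_span1 d pX; apply: vspan_eq. Qed.

Lemma exists_frame (L : Gr V 2) (P : Gr V 3) u : (vsp L <= vsp P)%VS -> u \in vsp L -> u != 0 ->
  exists q w, [/\ free3 u q w, vsp L = vspan (fam2 u q) & vsp P = vspan (fam3 u q w)].
Proof.
move=> LP uL u0; have /dim_span1 d1 := u0.
have [q qL qu] : exists2 q, q \in vsp L & q \notin vspan (fam1 u).
  apply/subvPn; apply/negP => /dimvS; rewrite dim_vsp d1; by [].
have f2 : free2 u q.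
  move=> a b E; have b0 : b = 0.
    apply/eqP; apply: contraNT qu => b0; apply/memv_span1; exists (- a / b).
    rewrite mulrC -scalerA scaleNr (_ : - (a *: u) = b *: q) ?scalerA ?mulVf ?scale1r //.
    by apply/eqP; rewrite eq_sym -addr_eq0 addrC E.
  split=> //; move: E; rewrite b0 scale0r addr0 => /eqP; rewrite scaler_eq0 (negPf u0) orbF => /eqP//.
have d2 : \dim (vspan (fam2 u q)) = 2%N by apply/dim_span2.
have EL : vsp L = vspan (fam2 u q).
  by apply: vspan_eq => // -[[|[|]]].
have [w wP wL] : exists2 w, w \in vsp P & w \notin vsp L.
  apply/subvPn; apply/negP => /dimvS; rewrite !dim_vsp; by [].
have f3 : free3 u q w.
  move=> a b c E; have c0 : c = 0.
    apply/eqP; apply: contraNT wL => c0; rewrite EL; apply/memv_span2; exists (- a / c), (- b / c).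
    apply: (scalerI c0); rewrite scalerDr !scalerA ![c * _]mulrC !divfK // !scaleNr -opprD.
    by apply/eqP; rewrite -addr_eq0 addrC E.
  by move: E; rewrite c0 scale0r addr0 => /f2[].
exists q, w; split=> //; apply: vspan_eq; last by apply/dim_span3.
by move=> [[|[|[|i]]] lti] //=; apply: (subvP LP).
Qed.

Lemma dual_frame p q u : free3 p q u -> exists a : 'I_3 -> 'Hom(V, K^o),
  forall x y z, [/\ a (Ordinal (isT : 0 < 3)%N) (x *: p + y *: q + z *: u) = x,
    a (Ordinal (isT : 1 < 3)%N) (x *: p + y *: q + z *: u) = y &
    a (Ordinal (isT : 2 < 3)%N) (x *: p + y *: q + z *: u) = z].
Proof.
move=> /dim_span3; set X := [tuple fam3 p q u i | i < 3] => d.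
have fX : free X by rewrite /free -[span X]/(vspan (fam3 p q u)) d size_tuple.
exists (fun i => linfun (coord X i : V -> K^o)) => x y z.
have E (i : 'I_3) : X`_i = fam3 p q u i by rewrite -tnth_nth tnth_mktuple.
have cE (i j : 'I_3) : coord X i (fam3 p q u j) = (i == j)%:R by rewrite -E coord_free // eq_sym.
have H (i : 'I_3) : coord X i (x *: p + y *: q + z *: u) =
  x * (i == Ordinal (isT : 0 < 3)%N)%:R + y * (i == Ordinal (isT : 1 < 3)%N)%:R + z * (i == Ordinal (isT
      : 2 < 3)%N)%:R.
  by rewrite !linearD !linearZ -!cE.
by split; rewrite lfunE /= H /= !(mulr0, mulr1, addr0, add0r).
Qed.

End Flags.

Section TangentPlanes.
Variable K : numClosedFieldType.
Local Notation V := 'rV[K]_6.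
Variable f : dhomog 6 K 3.
Local Notation t := (tri f).
Implicit Types p q u v w : V.

Local Notation tri_sort p q u := (triC12 f q p, triC12 f u p, triC12 f u q,
  (fun w => triC23 f w q p), (fun w => triC23 f w u p), (fun w => triC23 f w u q)).

Definition tangent_zero p q u :=
  [/\ t p p p = 0, t p p q = 0, t p q q = 0 & t q q q = 0] /\ [/\ t p p u = 0, t p q u = 0 & t q q u = 0].

Lemma tangent_zeroP p q u : tangent_zero p q u <->
  forall v w x, v \in vspan (fam2 p q) -> w \in vspan (fam2 p q) -> x \in vspan (fam3 p q u) -> t v w x = 0.
Proof.
split=> [[[z000 z001 z011 z111] [z002 z012 z112]] v w x|H].
  move=> /memv_span2[a [b ->]] /memv_span2[a' [b' ->]] /memv_span3[c [d [e ->]]].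
  rewrite !triE !(tri_sort p q u) z000 z001 z011 z111 z002 z012 z112; ring.
have p2 : p \in vspan (fam2 p q) by apply/memv_span2; exists 1, 0; rewrite scale1r scale0r addr0.
have q2 : q \in vspan (fam2 p q) by apply/memv_span2; exists 0, 1; rewrite scale1r scale0r add0r.
have p3 : p \in vspan (fam3 p q u) by apply/memv_span3; exists 1, 0, 0; rewrite scale1r !scale0r !addr0.
have q3 : q \in vspan (fam3 p q u) by apply/memv_span3; exists 0, 1, 0; rewrite scale1r !scale0r addr0 add0r.
have u3 : u \in vspan (fam3 p q u) by apply/memv_span3; exists 0, 0, 1; rewrite scale1r !scale0r !add0r.
by split; split; apply: H.
Qed.

Lemma tangent_pairsP (P : vprod (Gr V 2) (Gr V 3)) : tangent_pairs f P <->
  (vsp P.1 <= vsp P.2)%VS /\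
  forall v w x, v \in vsp P.1 -> w \in vsp P.1 -> x \in vsp P.2 -> t v w x = 0.
Proof.
have n2 : 2%:R != 0 :> K by rewrite pnatr_eq0.
have n3 : 3%:R != 0 :> K by rewrite pnatr_eq0.
split=> [[lP sub dd]|[sub H]].
  split=> // v w x vL wL xP; have D y : y \in vsp P.1 -> t y y x = 0.
    by move=> yL; have /eqP := dd _ _ yL xP; rewrite dirder_tri mulf_eq0 (negPf n3) => /eqP.
  have := D _ (memvD vL wL); rewrite !triE (D v) // (D w) // (triC12 f w v) => E.
  by apply: (mulfI n2); rewrite mulr0 -E; ring.
split=> // [v vL|v w vL wP]; first by rewrite evalf_tri H // (subvP sub).
by rewrite dirder_tri H ?mulr0.
Qed.

Lemma tri_line_plane p q u a b x y z : tangent_zero p q u ->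
  let w := x *: p + y *: q + z *: u in
  t (a *: p + b *: q) w w = z ^+ 2 * (a * t p u u + b * t q u u).
Proof.
move=> [[z000 z001 z011 z111] [z002 z012 z112]] /=; rewrite !triE !(tri_sort p q u).
by rewrite z000 z001 z011 z111 z002 z012 z112; ring.
Qed.

(** The cofactor of z^2 is the equation of the residual line; on the line itself it restricts to 3
    (x s_0 + y s_1). *)
Lemma evalf_plane p q u x y z : tangent_zero p q u ->
  evalf f (x *: p + y *: q + z *: u) =
    z ^+ 2 * (3%:R * (x * t p u u + y * t q u u) + z * t u u u).
Proof.
move=> [[z000 z001 z011 z111] [z002 z012 z112]]; rewrite evalf_tri !triE.
by rewrite !(tri_sort p q u) z000 z001 z011 z111 z002 z012 z112; ring.
Qed.

Hypothesis npl : ~ has_plane f.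

Lemma plane_not_contained p q u : free3 p q u -> triple_zero f p q u -> t u u u != 0.
Proof.
move=> fr [[z000 z001 z011 z111] [z002 z012 z112] [z022 z122]]; apply/eqP => z222; apply: npl.
exists (fam3 p q u); split.
  by apply/vspan_dim/dim_span3.
have S x y z : [/\ t x y z = 0, t x z y = 0 & [/\ t y x z = 0, t y z x = 0, t z x y = 0 & t z y x = 0]]
    <-> t x y z = 0.
  split=> [[]//|E]; split=> //; first by rewrite triC23.
  split; [by rewrite triC12|by rewrite triC23 triC12|by rewrite triC12 triC23|].
  by rewrite triC12 triC23 triC12.
have s001 := (S _ _ _).2 z001; have s011 := (S _ _ _).2 z011; have s002 := (S _ _ _).2 z002.
have s012 := (S _ _ _).2 z012; have s112 := (S _ _ _).2 z112; have s022 := (S _ _ _).2 z022.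
have s122 := (S _ _ _).2 z122.
move: s001 s011 s002 s012 s112 s022 s122.
move=> [? ? [? ? ? ?]] [? ? [? ? ? ?]] [? ? [? ? ? ?]] [? ? [? ? ? ?]] [? ? [? ? ? ?]] [? ? [? ? ? ?]]
    [? ? [? ? ? ?]].
by move=> [[|[|[|?]]] ?] [[|[|[|?]]] ?] [[|[|[|?]]] ?].
Qed.

Section Point.
Variable y : Ftilde f.
Local Notation L := (vsp (line_of y)).
Local Notation P := (vsp (plane_of y)).

Lemma line_plane_sub : (L <= P)%VS.
Proof. by have /tangent_pairsP[] := fsub_valP y. Qed.

Lemma tri_line_line v w x : v \in L -> w \in L -> x \in P -> t v w x = 0.
Proof. by have /tangent_pairsP[_] := fsub_valP y; apply. Qed.

Definition adapted p q u := [/\ free3 p q u, L = vspan (fam2 p q) & P = vspan (fam3 p q u)].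

Lemma adapted_tangent p q u : adapted p q u -> tangent_zero p q u.
Proof. by move=> [_ EL EP]; apply/tangent_zeroP => v w x; rewrite -EL -EP; apply: tri_line_line. Qed.

(** Three linear forms that vanish on the line take the same values at u and at u + l for l in L,
    hence so does f, and [evalf_plane] gives s_0 = s_1 = 0. Conversely f restricts to T(u, u, u)
    z^3, whose factor is nonzero because X contains no plane; so all three forms have the right
    kernel. *)
Lemma Vtilde_adapted p q u : adapted p q u ->
  Vtilde f y <-> t p u u = 0 /\ t q u u = 0.
Proof.
move=> ad; have [fr EL EP] := ad; have tz := adapted_tangent ad.
have n3 : 3%:R != 0 :> K by rewrite pnatr_eq0.
split=> [[a1 [a2 [a3 [E k1 k2 k3]]]]|[z022 z122]].
  have H x yy : 3%:R * (x * t p u u + yy * t q u u) = 0.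
    have vL : x *: p + yy *: q \in L by rewrite EL; apply/memv_span2; exists x, yy.
    have uP : u \in P by rewrite EP; apply/memv_span3; exists 0, 0, 1; rewrite !scale0r scale1r !add0r.
    have wP : x *: p + yy *: q + u \in P by rewrite memvD // (subvP line_plane_sub).
    have K1 (a : 'Hom(V, K^o)) : L = (P :&: lker a)%VS -> a (x *: p + yy *: q + u) = a u.
      move=> k; rewrite linearD /=; have : x *: p + yy *: q \in (P :&: lker a)%VS by rewrite -k.
      by rewrite memv_cap memv_ker => /andP[_ /eqP->]; rewrite add0r.
    have := E _ wP; rewrite (K1 a1) // (K1 a2) // (K1 a3) // -E //.
    rewrite -[u in X in X = _ -> _]scale1r evalf_plane // evalf_tri expr1n !mul1r => /eqP.
    by rewrite -[X in _ == X]add0r (inj_eq (addIr _)) => /eqP.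
  have := H 1 0; have := H 0 1; rewrite !mul1r !mul0r addr0 add0r.
  by move=> /eqP; rewrite mulf_eq0 (negPf n3) => /eqP-> /eqP; rewrite mulf_eq0 (negPf n3) => /eqP->.
have z222 : t u u u != 0 by apply: plane_not_contained fr _; case: tz.
have [a aE] := dual_frame fr.
have ker (c : K) : c != 0 -> L = (P :&: lker (c *: a (Ordinal (isT : 2 < 3)%N)))%VS.
  move=> c0; apply/vspaceP => v; rewrite memv_cap memv_ker EL EP.
  apply/idP/andP => [/memv_span2[x [x' ->]]|[/memv_span3[x [x' [z ->]]]]].
    split; first by apply/memv_span3; exists x, x', 0; rewrite scale0r addr0.
    by rewrite lfunE /= -[x *: p + x' *: q]addr0 -(scale0r u); have [_ _ ->] := aE x x' 0; rewrite scaler0.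
  rewrite lfunE /=; have [_ _ ->] := aE x x' z; rewrite scaler_eq0 (negPf c0) /= => /eqP ->.
  by rewrite scale0r addr0; apply/memv_span2; exists x, x'.
have k1 := ker 1 (oner_neq0 _); have k2 := ker _ z222.
exists (t u u u *: a (Ordinal (isT : 2 < 3)%N)), (1 *: a (Ordinal (isT : 2 < 3)%N)), (1 *: a (Ordinal
    (isT : 2 < 3)%N)); split=> //.
move=> v; rewrite EP => /memv_span3[x [x' [z ->]]]; rewrite !lfunE /=.
have [_ _ ->] := aE x x' z; rewrite evalf_plane // z022 z122 !scale1r /GRing.scale /=; ring.
Qed.

Lemma adapted_exists p : p \in L -> p != 0 -> exists q u, adapted p q u.
Proof. by move=> pL p0; apply: exists_frame => //; apply: line_plane_sub. Qed.

Lemma VtildeP : Vtilde f y <-> forall v w, v \in L -> w \in P -> t v w w = 0.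
Proof.
have [p pL p0] : exists2 p, p \in L & p != 0.
  have : L != 0%VS by rewrite -dimv_eq0 dim_vsp.
  by exists (vpick L); [exact: memv_pick|rewrite vpick0].
have [q [u ad]] := adapted_exists pL p0; rewrite (Vtilde_adapted ad).
have [fr EL EP] := ad; have tz := adapted_tangent ad; split=> [[z022 z122] v w|H].
  rewrite EL EP => /memv_span2[a [b ->]] /memv_span3[x [x' [z ->]]].
  by rewrite tri_line_plane // z022 z122; ring.
have uP : u \in P by rewrite EP; apply/memv_span3; exists 0, 0, 1; rewrite !scale0r scale1r !add0r.
split; apply: H => //; rewrite EL; apply/memv_span2.
by exists 0, 1; rewrite scale1r scale0r add0r.
Qed.


(** Off [Vtilde] the linear form T(., u, u) is nonzero on the line, so it has a single zero. *)
Lemma residual_point_unique p p' : ~ Vtilde f y -> p \in L -> p' \in L -> p != 0 -> p' != 0 ->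
  (forall w, w \in P -> t p w w = 0) -> (forall w, w \in P -> t p' w w = 0) ->
  vspan (fam1 p) = vspan (fam1 p').
Proof.
move=> nV pL pL' p0 p0' H H'; have [q [u ad]] := adapted_exists pL p0; have [fr EL EP] := ad.
have uP : u \in P by rewrite EP; apply/memv_span3; exists 0, 0, 1; rewrite !scale0r scale1r !add0r.
have q1 : t q u u != 0.
  by apply/eqP => z; apply: nV; apply/(Vtilde_adapted ad); split=> //; apply: H.
move: (pL'); rewrite EL => /memv_span2[a [b E]].
have b0 : b = 0.
  by have /eqP := H' u uP; rewrite E !triE H // mulr0 add0r mulf_eq0 (negPf q1) orbF => /eqP.
have a0 : a != 0 by apply: contra_neq p0' => a0; rewrite E a0 b0 !scale0r addr0.
apply/vspaceP => v; apply/idP/idP => /memv_span1[c ->]; apply/memv_span1.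
  by exists (c / a); rewrite E b0 scale0r addr0 scalerA divfK.
by exists (c * a); rewrite E b0 scale0r addr0 scalerA.
Qed.

(** In a frame whose first vector p spans x, f restricts to z^2 (B y + A z) with B nonzero. The
    residual line is thus spanned by p and A q - B u, and it meets the line in x alone. *)
Lemma residual_pointP (x : Xf f) : ~ Vtilde f y -> (vsp (set_val x) <= L)%VS ->
  (forall v w, v \in vsp (set_val x) -> w \in P -> t v w w = 0) -> residual_point y x.
Proof.
move=> nV xL H.
have [p px p0] : exists2 p, p \in vsp (set_val x) & p != 0.
  have : vsp (set_val x) != 0%VS by rewrite -dimv_eq0 dim_vsp.
  by exists (vpick (vsp (set_val x))); [exact: memv_pick|rewrite vpick0].
have xE := span1_eq p0 px.
have [q [u ad]] := adapted_exists (subvP xL _ px) p0; have [fr EL EP] := ad.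
have tz := adapted_tangent ad.
have n3 : 3%:R != 0 :> K by rewrite pnatr_eq0.
have uP : u \in P by rewrite EP; apply/memv_span3; exists 0, 0, 1; rewrite !scale0r scale1r !add0r.
have z022 : t p u u = 0 by apply: H.
have q1 : t q u u != 0.
  by apply/eqP => z; apply: nV; apply/(Vtilde_adapted ad).
set A := t u u u; set B := 3%:R * t q u u.
have B0 : B != 0 by rewrite mulf_neq0.
pose r := A *: q - B *: u.
have f2 : free2 p r.
  move=> a b; rewrite /r scalerBr !scalerA addrA -scaleNr => /fr[-> _ /eqP].
  by rewrite oppr_eq0 mulf_eq0 (negPf B0) orbF => /eqP.
have /dim_span2/eqP d2 := f2; pose l' : Gr V 2 := exist _ (vspan (fam2 p r)) d2.
have [a aE] := dual_frame fr.
pose a1 := a (Ordinal (isT : 2 < 3)%N); pose a3 := B *: a (Ordinal (isT : 1 < 3)%N) + A *: a1.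
have a1E x0 y0 z0 : a1 (x0 *: p + y0 *: q + z0 *: u) = z0 by have [_ _ ->] := aE x0 y0 z0.
have a3E x0 y0 z0 : a3 (x0 *: p + y0 *: q + z0 *: u) = B * y0 + A * z0.
  by rewrite /a3 !lfunE /= !lfunE /= a1E; have [_ -> _] := aE x0 y0 z0.
have k1 : L = (P :&: lker a1)%VS.
  apply/vspaceP => v; rewrite memv_cap memv_ker EL EP.
  apply/idP/andP => [/memv_span2[c [c' ->]]|[/memv_span3[c [c' [z ->]]]]].
    split; first by apply/memv_span3; exists c, c', 0; rewrite scale0r addr0.
    by rewrite -[c *: p + c' *: q]addr0 -(scale0r u) a1E.
  by rewrite a1E => /eqP->; rewrite scale0r addr0; apply/memv_span2; exists c, c'.
have rE c c' : c *: p + c' *: r = c *: p + (c' * A) *: q + (- (c' * B)) *: u.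
  by rewrite /r scalerBr !scalerA addrA scaleNr.
exists l'; split.
- exists a1, a1, a3; split=> //.
    move=> v; rewrite EP => /memv_span3[c [c' [z ->]]].
    by rewrite evalf_plane // !a1E a3E z022 -/A /B; ring.
  apply/vspaceP => v; rewrite memv_cap memv_ker EP.
  apply/idP/andP => [/memv_span2[c [c' ->]]|[/memv_span3[c [c' [z ->]]]]].
    rewrite rE a3E; split; first by apply/memv_span3; exists c, (c' * A), (- (c' * B)).
    by apply/eqP; ring.
  rewrite a3E => /eqP E; apply/memv_span2; exists c, (- z / B); rewrite rE; congr (_ + _ *: _ + _ *: _).
    by apply: (mulfI B0); rewrite -[LHS](addrK (A * z)) E; field.
  by rewrite divfK // opprK.
- move=> E; have : r \in L by rewrite E; apply/memv_span2; exists 0, 1; rewrite scale0r scale1r add0r.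
  rewrite k1 memv_cap memv_ker => /andP[_].
  have -> : r = 0 *: p + A *: q + (- B) *: u by rewrite scale0r add0r scaleNr.
  by rewrite a1E oppr_eq0 (negPf B0).
- rewrite xE; apply/vspaceP => v; rewrite memv_cap EL.
  apply/idP/andP => [/memv_span1[c ->]|[/memv_span2[c [c' ->]] /memv_span2[d [d' E]]]].
    by split; apply/memv_span2; exists c, 0; rewrite scale0r addr0.
  apply/memv_span1; exists c.
  have /fr[_ + /eqP] : (c - d) *: p + (c' - d' * A) *: q + (d' * B) *: u = 0.
    rewrite rE in E; transitivity ((c *: p + c' *: q) - (d *: p + (d' * A) *: q + (- (d' * B)) *: u));
        last by rewrite E subrr.
    by rewrite !scalerBl scaleNr !opprD opprK [RHS]addrA; congr (_ + _); rewrite addrACA.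
  rewrite mulf_eq0 (negPf B0) orbF => c'E /eqP d'0; move: c'E; rewrite d'0 mul0r subr0 => ->.
  by rewrite scale0r addr0.
Qed.

End Point.

End TangentPlanes.

(** * The contact locus and the blowup *)

Section Varieties.
Variable K : numClosedFieldType.
Local Notation V := 'rV[K]_6.
Variable f : dhomog 6 K 3.
Local Notation t := (tri f).
Implicit Types T : fspace K.

Lemma regular_coord T (lrT : locally_ringed T) (v : T -> V) (s : T) a :
  vreg_at v s -> regular_at (fun z => v z ord0 a) s.
Proof.
move=> rv; apply: (regular_eq (h := fun z => \sum_j coord (vbasis {:V}) j (v z) * (vbasis {:V})`_j ord0 a)).
  apply: near_all => z; rewrite [in RHS](coord_vbasis (memvf (v z))) summxE.
  by apply: eq_bigr => j _; rewrite mxE.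
by apply: lr_sum => // j _; apply: lr_mul (rv j) _ => //; exact: lr_cst.
Qed.

Lemma regular_tri T (lrT : locally_ringed T) (u v w : T -> V) (s : T) :
  vreg_at u s -> vreg_at v s -> vreg_at w s -> regular_at (fun z => t (u z) (v z) (w z)) s.
Proof.
move=> ru rv rw; apply: lr_sum => // a _; apply: lr_sum => // b _; apply: lr_sum => // c _.
by apply: lr_mul => //; [exact: lr_cst|do !apply: lr_mul => //; exact: regular_coord].
Qed.

Lemma closed_linear_subspaces k : closed (linear_subspaces f (k := k)).
Proof.
rewrite (_ : linear_subspaces f (k := k) =
  [set W : Gr V k | forall v w, v \in vsp (id W) -> w \in vsp (id W) -> t v v v = 0]).
  apply: (closed_vanishing (F := fun v w => t v v v) (lr_gr V k)).
  - by move=> W; apply: morph_at_id.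
  - by move=> W; apply: morph_at_id.
  - by move=> v w s rv rw; apply: regular_tri => //; exact: lr_gr.
apply/seteqP; split=> W /= H v; first by move=> w vW _; rewrite -evalf_tri H.
by move=> vW; rewrite evalf_tri (H v 0) // mem0v.
Qed.

Lemma variety_Xf : variety (Xf f).
Proof. by apply: variety_fsub; [exact: variety_gr|exact: closed_linear_subspaces]. Qed.

Local Notation G23 := (vprod (Gr V 2) (Gr V 3)).

Lemma lr_G23 : locally_ringed G23.
Proof. by apply: lr_vprod; apply: lr_gr. Qed.

Lemma fst_G23 (p : G23) : morph_at (fun q : G23 => q.1) p.
Proof. by apply: morph_fst; apply: lr_gr. Qed.

Lemma snd_G23 (p : G23) : morph_at (fun q : G23 => q.2) p.
Proof. by apply: morph_snd; apply: lr_gr. Qed.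

Lemma closed_tangent_pairs : closed (tangent_pairs f).
Proof.
have -> : tangent_pairs f = ((fun q : G23 => q.1) @^-1` linear_subspaces f (k := 2)) `&`
  ([set q : G23 | (vsp q.1 <= vsp q.2)%VS] `&`
   [set q : G23 | forall v w, v \in vsp q.1 -> w \in vsp q.2 -> 3%:R * t v v w = 0]).
  apply/seteqP; split=> q /=.
    by move=> [H1 H2 H3]; do !split=> //; move=> v w vL wP; rewrite -dirder_tri H3.
  by move=> [H1 [H2 H3]]; split=> // v w vL wP; rewrite dirder_tri H3.
apply: closedI; first by apply: closed_preimage fst_G23 _; exact: closed_linear_subspaces.
apply: closedI; first exact (closed_vsp_sub lr_G23 fst_G23 snd_G23).
apply: (closed_vanishing (F := fun v w => 3%:R * t v v w) lr_G23 fst_G23 snd_G23).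
move=> v w s rv rw; have R := regular_tri lr_G23 rv rv rw.
exact: (lr_mul lr_G23 (lr_cst lr_G23 _ _) R).
Qed.

Lemma variety_Ftilde : variety (Ftilde f).
Proof.
by apply: variety_fsub; [apply: variety_vprod; exact: variety_gr|exact: closed_tangent_pairs].
Qed.

Lemma lr_Ftilde : locally_ringed (Ftilde f).
Proof. by apply: lr_variety; exact: variety_Ftilde. Qed.

Lemma lr_Xf : locally_ringed (Xf f).
Proof. by apply: lr_variety; exact: variety_Xf. Qed.

Lemma morph_line_of (y : Ftilde f) : morph_at (@line_of K f : Ftilde f -> Gr V 2) y.
Proof. by apply: (morph_at_comp (g := set_val : Ftilde f -> G23)); [exact: morph_val|exact: fst_G23]. Qed.

Lemma morph_plane_of (y : Ftilde f) : morph_at (@plane_of K f : Ftilde f -> Gr V 3) y.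
Proof. by apply: (morph_at_comp (g := set_val : Ftilde f -> G23)); [exact: morph_val|exact: snd_G23]. Qed.

Local Notation XF := (vprod (Xf f) (Ftilde f)).

Lemma lr_XF : locally_ringed XF.
Proof. by apply: lr_vprod; [exact: lr_Xf|exact: lr_Ftilde]. Qed.

Lemma fst_XF (p : XF) : morph_at (fun q : XF => q.1) p.
Proof. by apply: morph_fst; [exact: lr_Xf|exact: lr_Ftilde]. Qed.

Lemma snd_XF (p : XF) : morph_at (fun q : XF => q.2) p.
Proof. by apply: morph_snd; [exact: lr_Xf|exact: lr_Ftilde]. Qed.

Lemma point_XF (p : XF) : morph_at (fun q : XF => set_val q.1 : Gr V 1) p.
Proof. by apply: (morph_at_comp (fst_XF p)); exact: morph_val. Qed.

Lemma variety_Itilde : variety (Itilde f).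
Proof.
apply: variety_fsub; first by apply: variety_vprod; [exact: variety_Xf|exact: variety_Ftilde].
refine (closed_vsp_sub (P := fun q : XF => line_of q.2) lr_XF point_XF _) => p.
by apply: (morph_at_comp (snd_XF p)); exact: morph_line_of.
Qed.

Lemma lr_Itilde : locally_ringed (Itilde f).
Proof. by apply: lr_variety; exact: variety_Itilde. Qed.

(* The strict transform of [Itilde]: off [Vtilde] the point of the line is the
   intersection with the residual line, and over [Vtilde] it is arbitrary. *)
Definition contact_points : set (Itilde f) :=
  [set q | forall v w, v \in vsp (set_val (set_val q).1) -> w \in vsp (plane_of (set_val q).2) ->
     t v w w = 0].

Definition contact : fspace K := fsub contact_points.

Definition contact_to_Ftilde (b : contact) : Ftilde f := Itilde_to_Ftilde f (set_val b).

Definition contact_point (b : contact) : Xf f := (set_val (set_val b)).1.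

Lemma variety_contact : variety contact.
Proof.
apply: variety_fsub; first exact: variety_Itilde.
apply: (closed_vanishing lr_Itilde (L := fun q : Itilde f => set_val (set_val q).1)
  (P := fun q : Itilde f => plane_of (set_val q).2) (F := fun v w => t v w w)).
- move=> q; exact: (morph_at_comp (g := set_val : Itilde f -> XF) (k := fun p : XF => set_val p.1 : Gr V
    1) (morph_val q) (point_XF _)).
- move=> q; apply: (morph_at_comp (g := set_val : Itilde f -> XF) (k := fun p : XF => plane_of p.2 : Gr
    V 3) (morph_val q)).
  exact: (morph_at_comp (snd_XF _) (morph_plane_of _)).
- by move=> v w s rv rw; apply: regular_tri => //; exact: lr_Itilde.
Qed.

Lemma lr_contact : locally_ringed contact.
Proof. by apply: lr_variety; exact: variety_contact. Qed.

Lemma morph_Itilde_to_Ftilde (q : Itilde f) : morph_at (Itilde_to_Ftilde f) q.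
Proof. by apply: (morph_at_comp (g := set_val : Itilde f -> XF)); [exact: morph_val|exact: snd_XF]. Qed.

Lemma morph_Itilde_to_X (q : Itilde f) : morph_at (I_to_X f \o Itilde_to_I f) q.
Proof.
apply: (morph_at_eq (g := fun q : Itilde f => (set_val q).1 : Xf f)).
  by apply: near_all => q'; rewrite /= /I_to_X fsub_mkK.
by apply: (morph_at_comp (g := set_val : Itilde f -> XF)); [exact: morph_val|exact: fst_XF].
Qed.

Lemma morph_contact_to_Ftilde (b : contact) : morph_at contact_to_Ftilde b.
Proof.
by apply: (morph_at_comp (g := set_val : contact -> Itilde f)); [exact: morph_val|exact:
    morph_Itilde_to_Ftilde].
Qed.

Lemma contact_sub (b : contact) : (vsp (set_val (contact_point b)) <= vsp (line_of (contact_to_Ftilde b)))%VS.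
Proof. exact: (fsub_valP (set_val b)). Qed.

Lemma contactP (b : contact) v w : v \in vsp (set_val (contact_point b)) ->
  w \in vsp (plane_of (contact_to_Ftilde b)) -> t v w w = 0.
Proof. exact: (fsub_valP b). Qed.

Lemma contact_inj (b b' : contact) : contact_to_Ftilde b = contact_to_Ftilde b' ->
  vsp (set_val (contact_point b)) = vsp (set_val (contact_point b')) -> b = b'.
Proof.
move=> Eb Ex; apply: fsub_inj; apply: fsub_inj.
rewrite [LHS]surjective_pairing [RHS]surjective_pairing; congr (_, _) => //.
by apply: fsub_inj; apply: gr_inj.
Qed.

Hypothesis npl : ~ has_plane f.

Lemma closed_Vtilde : closed (Vtilde f).
Proof.
have -> : Vtilde f = [set y : Ftilde f | forall v w, v \in vsp (line_of y) -> w \in vsp (plane_of y) ->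
    t v w w = 0].
  by apply/seteqP; split=> y; have [] := VtildeP npl y.
apply: (closed_vanishing (F := fun v w => t v w w) lr_Ftilde morph_line_of morph_plane_of).
by move=> v w s rv rw; apply: regular_tri => //; exact: lr_Ftilde.
Qed.

Lemma contact_inj_off (b b' : contact) : contact_to_Ftilde b = contact_to_Ftilde b' ->
  ~ Vtilde f (contact_to_Ftilde b) -> b = b'.
Proof.
move=> E nV; apply: contact_inj => //.
have pk (x : Xf f) : exists2 p, p \in vsp (set_val x) & p != 0.
  have : vsp (set_val x) != 0%VS by rewrite -dimv_eq0 dim_vsp.
  by exists (vpick (vsp (set_val x))); [exact: memv_pick|rewrite vpick0].
have [p pb p0] := pk (contact_point b); have [p' pb' p0'] := pk (contact_point b').
rewrite (span1_eq p0 pb) (span1_eq p0' pb').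
apply: (residual_point_unique npl nV) => //.
- exact: (subvP (contact_sub b)).
- by rewrite E; apply: (subvP (contact_sub b')).
- by move=> w; apply: contactP.
- by move=> w; rewrite E; apply: contactP.
Qed.

Lemma contact_residual (b : contact) : ~ Vtilde f (contact_to_Ftilde b) ->
  residual_point (contact_to_Ftilde b) (contact_point b).
Proof. by move=> nV; apply: residual_pointP => //; [exact: contact_sub|exact: contactP]. Qed.

End Varieties.
Arguments contact_points {K} f _.

(** * Passing between moving frames, flags and contact points *)

Section LocalFrames.
Variable K : numClosedFieldType.
Local Notation V := 'rV[K]_6.
Variable f : dhomog 6 K 3.
Local Notation t := (tri f).
Implicit Types T : fspace K.

Lemma vreg_fam3 T (lrT : locally_ringed T) (v0 v1 v2 : T -> V) s :
  vreg_at v0 s -> vreg_at v1 s -> vreg_at v2 s ->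
  forall i, vreg_at (fun z => fam3 (v0 z) (v1 z) (v2 z) i) s.
Proof. by move=> r0 r1 r2 [[|[|[|i]]] lti]. Qed.

Lemma vreg_fam2 T (lrT : locally_ringed T) (v0 v1 : T -> V) s :
  vreg_at v0 s -> vreg_at v1 s -> forall i, vreg_at (fun z => fam2 (v0 z) (v1 z) i) s.
Proof. by move=> r0 r1 [[|[|i]] lti]. Qed.

Lemma near_free3 T (lrT : locally_ringed T) (v0 v1 v2 : T -> V) s :
  vreg_at v0 s -> vreg_at v1 s -> vreg_at v2 s -> free3 (v0 s) (v1 s) (v2 s) ->
  \forall z \near s, free3 (v0 z) (v1 z) (v2 z).
Proof.
move=> r0 r1 r2 /dim_span3 d.
by apply: near_imp (near_free lrT (vreg_fam3 lrT r0 r1 r2) d) => z /dim_span3.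
Qed.

Lemma adapted_of_mem (y : Ftilde f) p q u : p \in vsp (line_of y) -> q \in vsp (line_of y) ->
  u \in vsp (plane_of y) -> free3 p q u -> adapted y p q u.
Proof.
move=> pL qL uP fr; split=> //; apply: vspan_eq.
- by move=> [[|[|i]] lti].
- by apply/dim_span2; exact: free3_free2 fr.
- by move=> [[|[|[|i]]] lti] //; apply: (subvP (line_plane_sub y)).
- by apply/dim_span3.
Qed.

Lemma adapted_inj (y y' : Ftilde f) p q u : adapted y p q u -> adapted y' p q u -> y = y'.
Proof.
move=> [_ EL EP] [_ EL' EP']; apply: fsub_inj.
rewrite [LHS]surjective_pairing [RHS]surjective_pairing; congr (_, _); apply: gr_inj.
  by rewrite -/(line_of y) -/(line_of y') EL EL'.
by rewrite -/(plane_of y) -/(plane_of y') EP EP'.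
Qed.

(** The first vector is prescribed, so that it can follow a given section of the line. *)
Lemma near_adapted T (lrT : locally_ringed T) (g : T -> Ftilde f) (v0 : T -> V) (s : T) q u :
  morph_at g s -> vreg_at v0 s -> (\forall z \near s, v0 z \in vsp (line_of (g z))) ->
  adapted (g s) (v0 s) q u -> exists v1 v2 : T -> V,
  [/\ vreg_at v1 s, vreg_at v2 s, v1 s = q, v2 s = u &
    \forall z \near s, adapted (g z) (v0 z) (v1 z) (v2 z)].
Proof.
move=> mg r0 n0 [fr EL EP].
have qL : q \in vsp (line_of (g s)) by rewrite EL; apply/memv_span2; exists 0, 1; rewrite scale1r
    scale0r add0r.
have uP : u \in vsp (plane_of (g s)).
  by rewrite EP; apply/memv_span3; exists 0, 0, 1; rewrite !scale0r scale1r !add0r.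
have [w1 [rw1 w1E nw1]] := vreg_lift qL; have [w2 [rw2 w2E nw2]] := vreg_lift uP.
have mL := morph_at_comp mg (morph_line_of (g s)); have mP := morph_at_comp mg (morph_plane_of (g s)).
have [cL _] := mL; have [cP _] := mP.
have r1 : vreg_at (fun z => w1 (line_of (g z))) s := vreg_comp mL rw1.
have r2 : vreg_at (fun z => w2 (plane_of (g z))) s := vreg_comp mP rw2.
exists (fun z => w1 (line_of (g z))), (fun z => w2 (plane_of (g z))); split=> //.
have frs : free3 (v0 s) (w1 (line_of (g s))) (w2 (plane_of (g s))) by rewrite w1E w2E.
apply: near_imp4 n0 (cL _ nw1) (cP _ nw2) (near_free3 lrT r0 r1 r2 frs) => z.
exact: adapted_of_mem.
Qed.

Lemma near_morph_pair (T S X : fspace K) (g : X -> T) (k : X -> S) (x : X) : locally_ringed X ->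
  near_morph g x -> near_morph k x -> near_morph (fun z => (g z, k z) : vprod T S) x.
Proof. by move=> lrX; apply: near_imp2 => z; apply: morph_pair. Qed.

Lemma flag_to_Ftilde T (lrT : locally_ringed T) (v0 v1 v2 : T -> V) s :
  vreg_at v0 s -> vreg_at v1 s -> vreg_at v2 s -> free3 (v0 s) (v1 s) (v2 s) ->
  (\forall z \near s, tangent_zero f (v0 z) (v1 z) (v2 z)) ->
  exists g : T -> Ftilde f, near_morph g s /\ \forall z \near s, adapted (g z) (v0 z) (v1 z) (v2 z).
Proof.
move=> r0 r1 r2 fr tz.
have d3 : \dim (vspan (fam3 (v0 s) (v1 s) (v2 s))) = 3%N by apply/dim_span3.
have d2 : \dim (vspan (fam2 (v0 s) (v1 s))) = 2%N by apply/dim_span2; exact: free3_free2 fr.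
have [gL [mL EL]] := near_morph_gr lrT (vreg_fam2 lrT r0 r1) d2.
have [gP [mP EP]] := near_morph_gr lrT (vreg_fam3 lrT r0 r1 r2) d3.
have nt : \forall z \near s, tangent_pairs f ((gL z, gP z) : vprod (Gr V 2) (Gr V 3)).
  apply: near_imp3 EL EP tz => z EL EP tz; apply/tangent_pairsP; rewrite /= EL EP; split.
    apply: vspan_sub => -[[|[|i]] lti] //; apply/memv_span3; rewrite /fam2 /=.
      by exists 1, 0, 0; rewrite scale1r !scale0r !addr0.
    by exists 0, 1, 0; rewrite scale1r !scale0r addr0 add0r.
  by apply/tangent_zeroP.
have [g [mg gE]] := near_morph_fsub (near_morph_pair lrT mL mP) nt (nbhs_singleton nt).
exists g; split=> //; apply: near_imp4 gE EL EP (near_free3 lrT r0 r1 r2 fr) => z gz EL EP fz.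
by split=> //; rewrite /line_of /plane_of gz.
Qed.

Lemma near_morph_contact T (lrT : locally_ringed T) (g : T -> Ftilde f) (u : T -> V) s :
  near_morph g s -> vreg_at u s -> u s != 0 ->
  (\forall z \near s, u z \in vsp (line_of (g z)) /\ forall w, w \in vsp (plane_of (g z)) -> t (u z) w w
      = 0) ->
  exists k : T -> contact f, near_morph k s /\ \forall z \near s,
    contact_to_Ftilde (k z) = g z /\ u z \in vsp (set_val (contact_point (k z))).
Proof.
move=> mg ru u0 nu; have /dim_span1 d1 := u0.
have [x [mx xE]] := near_morph_gr lrT (v := fun z => fam1 (u z)) (fun=> ru) d1.
have nX : \forall z \near s, linear_subspaces f (x z).
  apply: near_imp2 xE nu => z xz [uL _] v; rewrite xz => /memv_span1[a ->].
  by rewrite evalf_tri !triE (tri_line_line (y := g z)) ?mulr0 // (subvP (line_plane_sub (g z))).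
have [x' [mx' x'E]] := near_morph_fsub mx nX (nbhs_singleton nX).
have nI : \forall z \near s, incidentIt (((x' z : Xf f), g z) : vprod (Xf f) (Ftilde f)).
  apply: near_imp3 xE x'E nu => z xz x'z [uL _]; rewrite /incidentIt /= x'z xz.
  by apply: vspan_sub => i.
have [j [mj jE]] := near_morph_fsub (near_morph_pair lrT mx' mg) nI (nbhs_singleton nI).
have nC : \forall z \near s, contact_points f (j z).
  apply: near_imp4 xE x'E jE nu => z xz x'z jz [_ H] v w; rewrite jz /= x'z xz => /memv_span1[a ->] wP.
  by rewrite triZ1 H ?mulr0.
have [k [mk kE]] := near_morph_fsub mj nC (nbhs_singleton nC).
exists k; split=> //; apply: near_imp4 xE x'E jE kE => z xz x'z jz kz.
rewrite /contact_to_Ftilde /Itilde_to_Ftilde /contact_point kz jz /= x'z xz; split=> //.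
by apply/memv_span1; exists 1; rewrite scale1r.
Qed.

End LocalFrames.

Section Sections.
Variable K : fieldType.

(** Here [R y z] stands for z being a frame of y. Near [y0] the point [th] of [v y] again has the
    frame [v y], and a point is determined by any of its frames. *)
Lemma near_section (Y : fspace K) n (Z : set (aff K n)) (R : Y -> aff K n -> Prop)
    (th : fsub Z -> Y) (v : Y -> aff K n) (y0 : Y) (Z0 : Z (v y0)) :
  morph_at v y0 -> (forall y y' z, R y z -> R y' z -> y = y') ->
  (\forall y \near y0, Z (v y)) -> (\forall y \near y0, R y (v y)) ->
  (\forall z \near fsub_mk Z0, R (th z) (set_val z)) ->
  \forall y \near y0, exists Zy : Z (v y), th (fsub_mk Zy) = y.
Proof.
move=> [cv _] Rinj nZ nR nth0; have [N nN NE] := fsub_nearE nth0.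
rewrite fsub_mkK in nN; apply: near_imp3 nZ nR (cv _ nN) => y Zy Ry Ny.
exists Zy; apply: Rinj Ry; have := NE (fsub_mk Zy); rewrite fsub_mkK; exact.
Qed.

End Sections.

(** * Generators of the ideal of [Vtilde] and a nonzerodivisor on the contact locus *)

Section LocalEquations.
Variable K : numClosedFieldType.
Hypothesis Kunc : uncountable_field K.
Local Notation V := 'rV[K]_6.
Variable f : dhomog 6 K 3.
Hypothesis good : good_cubic f.
Local Notation t := (tri f).
Local Notation n := (3 * 6)%N.
Local Notation A := (aff K n).
Local Notation i0 := (@Ordinal 3 0 isT).
Local Notation i1 := (@Ordinal 3 1 isT).
Local Notation i2 := (@Ordinal 3 2 isT).
Implicit Types T : fspace K.

Lemma free3_neq0 (p q u : V) : free3 p q u -> p != 0.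
Proof.
move=> H; apply/eqP => p0; have [] := H 1 0 0; first by rewrite p0 !scale0r scaler0 !addr0.
by move=> /eqP; rewrite oner_eq0.
Qed.

Definition pack (p q u : V) : 'rV[K]_n := mxvec (\matrix_(i < 3, b < 6) fam3 p q u i ord0 b).

Lemma pt_pack p q u i : pt i (pack p q u) = fam3 p q u i.
Proof. by rewrite /pt /pack mxvecK; apply/rowP => b; rewrite !mxE. Qed.

Lemma morph_pack T (lrT : locally_ringed T) (v0 v1 v2 : T -> V) s :
  vreg_at v0 s -> vreg_at v1 s -> vreg_at v2 s ->
  morph_at (fun z => pack (v0 z) (v1 z) (v2 z) : A) s.
Proof.
move=> r0 r1 r2; apply: morph_at_aff => // l.
case/mxvec_indexP: l => i b; apply: (regular_eq (h := fun z => fam3 (v0 z) (v1 z) (v2 z) i ord0 b)).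
  by apply: near_all => z; rewrite /pack mxvecE mxE.
exact: (regular_coord lrT b (vreg_fam3 lrT r0 r1 r2 i)).
Qed.

Lemma vreg_pt i (z : A) : vreg_at (fun z : A => pt i z) z.
Proof.
apply: (vreg_eq (v := fun z : A => \sum_b (z : 'rV_n) ord0 (mxvec_index i b) *: delta_mx ord0 b)).
  apply: near_all => y; rewrite [RHS]row_sum_delta; apply: eq_bigr => b _; congr (_ *: _).
  by rewrite /pt !mxE.
have lrA := lr_aff K n.
apply: (vreg_sum lrA) => b _; apply: (vreg_scale lrA); first exact: aff_regular_coord.
exact: vreg_cst.
Qed.

Lemma vreg_pt_val i (Z : set A) (z : fsub Z) : vreg_at (fun z : fsub Z => pt i (set_val z)) z.
Proof. exact: (vreg_comp (g := set_val : fsub Z -> A) (morph_val z) (vreg_pt i (set_val z))). Qed.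

Definition pt_tangent (z : A) := tangent_zero f (pt i0 z) (pt i1 z) (pt i2 z).

Lemma frame_eqs_tangent (z : A) : pt_tangent z <->
  forall i, (i < 7)%N -> (gp f (frame_monomial i)).@[(z : 'rV_n) ord0] = 0.
Proof.
split=> [[[z0 z1 z2 z3] [z4 z5 z6]] i|H].
  by rewrite gpE /tp; case: i => [|[|[|[|[|[|[|i]]]]]]].
by do !split; [have := H 0%N|have := H 1%N|have := H 2%N|have := H 3%N|have := H 4%N|have := H 5%N|have
    := H 6%N];
  rewrite gpE; apply.
Qed.

Section AtVtilde.
Variables (y0 : Ftilde f) (v0 v1 v2 : Ftilde f -> V).
Hypotheses (r0 : vreg_at v0 y0) (r1 : vreg_at v1 y0) (r2 : vreg_at v2 y0).
Hypothesis ad : \forall y \near y0, adapted y (v0 y) (v1 y) (v2 y).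

(** If s_0 or s_1 is a unit at [y0], division suffices. Otherwise h becomes a fraction P / Q on the
    space of frames, P vanishes at the nearby zeros of the nine equations and so lies in their local
    ideal; pulled back along the moving frame the first seven equations vanish, and s_0, s_1
    remain. *)
Lemma ideal_Vtilde_generators h : ideal_at (Vtilde f) y0 h ->
  exists a0 a1 : Ftilde f -> K, [/\ regular_at a0 y0, regular_at a1 y0 &
    \forall y \near y0, h y = a0 y * t (v0 y) (v2 y) (v2 y) + a1 y * t (v1 y) (v2 y) (v2 y)].
Proof.
have [nsing npl ndeg] := good; have lrF := lr_Ftilde f.
move=> [rh hV]; have ad0 := nbhs_singleton ad; have [fr EL EP] := ad0.
pose s0 y := t (v0 y) (v2 y) (v2 y); pose s1 y := t (v1 y) (v2 y) (v2 y).
have rs0 : regular_at s0 y0 by apply: regular_tri.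
have rs1 : regular_at s1 y0 by apply: regular_tri.
have r00 : regular_at (fun=> 0) y0 by apply: lr_cst.
have [s00|s00] := eqVneq (s0 y0) 0; last first.
  exists (fun y => h y / s0 y), (fun=> 0); split=> //; first exact: lr_div.
  by apply: near_imp (lr_neq0 lrF rs0 s00) => y sy; rewrite mul0r addr0 divfK.
have [s10|s10] := eqVneq (s1 y0) 0; last first.
  exists (fun=> 0), (fun y => h y / s1 y); split=> //; first exact: lr_div.
  by apply: near_imp (lr_neq0 lrF rs1 s10) => y sy; rewrite mul0r add0r divfK.
pose v (y : Ftilde f) : A := pack (v0 y) (v1 y) (v2 y).
have mv : morph_at v y0 by apply: morph_pack.
have tgv : \forall y \near y0, pt_tangent (v y).
  by apply: near_imp ad => y /adapted_tangent; rewrite /pt_tangent !pt_pack.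
have Z0 := nbhs_singleton tgv; pose z0 : fsub pt_tangent := fsub_mk Z0.
have z0E : set_val z0 = v y0 by rewrite fsub_mkK.
have lrZ : locally_ringed (fsub pt_tangent) by apply: lr_fsub; exact: lr_aff.
have frz : free3 (pt i0 (set_val z0)) (pt i1 (set_val z0)) (pt i2 (set_val z0)) by rewrite z0E !pt_pack.
have [th [mth thE]] := flag_to_Ftilde lrZ (vreg_pt_val i0 z0) (vreg_pt_val i1 z0) (vreg_pt_val i2 z0) frz
  (near_all _ (fun z : fsub pt_tangent => fsub_valP z)).
have adv : \forall y \near y0, adapted y (pt i0 (v y)) (pt i1 (v y)) (pt i2 (v y)).
  by apply: near_imp ad => y; rewrite !pt_pack.
have sec := near_section (R := fun y z => adapted y (pt i0 z) (pt i1 z) (pt i2 z)) mv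
  (fun y y' z => @adapted_inj K f y y' _ _ _) tgv adv thE.
have [P [Q [Q0 QP nQ]]] := regular_fraction mv (near_morph_at mth) sec rh.
have th0 : th z0 = y0.
  by have [Zy thy] := nbhs_singleton sec; rewrite -[RHS]thy; congr th; apply: fsub_inj; rewrite !fsub_mkK.
have [cth _] := near_morph_at mth; rewrite th0 in cth.
have [N nN NE] := fsub_nearE (filterI (cth _ hV) thE).
rewrite z0E in nN; have [q [q0 qN]] := aff_nbhs_basis nN.
have tz : triple_zero f (v0 y0) (v1 y0) (v2 y0) by have [? ?] := adapted_tangent ad0; split.
have [q2 [q20 [c cE]]] : germ_ideal ((v y0 : 'rV_n) ord0) (gen_ideal (@frame_eqs K f 9)) P.
  have qQ0 : (q * Q).@[(v y0 : 'rV_n) ord0] != 0 by rewrite mevalM mulf_neq0.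
  have gz0 (i : 'I_9) : (frame_eqs f i).@[(v y0 : 'rV_n) ord0] = 0 by apply: frame_eqs_zero; rewrite !pt_pack.
  have jac : row_free (\matrix_(i < 9, l < n) ((frame_eqs f i)^`M(l)).@[(v y0 : 'rV_n) ord0]).
    apply: frame_eqs_free => //; rewrite !pt_pack //.
    exact: plane_not_contained tz.
  apply: (smooth_vanishing Kunc gz0 jac qQ0).
  - move=> z0' gz; pose z : A := \row_i z0' i; have -> : z0' = (z : 'rV_n) ord0 by apply/funext => i;
      rewrite mxE.
    have {gz} gz i : (i < 9)%N -> (gp f (frame_monomial i)).@[(z : 'rV_n) ord0] = 0.
      move=> i9; rewrite -[RHS](gz (Ordinal i9)); apply: meval_eq => j; by rewrite mxE.
    rewrite mevalM mulf_eq0 negb_or => /andP[qz Qz].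
    have Zz : pt_tangent z by apply/frame_eqs_tangent => i i7; apply: gz; apply: leq_trans i7 _.
    have zE : set_val (fsub_mk Zz : fsub pt_tangent) = z by rewrite fsub_mkK.
    have [|hz az] := NE (fsub_mk Zz); first by rewrite zE; apply: qN.
    rewrite zE in az.
    have Vz : Vtilde f (th (fsub_mk Zz)).
      apply/(Vtilde_adapted npl az); have := gz 7 isT; have := gz 8 isT; rewrite !gpE /tp /=; by split.
    have := QP (fsub_mk Zz); rewrite zE => /(_ Qz); rewrite (hz Vz) => /esym/eqP.
    by rewrite mulf_eq0 invr_eq0 (negPf Qz) orbF => /eqP.
have q2Q0 : (q2 * Q).@[(v y0 : 'rV_n) ord0] != 0 by rewrite mevalM mulf_neq0.
have rv i : regular_at (fun y => (v y : 'rV_n) ord0 i) y0.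
  by have [_ H] := mv; apply: (H (fun z : A => (z : 'rV_n) ord0 i)); exact: aff_regular_coord.
have rm P' : regular_at (fun y => P'.@[(v y : 'rV_n) ord0]) y0 by apply: lr_meval.
(* The index 7 gives the coefficient of s_0, and [ord_max] below that of s_1. *)
exists (fun y => (c (widen_ord (leqnSn 8) ord_max)).@[(v y : 'rV_n) ord0] / (q2 * Q).@[(v y : 'rV_n) ord0]).
exists (fun y => (c ord_max).@[(v y : 'rV_n) ord0] / (q2 * Q).@[(v y : 'rV_n) ord0]).
split; [exact: lr_div|exact: lr_div|].
apply: near_imp3 tgv nQ (lr_neq0 lrF (rm (q2 * Q)) q2Q0) => y ty [Qy ->].
rewrite mevalM mulf_eq0 negb_or => /andP[q2y _].
have := congr1 (fun P => P.@[(v y : 'rV_n) ord0]) cE; rewrite /= mevalM meval_sum big_ord_recr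
    big_ord_recr big1 /=.
  rewrite !mevalM !gpE /tp /= !pt_pack /fam3 /= => E.
  by apply: (mulfI q2y); rewrite mulrA E; field; rewrite q2y Qy.
move=> i _; rewrite mevalM; apply/eqP; rewrite mulf_eq0; apply/orP; right; apply/eqP.
exact: ((frame_eqs_tangent _).1 ty i (ltn_ord i)).
Qed.

End AtVtilde.

Section AtContact.
Variables (b0 : contact f) (v0 v1 v2 : contact f -> V).
Hypotheses (r0 : vreg_at v0 b0) (r1 : vreg_at v1 b0) (r2 : vreg_at v2 b0).
Hypothesis ad : \forall b \near b0, v0 b \in vsp (set_val (contact_point b)) /\
  adapted (contact_to_Ftilde b) (v0 b) (v1 b) (v2 b).
Hypothesis b0V : Vtilde f (contact_to_Ftilde b0).

(* The local ring is a domain because the eight equations of the contact locus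
   have independent differentials; the ninth equation is not in their ideal. *)
Lemma contact_nonzerodivisor : nonzerodivisor_at (fun b => t (v1 b) (v2 b) (v2 b)) b0.
Proof.
have [nsing npl ndeg] := good; have lrB := lr_contact f.
split=> [|a ra a0]; first exact: regular_tri.
have [x0 ad0] := nbhs_singleton ad; have [fr EL EP] := ad0.
have [z022 z122] := (Vtilde_adapted npl ad0).1 b0V.
pose Z8 : set A := [set z | pt_tangent z /\ t (pt i0 z) (pt i2 z) (pt i2 z) = 0].
pose v (b : contact f) : A := pack (v0 b) (v1 b) (v2 b).
have mv : morph_at v b0 by apply: morph_pack.
have nZ : \forall b \near b0, Z8 (v b).
  apply: near_imp ad => b [xb ab]; split; first by have := adapted_tangent ab; rewrite /pt_tangent !pt_pack.
  rewrite !pt_pack; apply: (contactP xb); have [_ _ ->] := ab.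
  by apply/memv_span3; exists 0, 0, 1; rewrite !scale0r scale1r !add0r.
have Z0 := nbhs_singleton nZ; pose z0 : fsub Z8 := fsub_mk Z0.
have z0E : set_val z0 = v b0 by rewrite fsub_mkK.
have lrZ : locally_ringed (fsub Z8) by apply: lr_fsub; exact: lr_aff.
have frz : free3 (pt i0 (set_val z0)) (pt i1 (set_val z0)) (pt i2 (set_val z0)) by rewrite z0E !pt_pack.
have [g [mg gE]] := flag_to_Ftilde lrZ (vreg_pt_val i0 z0) (vreg_pt_val i1 z0) (vreg_pt_val i2 z0) frz
  (near_all _ (fun z : fsub Z8 => (fsub_valP z).1)).
have u0 : pt i0 (set_val z0) != 0 by exact: free3_neq0 frz.
have nu : \forall z \near z0, pt i0 (set_val z) \in vsp (line_of (g z)) /\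
    forall w, w \in vsp (plane_of (g z)) -> t (pt i0 (set_val z)) w w = 0.
  apply: near_imp gE => z az; have [_ -> ->] := az; split.
    by apply/memv_span2; exists 1, 0; rewrite scale1r scale0r addr0.
  move=> w /memv_span3[x [y [c ->]]]; have [_ zz] := fsub_valP z.
  have := tri_line_plane 1 0 x y c (adapted_tangent az); rewrite scale1r scale0r addr0 /= => ->.
  by rewrite zz; ring.
have [th [mth thE]] := near_morph_contact lrZ mg (vreg_pt_val i0 z0) u0 nu.
pose R (b : contact f) (z : A) := pt i0 z \in vsp (set_val (contact_point b)) /\
  adapted (contact_to_Ftilde b) (pt i0 z) (pt i1 z) (pt i2 z).
have Rinj b b' z : R b z -> R b' z -> b = b'.
  move=> [xb ab] [xb' ab']; apply: contact_inj; first exact: adapted_inj ab ab'.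
  have p0 : pt i0 z != 0 by have [frb _ _] := ab; exact: free3_neq0 frb.
  by rewrite (span1_eq p0 xb) (span1_eq p0 xb').
have Rv : \forall b \near b0, R b (v b) by apply: near_imp ad => b; rewrite /R !pt_pack.
have Rth : \forall z \near z0, R (th z) (set_val z).
  by apply: near_imp2 gE thE => z gz [Ez xz]; split=> //; rewrite Ez.
have sec := near_section mv Rinj nZ Rv Rth.
have [P [Q [Q0 QP nQ]]] := regular_fraction mv (near_morph_at mth) sec ra.
have th0 : th z0 = b0.
  by have [Zy thy] := nbhs_singleton sec; rewrite -[RHS]thy; congr th; apply: fsub_inj; rewrite !fsub_mkK.
have [cth _] := near_morph_at mth; rewrite th0 in cth.
have [N nN NE] := fsub_nearE (filterI (filterI (cth _ a0) (cth _ ad)) Rth).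
rewrite z0E in nN; have [q [q0 qN]] := aff_nbhs_basis nN.
have tz : triple_zero f (v0 b0) (v1 b0) (v2 b0) by have [? ?] := adapted_tangent ad0; split.
have frv : free3 (pt i0 (v b0)) (pt i1 (v b0)) (pt i2 (v b0)) by rewrite !pt_pack.
have tzv : triple_zero f (pt i0 (v b0)) (pt i1 (v b0)) (pt i2 (v b0)) by rewrite !pt_pack.
have t222 := plane_not_contained npl frv tzv.
have gz0 (i : 'I_8) : (frame_eqs f i).@[(v b0 : 'rV_n) ord0] = 0 by exact: frame_eqs_zero.
have jac := frame_eqs_free frv tzv t222 nsing ndeg (isT : (8 <= 9)%N).
have qQ0 : (q * Q).@[(v b0 : 'rV_n) ord0] != 0 by rewrite mevalM mulf_neq0.
have van : germ_ideal ((v b0 : 'rV_n) ord0) (gen_ideal (@frame_eqs K f 8)) (P * gp f (i1, i2, i2)).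
  apply: (smooth_vanishing Kunc gz0 jac qQ0) => z' gz.
  pose z : A := \row_i z' i; have -> : z' = (z : 'rV_n) ord0 by apply/funext => i; rewrite mxE.
  have {gz} gz i : (i < 8)%N -> (gp f (frame_monomial i)).@[(z : 'rV_n) ord0] = 0.
    move=> i8; rewrite -[RHS](gz (Ordinal i8)); apply: meval_eq => j; by rewrite mxE.
  rewrite mevalM mulf_eq0 negb_or => /andP[qz Qz].
  have Zz : Z8 z.
    split; first by apply/frame_eqs_tangent => i i7; apply: gz; apply: leq_trans i7 _.
    by have := gz 7 isT; rewrite gpE.
  have zE : set_val (fsub_mk Zz : fsub Z8) = z by rewrite fsub_mkK.
  have [|[/= hz [xv av]] [xp ap]] := NE (fsub_mk Zz); first by rewrite zE; apply: qN.
  rewrite zE in xp ap.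
  have := QP (fsub_mk Zz); rewrite zE => /(_ Qz) aE.
  move/eqP: hz; rewrite mulf_eq0 mevalM gpE /tp /= => /orP[/eqP az|/eqP sz].
    by move/esym/eqP: aE; rewrite az mulf_eq0 invr_eq0 (negPf Qz) orbF => /eqP->; rewrite mul0r.
  (* The vanishing factor was computed in the frame [v] and the ninth equation in the frame z of the
     same flag; they are compared through membership in [Vtilde]. *)
  suff Vz : Vtilde f (contact_to_Ftilde (th (fsub_mk Zz))).
    by have [_ ->] := (Vtilde_adapted npl ap).1 Vz; rewrite mulr0.
  apply/(Vtilde_adapted npl av); split=> //; apply: (contactP xv); have [_ _ ->] := av.
  by apply/memv_span3; exists 0, 0, 1; rewrite !scale0r scale1r !add0r.
have [[q2 [q20 [c cE]]]|no] := smooth_local_prime gz0 jac van; last first.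
  by case: (last_eq_not_in_ideal frv tzv t222 nsing ndeg no).
have rv i : regular_at (fun b => (v b : 'rV_n) ord0 i) b0.
  by have [_ H] := mv; apply: (H (fun z : A => (z : 'rV_n) ord0 i)); exact: aff_regular_coord.
apply: near_imp3 nZ nQ (lr_neq0 lrB (lr_meval lrB q2 rv) q20) => b [tb sb] [Qb ->] q2b.
have := congr1 (fun P => P.@[(v b : 'rV_n) ord0]) cE; rewrite /= mevalM meval_sum big1.
  by move/eqP; rewrite mulf_eq0 (negPf q2b) => /eqP->; rewrite mul0r.
move=> i _; rewrite mevalM; apply/eqP; rewrite mulf_eq0; apply/orP; right; apply/eqP.
case: (ltnP i 7) => i7; first exact: ((frame_eqs_tangent _).1 tb i i7).
have -> : frame_eqs f i = gp f (i0, i2, i2).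
  by rewrite /frame_eqs (_ : nat_of_ord i = 7%N) //; apply/eqP; rewrite eqn_leq i7 -ltnS ltn_ord.
by rewrite gpE.
Qed.

End AtContact.
End LocalEquations.

(** * Inverse images that are Cartier divisors *)

Section CartierPreimage.
Variable K : fieldType.
Implicit Types T Y : fspace K.

Lemma inverse_ideal_regular T Y (lrT : locally_ringed T) (g : T -> Y) (Z : set Y) (t : T) h :
  morph_at g t -> inverse_ideal_at g Z t h -> regular_at h t.
Proof.
move=> [_ rg] [n [a [b [rab hE]]]].
apply: (regular_eq (h := fun s => \sum_(i < n) a i s * b i (g s))).
  by apply: near_imp hE => s ->.
apply: lr_sum => // i _; have [ra [rb _]] := rab i.
by apply: lr_mul => //; exact: rg rb.
Qed.

Lemma inverse_ideal_off T Y (lrT : locally_ringed T) (lrY : locally_ringed Y) (g : T -> Y) (Z : set Y)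
    (t : T) h : closed Z -> ~ Z (g t) -> regular_at h t -> inverse_ideal_at g Z t h.
Proof.
move=> cZ nZ rh; exists 1%N, (fun=> h), (fun _ _ => 1); split.
  move=> i; split=> //; split; first exact: lr_cst.
  have oZ : open_nbhs (g t) (~` Z) by split=> //; rewrite openC.
  by apply: near_imp (open_nbhs_nbhs oZ) => y nZy /nZy.
by apply: near_all => s; rewrite big_ord1 mulr1.
Qed.

Lemma cartier_preimage_off T Y (lrT : locally_ringed T) (lrY : locally_ringed Y) (g : T -> Y) (Z : set Y)
    (t : T) : closed Z -> morph_at g t -> ~ Z (g t) ->
  exists e : T -> K, nonzerodivisor_at e t /\
    forall h : T -> K, inverse_ideal_at g Z t h <->
      exists a : T -> K, regular_at a t /\ \forall s \near t, h s = a s * e s.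
Proof.
move=> cZ mg nZ; exists (fun=> 1); split.
  by split=> [|a _]; [exact: lr_cst|apply: near_imp => s; rewrite mulr1].
move=> h; split=> [/(inverse_ideal_regular lrT mg) rh|[a [ra hE]]].
  by exists h; split=> //; apply: near_all => s; rewrite mulr1.
apply: inverse_ideal_off => //; apply: regular_eq ra.
by apply: near_imp hE => s ->; rewrite mulr1.
Qed.

(** If g mapped a neighbourhood of t into Z, every element of the inverse image ideal would vanish
    near t, in particular the local equation e; but e is a nonzerodivisor. *)
Lemma cartier_preimage_dense T Y (lrT : locally_ringed T) (g : T -> Y) (Z : set Y) :
  (forall t, morph_at g t) -> cartier_preimage g Z ->
  forall (t : T) P, nbhs t P -> exists2 s, P s & ~ Z (g s).
Proof.
move=> mg cg t P nP; apply: contrapT => no.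
have nZ : \forall s \near t, Z (g s).
  by apply: near_imp nP => s Ps; apply: contrapT => nZ; apply: no; exists s.
have [e [[re nze] eP]] := cg t; have [cgt _] := mg t.
have [n [a [b [rab eE]]]] : inverse_ideal_at g Z t e.
  apply/eP; exists (fun=> 1); split; first exact: lr_cst.
  by apply: near_all => s; rewrite mul1r.
have nb : \forall s \near t, forall i, Z (g s) -> b i (g s) = 0.
  by apply: near_forall_fin => i; have [_ [_ nbi]] := rab i; exact: (cgt _ nbi).
have e0 : \forall s \near t, 1 * e s = 0.
  apply: near_imp3 nZ eE nb => s Zs -> bs.
  by rewrite mul1r big1 // => i _; rewrite bs ?mulr0.
have /nbhs_singleton/eqP := nze (fun=> 1) (lr_cst lrT _ _) e0.
by rewrite oner_eq0.
Qed.

End CartierPreimage.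

(** * The inverse image of [Vtilde] in the contact locus *)

Section Blowup.
Variable K : numClosedFieldType.
Hypothesis Kunc : uncountable_field K.
Local Notation V := 'rV[K]_6.
Variable f : dhomog 6 K 3.
Hypothesis good : good_cubic f.
Local Notation t := (tri f).
Local Notation i0 := (@Ordinal 3 0 isT).
Local Notation i1 := (@Ordinal 3 1 isT).
Implicit Types T : fspace K.

Let npl : ~ has_plane f. Proof. by case: good. Qed.

(** Cramer's rule in two of the linear forms dual to the frame at s; their determinant [D] is 1 at
    s, hence a unit nearby. *)
Lemma span2_coefficient T (lrT : locally_ringed T) (p q u : T -> V) s r :
  vreg_at p s -> vreg_at q s -> vreg_at u s -> free3 (p s) (q s) r ->
  (\forall z \near s, u z \in vspan (fam2 (p z) (q z))) ->
  exists a b : T -> K, [/\ regular_at a s, regular_at b s &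
    \forall z \near s, u z = a z *: p z + b z *: q z].
Proof.
move=> rp rq ru fr nu; have [a aE] := dual_frame fr.
pose l0 z := a i0 z; pose l1 z := a i1 z.
have reg (l : 'Hom(V, K^o)) (v : T -> V) : vreg_at v s -> regular_at (fun z => l (v z)) s.
  exact: (vreg_linear lrT (l : {linear V -> K^o})).
pose D z := l0 (p z) * l1 (q z) - l0 (q z) * l1 (p z).
have rD : regular_at D s by apply: lr_sub => //; apply: lr_mul => //; apply: reg.
have D0 : D s != 0.
  have [p0 p1 _] := aE 1 0 0; have [q0 q1 _] := aE 0 1 0.
  move: p0 p1 q0 q1; rewrite !scale1r !scale0r !addr0 add0r => p0 p1 q0 q1.
  by rewrite /D /l0 /l1 p0 p1 q0 q1 mul1r mul0r subr0 oner_neq0.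
exists (fun z => (l0 (u z) * l1 (q z) - l0 (q z) * l1 (u z)) / D z).
exists (fun z => (l0 (p z) * l1 (u z) - l0 (u z) * l1 (p z)) / D z).
split; [by apply: lr_div => //; apply: lr_sub => //; apply: lr_mul => //; apply: reg..|].
apply: near_imp2 nu (lr_neq0 lrT rD D0) => z /memv_span2[x [y E]] Dz.
have E0 : l0 (u z) = x * l0 (p z) + y * l0 (q z) by rewrite /l0 E linearD !linearZ.
have E1 : l1 (u z) = x * l1 (p z) + y * l1 (q z) by rewrite /l1 E linearD !linearZ.
rewrite {1}E E0 E1; congr (_ *: _ + _ *: _); apply: (mulIf Dz); rewrite divfK // /D; ring.
Qed.

Lemma frame_at (y0 : Ftilde f) p : p \in vsp (line_of y0) -> p != 0 ->
  exists w0 w1 w2 : Ftilde f -> V, [/\ vreg_at w0 y0, vreg_at w1 y0, vreg_at w2 y0, w0 y0 = p &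
    \forall y \near y0, adapted y (w0 y) (w1 y) (w2 y)].
Proof.
move=> pL p0; have [q [u ad]] := adapted_exists pL p0.
have [w [rw wE nw]] := vreg_lift pL; have [cL _] := morph_line_of y0.
have r0 : vreg_at (fun y : Ftilde f => w (line_of y)) y0 := vreg_comp (morph_line_of y0) rw.
rewrite -wE in ad.
have [w1 [w2 [r1 r2 _ _ n]]] := near_adapted (lr_Ftilde f) (g := id) (morph_at_id y0) r0 (cL _ nw) ad.
by exists (fun y => w (line_of y)), w1, w2; split.
Qed.

Lemma gr_nonzero k (W : Gr V k.+1) : exists2 p, p \in vsp W & p != 0.
Proof.
have : vsp W != 0%VS by rewrite -dimv_eq0 dim_vsp.
by exists (vpick (vsp W)); [exact: memv_pick|rewrite vpick0].
Qed.

Lemma morph_contact_point (b : contact f) :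
  morph_at (fun b : contact f => set_val (contact_point b) : Gr V 1) b.
Proof.
apply: (morph_at_comp (g := set_val \o (set_val : contact f -> Itilde f)) (k := fun p : vprod (Xf f)
    (Ftilde f) => set_val p.1 : Gr V 1)).
  by apply: morph_at_comp; exact: morph_val.
exact: point_XF.
Qed.

Lemma Vtilde_equations_ideal (y0 : Ftilde f) (w0 w1 w2 : Ftilde f -> V) :
  vreg_at w0 y0 -> vreg_at w1 y0 -> vreg_at w2 y0 ->
  (\forall y \near y0, adapted y (w0 y) (w1 y) (w2 y)) ->
  ideal_at (Vtilde f) y0 (fun y => t (w0 y) (w2 y) (w2 y)) /\
  ideal_at (Vtilde f) y0 (fun y => t (w1 y) (w2 y) (w2 y)).
Proof.
move=> r0 r1 r2 ad; have lrF := lr_Ftilde f.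
by split; (split; first exact: regular_tri); apply: near_imp ad => y ay /(Vtilde_adapted npl ay)[].
Qed.

(** Let u be a section spanning the contact point, so that T(u, w2, w2) = 0. Writing w0 = c u + c'
    w1 gives s_0 = c' s_1, so both generators of the ideal become multiples of s_1, which is a
    nonzerodivisor. *)
Lemma contact_cartier : cartier_preimage (@contact_to_Ftilde K f) (Vtilde f).
Proof.
move=> b0; have lrB := lr_contact f; have lrF := lr_Ftilde f.
have mb := morph_contact_to_Ftilde b0.
case: (pselect (Vtilde f (contact_to_Ftilde b0))) => [b0V|nV]; last first.
  by apply: cartier_preimage_off => //; exact: closed_Vtilde.
have [p px p0] := gr_nonzero (set_val (contact_point b0)).
have [w0 [w1 [w2 [r0 r1 r2 w0E ad]]]] := frame_at (subvP (contact_sub b0) _ px) p0.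
have [v0 [rv0 v0E nv0]] := vreg_lift px.
pose u (b : contact f) := v0 (set_val (contact_point b)).
have [cb rb] := mb; have [cx _] := morph_contact_point b0.
have ru : vreg_at u b0 := vreg_comp (morph_contact_point b0) rv0.
have R (v : Ftilde f -> V) : vreg_at v (contact_to_Ftilde b0) -> vreg_at (v \o @contact_to_Ftilde K f)
    b0 := vreg_comp mb.
have [fr EL EP] := nbhs_singleton ad.
have fru : free3 (u b0) (w1 (contact_to_Ftilde b0)) (w2 (contact_to_Ftilde b0)) by rewrite /u v0E -w0E.
have nad : \forall b \near b0, adapted (contact_to_Ftilde b) (w0 (contact_to_Ftilde b))
    (w1 (contact_to_Ftilde b)) (w2 (contact_to_Ftilde b)) := cb _ ad.
have nu : \forall b \near b0, u b \in vsp (set_val (contact_point b)) := cx _ nv0.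
have adu : \forall b \near b0, u b \in vsp (set_val (contact_point b)) /\
    adapted (contact_to_Ftilde b) (u b) ((w1 \o @contact_to_Ftilde K f) b) ((w2 \o @contact_to_Ftilde K f) b).
  apply: near_imp3 nu nad (near_free3 lrB ru (R _ r1) (R _ r2) fru) => b ub [_ EL' EP'] frb.
  split=> //; apply: adapted_of_mem => //; first exact: (subvP (contact_sub b)).
    by rewrite EL'; apply/memv_span2; exists 0, 1; rewrite scale1r scale0r add0r.
  by rewrite EP'; apply/memv_span3; exists 0, 0, 1; rewrite !scale0r scale1r !add0r.
have nzd := contact_nonzerodivisor Kunc good ru (R _ r1) (R _ r2) adu b0V.
exists (fun b => t (w1 (contact_to_Ftilde b)) (w2 (contact_to_Ftilde b)) (w2 (contact_to_Ftilde b))).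
split=> // h.
have [I0 I1] := Vtilde_equations_ideal r0 r1 r2 ad.
split=> [[n [a [b [rab hE]]]]|[a [ra hE]]]; last first.
  exists 1%N, (fun=> a), (fun _ y => t (w1 y) (w2 y) (w2 y)); split=> //.
  by apply: near_imp hE => z ->; rewrite big_ord1.
have nw0 : \forall b \near b0, w0 (contact_to_Ftilde b) \in vspan (fam2 (u b) (w1 (contact_to_Ftilde b))).
  apply: near_imp2 adu nad => z [_ [_ <- _]] [_ -> _].
  by apply/memv_span2; exists 1, 0; rewrite scale1r scale0r addr0.
have [c [c' [rc rc' cE]]] := span2_coefficient lrB ru (R _ r1) (R _ r0) fru nw0.
have each i : exists d, regular_at d b0 /\ \forall s \near b0,
    a i s * b i (contact_to_Ftilde s) = d s * t (w1 (contact_to_Ftilde s)) (w2 (contact_to_Ftilde s))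
        (w2 (contact_to_Ftilde s)).
  have [ra bI] := rab i.
  have [d0 [d1 [rd0 rd1 bE]]] := ideal_Vtilde_generators Kunc good r0 r1 r2 ad bI.
  exists (fun s => a i s * (d0 (contact_to_Ftilde s) * c' s + d1 (contact_to_Ftilde s))); split.
    by apply: lr_mul => //; apply: lr_add => //; [apply: lr_mul => //|]; exact: rb.
  apply: near_imp3 (cb _ bE : \forall s \near b0, _) cE adu => s /= -> cs [us [_ _ EPs]].
  rewrite cs triE triZ1 triZ1 (contactP us).
    by ring.
  by rewrite EPs; apply/memv_span3; exists 0, 0, 1; rewrite !scale0r scale1r !add0r.
have [d dP] := choice each.
exists (fun s => \sum_i d i s); split; first by apply: lr_sum => // i _; have [] := dP i.
have nd : \forall s \near b0, forall i, a i s * b i (contact_to_Ftilde s) =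
    d i s * t (w1 (contact_to_Ftilde s)) (w2 (contact_to_Ftilde s)) (w2 (contact_to_Ftilde s)).
  by apply: near_forall_fin => i; have [] := dP i.
by apply: near_imp2 hE nd => s -> ds; rewrite mulr_suml; apply: eq_bigr.
Qed.

End Blowup.

(** * The universal property of the contact locus and the resolution *)

Section Resolution.
Variable K : numClosedFieldType.
Hypothesis Kunc : uncountable_field K.
Local Notation V := 'rV[K]_6.
Variable f : dhomog 6 K 3.
Hypothesis good : good_cubic f.
Local Notation t := (tri f).
Local Notation beta0 := (@contact_to_Ftilde K f).
Implicit Types T : fspace K.

Let npl : ~ has_plane f. Proof. by case: good. Qed.

(** Off [Vtilde] a contact point is determined by its image in [Ftilde]; separatedness extends the
    equality to s. *)
Lemma contact_agree T (lrT : locally_ringed T) (g1 g2 : T -> contact f) s :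
  morph_at g1 s -> morph_at g2 s -> (\forall z \near s, beta0 (g1 z) = beta0 (g2 z)) ->
  (forall P, nbhs s P -> exists2 z, P z & ~ Vtilde f (beta0 (g1 z))) -> g1 s = g2 s.
Proof.
move=> m1 m2 E D; have [sB _] := variety_contact f; apply: (separated_agree lrT sB m1 m2) => P nP.
by have [z [Pz Ez] nV] := D _ (filterI nP E); exists z => //; exact: contact_inj_off Ez nV.
Qed.

(* If the two equations of [Vtilde] pull back to [a0 * e] and [a1 * e], then
   [a0], [a1] generate the unit ideal, and the lift of [g] is given by the point
   [a1 w0 - a0 w1] of the line. *)
Lemma contact_local_lift T (lrT : locally_ringed T) (g : T -> Ftilde f) s :
  (forall z, morph_at g z) ->
  (exists e : T -> K, nonzerodivisor_at e s /\
    forall h : T -> K, inverse_ideal_at g (Vtilde f) s h <->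
      exists a : T -> K, regular_at a s /\ \forall z \near s, h z = a z * e z) ->
  exists k : T -> contact f, near_morph k s /\ \forall z \near s, beta0 (k z) = g z.
Proof.
move=> mg [e [[re nze] eP]]; have [p pL p0] := gr_nonzero (line_of (g s)).
have [w0 [w1 [w2 [r0 r1 r2 _ ad]]]] := frame_at pL p0.
have [I0 I1] := Vtilde_equations_ideal good r0 r1 r2 ad.
have [cg rg] := mg s.
have I w : ideal_at (Vtilde f) (g s) w -> inverse_ideal_at g (Vtilde f) s (w \o g).
  move=> Iw; exists 1%N, (fun _ _ => 1), (fun=> w); split; first by move=> i; split=> //; exact: lr_cst.
  by apply: near_all => z; rewrite big_ord1 mul1r.
have [a0 [ra0 E0]] := (eP _).1 (I _ I0); have [a1 [ra1 E1]] := (eP _).1 (I _ I1).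
have nad : \forall z \near s, adapted (g z) (w0 (g z)) (w1 (g z)) (w2 (g z)) := cg _ ad.
(* The local equation e is itself a combination of a0 e and a1 e; cancelling the nonzerodivisor e
   writes 1 as a combination of a0 and a1. *)
have a01 : a0 s != 0 \/ a1 s != 0.
  have [n [a [b [rab eE]]]] : inverse_ideal_at g (Vtilde f) s e.
    apply/eP; exists (fun=> 1); split; first exact: lr_cst.
    by apply: near_all => z; rewrite mul1r.
  have each i : exists d, [/\ regular_at d.1 s, regular_at d.2 s & \forall z \near s,
      a i z * b i (g z) = (d.1 z * a0 z + d.2 z * a1 z) * e z].
    have [ra bI] := rab i.
    have [d0 [d1 [rd0 rd1 bE]]] := ideal_Vtilde_generators Kunc good r0 r1 r2 ad bI.
    exists (fun z => a i z * d0 (g z), fun z => a i z * d1 (g z)); split=> /=.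
    - by apply: lr_mul => //; exact: rg rd0.
    - by apply: lr_mul => //; exact: rg rd1.
    - apply: near_imp3 (cg _ bE : \forall z \near s, _) E0 E1 => z /= -> /= -> ->; ring.
  have [d dP] := choice each.
  pose c z := \sum_i ((d i).1 z * a0 z + (d i).2 z * a1 z).
  have rc : regular_at c s.
    by apply: lr_sum => // i _; have [rd0 rd1 _] := dP i; apply: lr_add => //; exact: lr_mul.
  have ce : \forall z \near s, (c z - 1) * e z = 0.
    have nd : \forall z \near s, forall i, a i z * b i (g z) = ((d i).1 z * a0 z + (d i).2 z * a1 z) * e z.
      by apply: near_forall_fin => i; have [] := dP i.
    apply: near_imp2 eE nd => z ez dz; rewrite mulrBl mul1r {2}ez mulr_suml.
    by apply/eqP; rewrite subr_eq0; apply/eqP/eq_bigr => i _; rewrite dz.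
  have /nbhs_singleton cs := nze (fun z => c z - 1) (lr_sub lrT rc (lr_cst lrT _ _)) ce.
  have [a0s|] := eqVneq (a0 s) 0; last by left.
  have [a1s|] := eqVneq (a1 s) 0; last by right.
  move/eqP: cs; rewrite /c big1 ?sub0r ?oppr_eq0 ?oner_eq0 // => i _.
  by rewrite a0s a1s !mulr0 addr0.
have r w : vreg_at w (g s) -> vreg_at (fun z => w (g z) : V) s by exact: (vreg_comp (mg s)).
pose u z := a1 z *: w0 (g z) + (- a0 z) *: w1 (g z).
have ru : vreg_at u s.
  apply: vreg_add => //; apply: vreg_scale => //; try exact: r.
  exact: lr_opp.
have u0 : u s != 0.
  have [fr _ _] := nbhs_singleton nad; apply/eqP => /(free3_free2 fr)[a1s /eqP].
  by rewrite oppr_eq0; case: a01; [move=> /negPf->|rewrite a1s eqxx].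
have nu : \forall z \near s, u z \in vsp (line_of (g z)) /\
    forall w, w \in vsp (plane_of (g z)) -> t (u z) w w = 0.
  apply: near_imp3 nad E0 E1 => z az /= E0z E1z; have [_ -> ->] := az; split.
    by apply/memv_span2; exists (a1 z), (- a0 z).
  move=> w /memv_span3[x [y [c ->]]].
  by have := tri_line_plane (a1 z) (- a0 z) x y c (adapted_tangent az); rewrite /= E0z E1z => ->; ring.
have [k [mk kE]] := near_morph_contact lrT (near_morphW s mg) ru u0 nu.
by exists k; split=> //; apply: near_imp kE => z [].
Qed.

(** The local lifts [k s] are glued along the diagonal, as [k s s]. Near s this agrees with the
    single lift [k s], because two lifts agree off the inverse image of [Vtilde], whose complement
    is dense. *)
Lemma contact_lift T (lrT : locally_ringed T) (g : T -> Ftilde f) :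
  (forall z, morph_at g z) -> cartier_preimage g (Vtilde f) ->
  exists k : T -> contact f, (forall z, morph_at k z) /\ forall z, beta0 (k z) = g z.
Proof.
move=> mg cg; have D := cartier_preimage_dense lrT mg cg.
have loc s : exists k : T -> contact f, near_morph k s /\ \forall z \near s, beta0 (k z) = g z.
  exact: contact_local_lift.
have [k kP] := choice loc.
have E s : beta0 (k s s) = g s by have [_ /nbhs_singleton] := kP s.
exists (fun s => k s s); split=> // s; have [mk kE] := kP s.
apply: (morph_at_eq _ (near_morph_at mk)).
apply: near_imp2 mk (near_near kE) => z mkz kEz; have [mk' kE'] := kP z.
apply: (contact_agree lrT mkz (near_morph_at mk')).
  by apply: near_imp2 kEz kE' => z' -> ->.
move=> P nP; have [z' [Pz' Ez'] nV] := D z _ (filterI nP kEz).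
by exists z' => //; rewrite Ez'.
Qed.

Lemma contact_is_blowup : is_blowup beta0 (Vtilde f).
Proof.
split; first exact: variety_contact.
- by apply/morphismP => b; exact: morph_contact_to_Ftilde.
- exact: contact_cartier.
move=> T g vT /morphismP mg cg; have lrT := lr_variety vT.
have [k [mk kE]] := contact_lift lrT mg cg; exists k; split.
  by split; [apply/morphismP|apply/funext => z; exact: kE].
move=> k' [/morphismP mk' k'E]; apply/funext => s; apply: (contact_agree lrT (mk s) (mk' s)).
  by apply: near_all => z; rewrite kE -k'E.
by move=> P nP; have [z Pz nV] := cartier_preimage_dense lrT mg cg nP; exists z => //; rewrite kE.
Qed.

(** Over [Vtilde] every point p of the line is a contact point; it is produced by the local
    construction applied to constant maps. *)
Lemma contact_over_Vtilde (y : Ftilde f) : Vtilde f y -> exists b, beta0 b = y.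
Proof.
move=> /(VtildeP npl) yV; have lrF := lr_Ftilde f; have [p pL p0] := gr_nonzero (line_of y).
have [k [_ /nbhs_singleton[ky _]]] := near_morph_contact lrF (g := fun=> y) (u := fun=> p) (s := y)
  (near_morphW y (fun s => morph_at_cst lrF y s)) (vreg_cst lrF p y) p0
  (near_all _ (fun z => conj pL (fun w wP => yV p w pL wP))).
by exists (k y).
Qed.

(** Each point of [Vtilde] lifts to the contact locus, where the inverse image of [Vtilde] is
    Cartier and so has dense complement; the images of nearby points approach the given one. *)
Lemma dense_off_Vtilde : dense (~` Vtilde f).
Proof.
move=> O [y Oy] oO; case: (pselect (Vtilde f y)) => [yV|nV]; last by exists y.
have [b by0] := contact_over_Vtilde yV; have [cb _] := morph_contact_to_Ftilde b.
have nO : nbhs (beta0 b) O by rewrite by0; apply: open_nbhs_nbhs.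
have [b' Ob' nV] := cartier_preimage_dense (lr_contact f) (@morph_contact_to_Ftilde K f)
  (contact_cartier Kunc good) (cb _ nO).
by exists (beta0 b').
Qed.

Lemma open_off_Vtilde : open (~` Vtilde f).
Proof. by rewrite openC; exact: closed_Vtilde. Qed.

(** Over the complement of [Vtilde] the inverse image of [Vtilde] is empty, hence Cartier with
    equation 1. Lifting the inclusion thus makes the residual point a morphism. *)
Lemma exists_residual_map : exists psi : fsub (~` Vtilde f) -> contact f,
  (forall y, morph_at psi y) /\ forall y, beta0 (psi y) = set_val y.
Proof.
have lrU : locally_ringed (fsub (~` Vtilde f)) by apply: lr_fsub; exact: lr_Ftilde.
apply: (contact_lift lrU (g := set_val)); first by move=> y; exact: morph_val.
move=> y; apply: (cartier_preimage_off lrU (lr_Ftilde f)); [exact: closed_Vtilde|exact: morph_val|].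
exact: (fsub_valP y).
Qed.

Lemma blowup_iso (B B' Y : fspace K) (beta : B -> Y) (beta' : B' -> Y) (Z : set Y) :
  is_blowup beta Z -> is_blowup beta' Z ->
  exists (k : B -> B') (k' : B' -> B), [/\ morphism k, morphism k', beta' \o k = beta,
    beta \o k' = beta' & cancel k k' /\ cancel k' k].
Proof.
move=> [vB mb cb uB] [vB' mb' cb' uB'].
have [k [[mk kE] _]] := uB' _ _ vB mb cb; have [k' [[mk' kE'] _]] := uB _ _ vB' mb' cb'.
have mkb := (morphismP k).1 mk; have mkb' := (morphismP k').1 mk'.
exists k, k'; split=> //; split=> b.
  have [i [_ iu]] := uB _ _ vB mb cb.
  have Ei : i = id by apply: iu; split=> //; apply/morphismP => ?; exact: morph_at_id.
  have Ek : i = k' \o k.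
    apply: iu; split; last by rewrite compA kE' kE.
    by apply/morphismP => ?; apply: morph_at_comp.
  by rewrite -[LHS]/((k' \o k) b) -Ek Ei.
have [i [_ iu]] := uB' _ _ vB' mb' cb'.
have Ei : i = id by apply: iu; split=> //; apply/morphismP => ?; exact: morph_at_id.
have Ek : i = k \o k'.
  apply: iu; split; last by rewrite compA kE kE'.
  by apply/morphismP => ?; apply: morph_at_comp.
by rewrite -[LHS]/((k \o k') b) -Ek Ei.
Qed.

Lemma fsub_morphism (T S : fspace K) (A : set T) (C : set S) (g : T -> S) (h : fsub A -> fsub C) :
  (forall z, morph_at g z) -> (forall z, set_val (h z) = g (set_val z)) -> morphism h.
Proof.
move=> mg hE; apply/morphismP => z; apply: morph_fsub.
apply: (morph_at_eq (g := g \o (set_val : fsub A -> T))).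
  by apply: near_all => z' /=; rewrite hE.
by apply: morph_at_comp; [exact: morph_val|exact: mg].
Qed.

(** Every blowup is isomorphic to [contact] over [Ftilde], so Phi is this isomorphism followed by
    the inclusion into [Itilde]. Over a point of [Vtilde] the whole fibre of [Itilde] satisfies the
    contact condition, which identifies the fibres. *)
Lemma residual_map_resolution : exists psi : ratmap (Ftilde f) (Xf f),
    rdom psi = ~` (Vtilde f) /\
    (forall p : fsub (rdom psi), residual_point (set_val p) (psi p)) /\
  (exists (B : fspace K) (beta : B -> Ftilde f),
    is_blowup beta (Vtilde f)) /\
  forall (B : fspace K) (beta : B -> Ftilde f),
    is_blowup beta (Vtilde f) ->
  exists Phi : B -> Itilde f,
    [/\ morphism Phi,
        forall b : B, ~ Vtilde f (beta b) ->
          Itilde_to_Ftilde f (Phi b) = beta b /\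
          residual_point (beta b) (set_val (Phi b)).1,
        forall p : Ftilde f, Vtilde f p ->
          exists u : fsub (beta @^-1` [set p]) ->
                     fsub (Itilde_to_Ftilde f @^-1` [set p]),
            isomorphism u /\ forall b, set_val (u b) = Phi (set_val b) &
        resolves beta psi (I_to_X f \o Itilde_to_I f \o Phi)].
Proof.
have [s [ms sE]] := exists_residual_map.
have mcp (b : contact f) : morph_at (@contact_point K f) b.
  apply: (morph_at_comp (g := set_val \o (set_val : contact f -> Itilde f)) (k := fun p : vprod (Xf f)
      (Ftilde f) => p.1)).
    by apply: morph_at_comp; exact: morph_val.
  exact: fst_XF.
have mpsi : morphism (@contact_point K f \o s).
  by apply/morphismP => y; apply: morph_at_comp (ms y) (mcp _).
exists (RatMap open_off_Vtilde dense_off_Vtilde mpsi); split=> //; split.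
  move=> p; rewrite -sE; apply: (contact_residual npl); rewrite sE; exact: (fsub_valP p).
split; first by exists (contact f), beta0; exact: contact_is_blowup.
move=> B beta bB; have [k [k' [mk mk' kE kE' [kK kK']]]] := blowup_iso bB contact_is_blowup.
have [vB /morphismP mb cb _] := bB; have lrB := lr_variety vB.
have kb b : beta0 (k b) = beta b by rewrite -kE.
pose Phi := (set_val : contact f -> Itilde f) \o k.
have mPhi b : morph_at Phi b by apply: morph_at_comp; [exact: ((morphismP k).1 mk)|exact: morph_val].
exists Phi; split; first exact/morphismP.
- by move=> b nV; split; [exact: kb|rewrite -kb; apply: (contact_residual npl); rewrite kb].
- move=> p pV.
  have uP (b : fsub (beta @^-1` [set p])) : (Itilde_to_Ftilde f @^-1` [set p]) (Phi (set_val b)).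
    by rewrite /= -[LHS]/(beta0 (k (set_val b))) kb; exact: (fsub_valP b).
  have cP (q : fsub (Itilde_to_Ftilde f @^-1` [set p])) : contact_points f (set_val q).
    have qp : Itilde_to_Ftilde f (set_val q) = p := fsub_valP q.
    move=> v w vx; rewrite -[(set_val (set_val q)).2]/(Itilde_to_Ftilde f (set_val q)) qp.
    apply: (VtildeP npl p).1 => //; rewrite -qp.
    exact: (subvP (fsub_valP (set_val q))).
  pose c q : contact f := fsub_mk (cP q).
  have uP' (q : fsub (Itilde_to_Ftilde f @^-1` [set p])) : (beta @^-1` [set p]) (k' (c q)).
    by rewrite /= -[LHS]/((beta \o k') (c q)) kE' /contact_to_Ftilde fsub_mkK; exact: (fsub_valP q).
  exists (fun b => fsub_mk (uP b)); split; last by move=> b; rewrite fsub_mkK.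
  split; first by apply: (fsub_morphism mPhi) => b; rewrite fsub_mkK.
  exists (fun q => fsub_mk (uP' q)); split.
  + apply/morphismP => q; apply: morph_fsub; apply: (morph_at_eq (g := k' \o c)).
      by apply: near_all => q'; rewrite /= fsub_mkK.
    apply: morph_at_comp; last exact: ((morphismP k').1 mk').
    apply: morph_fsub; apply: (morph_at_eq (g := set_val : fsub (Itilde_to_Ftilde f @^-1` [set p]) ->
        Itilde f)).
      by apply: near_all => q'; rewrite fsub_mkK.
    exact: morph_val.
  + move=> b; apply: fsub_inj; rewrite fsub_mkK.
    have -> : c (fsub_mk (uP b)) = k (set_val b) by apply: fsub_inj.
    exact: kK.
  + by move=> q; apply: fsub_inj; rewrite fsub_mkK /Phi /= kK'.
- split.
  + apply/morphismP => b; apply: morph_at_comp (mPhi b) _; exact: morph_Itilde_to_X.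
  + move=> O [b Ob] oO; have nO : nbhs b O by apply: open_nbhs_nbhs.
    by have [b' Ob' nV] := cartier_preimage_dense lrB mb cb nO; exists b'.
  + move=> b y yb; have Es : s y = k b.
      by apply: (contact_inj_off npl); rewrite sE yb; [rewrite kb|have := fsub_valP y; rewrite -yb].
    by rewrite /= Es /I_to_X fsub_mkK.
Qed.

End Resolution.

Theorem corollary5p5 (R : realType) :
  exists U : set (cubics R[i]), open U /\ dense U /\
  forall (D : cubics R[i]) (f : dhomog 6 R[i] 3),
    U D -> f \in vsp D -> f != 0 ->
  exists psi : ratmap (Ftilde f) (Xf f),
    rdom psi = ~` (Vtilde f) /\
    (forall p : fsub (rdom psi), residual_point (set_val p) (psi p)) /\
  (exists (B : fspace R[i]) (beta : B -> Ftilde f),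
    is_blowup beta (Vtilde f)) /\
  forall (B : fspace R[i]) (beta : B -> Ftilde f),
    is_blowup beta (Vtilde f) ->
  exists Phi : B -> Itilde f,
    [/\ morphism Phi,
        forall b : B, ~ Vtilde f (beta b) ->
          Itilde_to_Ftilde f (Phi b) = beta b /\
          residual_point (beta b) (set_val (Phi b)).1,
        forall p : Ftilde f, Vtilde f p ->
          exists u : fsub (beta @^-1` [set p]) ->
                     fsub (Itilde_to_Ftilde f @^-1` [set p]),
            isomorphism u /\ forall b, set_val (u b) = Phi (set_val b) &
        resolves beta psi (I_to_X f \o Itilde_to_I f \o Phi)].
Proof.
have [U [oU dU UP]] := generic_good_cubic (@complex_uncountable R).
exists U; do 2!split=> //; move=> D f UD fD f0.
by have := residual_map_resolution (@complex_uncountable R) (UP D f UD fD f0).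
Qed.
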